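(* Let $T>0$ and consider the setting of the context: flow $\Phi^t$, invariant ergodic measure $\mu$, Koopman operators $U^t$ with generator $V$, and kernel integral operator $K_T$ on $L^2(\mu)$. Let $\phi$ and $\psi$ be mutually orthogonal, unit-norm, real eigenfunctions of $K_T$ corresponding to nonzero eigenvalues $\lambda_T$ and $\nu_T$, respectively, with $\lambda_T\le\nu_T$. Assume that $\lambda_T,\nu_T$ are simple if distinct and twofold-degenerate if equal. Define $$z=\frac{1}{\sqrt2}(\phi+i\psi),\qquad \alpha_t=\langle z,U^tz\rangle,\qquad \omega=\langle\psi,V\phi\rangle\equiv\frac1i\langle z,Vz\rangle\equiv\frac1i\,\dot\alpha_t\big|_{t=0},$$ where $\omega$ is real, and set $$\gamma_T=\min_{u\in\sigma_p(K_T)\setminus\{\lambda_T,\nu_T\}}\left\{\min\{|\lambda_T-u|,|\nu_T-u|\}\right\},\qquad \delta_T=\frac{1}{\sqrt2}(\nu_T-\lambda_T),\qquad \tilde\delta_T=\frac{\delta_T}{\nu_T}.$$ Then the following hold for every $t\ge0$: (i) The autocorrelation function $\alpha_t$ lies in the $\tilde\epsilon_t$-approximate point spectrum of $U^t$, and $z$ is a corresponding $\tilde\epsilon_t$-approximate eigenfunction (that is, $\|U^tz-\alpha_tz\|_{L^2(\mu)}\le\tilde\epsilon_t\|z\|_{L^2(\mu)}$), for the bound $$\tilde\epsilon_t=s_t+\sqrt{S_t},$$ where $$s_t=\frac{1}{\gamma_T}\left(\frac{C_1t}{T}+3\delta_T\right),\qquad S_t=\frac{C_2\|\mathcal V\|(1+\tilde\delta_T)}{\lambda_T}\int_0^ts_u\,du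 .$$ Here $\|\mathcal V\|$ is the norm of the dynamical vector field, viewed as a bounded operator $\mathcal V:C^1(M)\to C(M)$, and $C_1$ and $C_2$ are constants that depend only on the observation map $F$. Explicitly, $$C_1=2\|h\|_{C^1(\mathbb R_+)}\|d^2\|_{C(X\times X)},\qquad C_2=2\|h\|_{C^1(\mathbb R_+)}\|d^2\|_{C^1(M\times M)}.$$ (ii) The modulus $|\omega|$ is independent of the choice of real orthonormal basis $\{\phi,\psi\}$ for the eigenspace(s) corresponding to $\lambda_T$ and $\nu_T$. Moreover, the phase factor $e^{i\omega t}$ is related to the autocorrelation function according to the bound $$|\alpha_t-e^{i\omega t}|\le2\sqrt{S_t}.$$
   Context: Dynamical system. $\Phi^t:\Omega\to\Omega$, $t\in\mathbb R$, is a continuous-time, continuous flow on a metric space $\Omega$ possessing an invariant, ergodic Borel probability measure $\mu$ supported on a compact set $X\subseteq\Omega$. The support $X$ is contained in a forward-invariant, compact $C^1$ manifold $M$ such that $\Phi^t|_M$ is $C^1$; $X$ is not required to have differentiable structure. The system is observed through a continuous function $F:\Omega\to Y$, where $Y$ is a Banach space and the restriction of $F$ to $M$ is $C^1$. Operators. $\langle f,g\rangle=\int_\Omega f^*g\,d\mu$ is the inner product of (complex) $L^2(\mu)$, conjugate-linear in the first argument. The Koopman operators $U^t:L^2(\mu)\to L^2(\mu)$, $U^tf=f\circ\Phi^t$, form a unitary group generated by a skew-adjoint operator $V:D(V)\to L^2(\mu)$ with dense domain $D(V)$, so that $\frac{d}{dt}U^tf=VU^tf=U^tVf$ for $f\in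 D(V)$. $V$ is an extension of the directional derivative $\mathcal Vf=\vec V\cdot\nabla f$ on $C^1(M)$ functions associated with the vector field $\vec V$ generating $\Phi^t$. Kernel. $d(x,x')=\|F(x)-F(x')\|_Y$ and, for $T>0$, $d_T^2(x,x')=\frac1T\int_0^Td^2(\Phi^t(x),\Phi^t(x'))\,dt$, for $x,x'\in\Omega$. The shape function $h:\mathbb R_+\to\mathbb R_+$ is positive, $C^1$, and bounded, with bounded derivative. The kernel is $k_T(x,x')=h(d_T^2(x,x'))$, and $K_T:L^2(\mu)\to L^2(\mu)$ is the integral operator $K_Tf=\int_\Omega k_T(\cdot,x)f(x)\,d\mu(x)$. By symmetry and continuity of $k_T$ and compactness of $X$, $K_T$ is a positive-definite, self-adjoint, Hilbert-Schmidt operator, with eigenvalues $\lambda_{0,T}\ge\lambda_{1,T}\ge\cdots\searrow0$; $\sigma_p(K_T)=\{\lambda_{0,T},\lambda_{1,T},\ldots\}$ denotes its point spectrum. By continuous differentiability of $k_T$ and compactness of $X$, every element of the range of $K_T$ has a representative in $C^1(M)$. Norms. $C(\cdot)$ carries the uniform norm, and $C^1(\mathbb R_+)$, $C^1(M)$, $C^1(M\times M)$ carry the standard $C^1$ norms. Approximate spectrum. For a bound $\epsilon$, a nonzero $z\in L^2(\mu)$ is an $\epsilon$-approximate eigenfunction of $U^t$ corresponding to $a\in\mathbb C$, and $a$ lies in the $\epsilon$-approximate point spectrum of $U^t$, if $\|U^tz-az\|_{L^2(\mu)}\le\epsilon\|z\|_{L^2(\mu)}$.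
   Formalization: The three expressions for ω disagree in sign: (1/i)⟨z,Vz⟩ = −⟨ψ,Vφ⟩, and (ii) fails for ⟨ψ,Vφ⟩ (circle rotation, large T), so ω is taken as (1/i)⟨z,Vz⟩; d² in C¹(M×M) and positivity of K_T, asserted or presupposed in the setting, are explicit hypotheses. *)

(* Defs.v *)
From HB Require Import structures.
From mathcomp Require Import all_boot all_order all_algebra.
From mathcomp Require Import all_classical all_reals all_analysis.
From mathcomp Require Export complex.

Set Implicit Arguments.
Unset Strict Implicit.
Unset Printing Implicit Defensive.

Import Order.TTheory GRing.Theory Num.Theory.
Import numFieldNormedType.Exports.

Local Open Scope classical_set_scope.
Local Open Scope complex_scope.
Local Open Scope ring_scope.

(* MathComp-Analysis requires measurable types to be pointed; a space carrying
   a probability measure is nonempty, so this costs no generality. *)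
#[short(type="pmetricType")]
HB.structure Definition PMetric (K : numDomainType) :=
  {M of Metric K M & Pointed M}.

Notation normc := ComplexField.Normc.normc.
Notation borel Omega := (g_sigma_algebraType (@open Omega)).

Section C1.
Context {R : realType}.

(* The sets [A] below are relatively open subsets of half-spaces (or products
   of these), on which the derivative within [A] is unique. One-sided
   derivatives at boundary points are thus included. *)
Definition has_deriv_within (E G : normedModType R) (A : set E) (f : E -> G)
    (x : E) (L : E -> G) :=
  [/\ linear L, continuous L &
    forall e : R, 0 < e ->
      \forall y \near within A (nbhs x),
        `|f y - f x - L (y - x)| <= e * `|y - x|].

Definition deriv_within (E G : normedModType R) (A : set E) (f : E -> G)
    (x : E) : E -> G :=
  xget (cst 0) [set L | has_deriv_within A f x L].

(* Pointwise continuity of the derivative is norm continuity here, since [E]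
   is always finite-dimensional. *)
Definition C1_on (E G : normedModType R) (A : set E) (f : E -> G) :=
  exists Df : E -> E -> G,
    (forall x, A x -> has_deriv_within A f x (Df x)) /\
    (forall v, {within A, continuous (fun x => Df x v)}).

Definition opnorm (E G : normedModType R) (L : E -> G) : R :=
  sup [set `|L v| | v in [set v : E | `|v| <= 1]].

Definition supnorm (T : Type) (G : normedModType R) (A : set T) (f : T -> G)
    : R :=
  sup [set `|f x| | x in A].

Definition Rplus : set R^o := [set s | 0 <= s].

Definition C1norm_Rplus (h : R -> R) : R :=
  supnorm Rplus (h : R^o -> R^o)
  + sup [set opnorm (deriv_within Rplus (h : R^o -> R^o) s) | s in Rplus].

End C1.

Section manifold.
Context {R : realType}.

(* Finite atlas, together with subsets of the chart domains (the cores) over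
   which the derivatives in a chart are measured by the C^1 norm. *)
Record atlas (T : Type) (E : normedModType R) := Atlas {
  aidx : finType ;
  adom : aidx -> set T ;
  achart : aidx -> T -> E ;
  aparam : aidx -> E -> T ;
  acore : aidx -> set T }.

Arguments adom {T E} a i.
Arguments achart {T E} a i.
Arguments aparam {T E} a i.
Arguments acore {T E} a i.

Definition carrier T E (A : atlas T E) : set T :=
  [set x | exists i, adom A i x].

Definition prod_atlas T1 T2 E1 E2 (A1 : atlas T1 E1) (A2 : atlas T2 E2)
    : atlas (T1 * T2)%type (E1 * E2)%type :=
  {| aidx := (aidx A1 * aidx A2)%type ;
     adom := fun i => adom A1 i.1 `*` adom A2 i.2 ;
     achart := fun i x => (achart A1 i.1 x.1, achart A2 i.2 x.2) ;
     aparam := fun i y => (aparam A1 i.1 y.1, aparam A2 i.2 y.2) ;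
     acore := fun i => acore A1 i.1 `*` acore A2 i.2 |}.

(* All of R^n if [b] is false, and {y | y_0 >= 0} if [b] is true. *)
Definition halfspace n (b : bool) : set 'rV[R]_n :=
  [set y | forall i : 'I_n, b -> val i = 0%N -> 0 <= y ord0 i].

(* [A] makes the subset [M] of [T] a compact C^1 manifold, possibly with
   boundary, for the subspace topology. *)
Record compact_C1_manifold (T : topologicalType) n (M : set T)
    (A : atlas T 'rV[R]_n) : Prop := {
  dom_open : forall i, exists2 O : set T, open O & adom A i = M `&` O ;
  chartK : forall i x, adom A i x -> aparam A i (achart A i x) = x ;
  chart_cont : forall i, {within adom A i, continuous (achart A i)} ;
  param_cont : forall i,
    {within achart A i @` adom A i, continuous (aparam A i)} ;
  img_open : forall i, exists b, exists2 O : set 'rV[R]_n, open O &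
    achart A i @` adom A i = O `&` halfspace b ;
  transition : forall i j,
    C1_on (achart A i @` (adom A i `&` adom A j)) (achart A j \o aparam A i) ;
  core_compact : forall i, compact (acore A i) ;
  core_sub : forall i, acore A i `<=` adom A i ;
  core_cover : forall x, M x -> exists i, acore A i x }.

Definition C1fun T E (G : normedModType R) (A : atlas T E) (f : T -> G) :=
  forall i, C1_on (achart A i @` adom A i) (f \o aparam A i).

Definition dchart T E (G : normedModType R) (A : atlas T E) (i : aidx A)
    (f : T -> G) (x : T) : E -> G :=
  deriv_within (achart A i @` adom A i) (f \o aparam A i) (achart A i x).

(* The C^1 norm of a compact manifold is defined up to the choice of a finite
   family of charts and of compact cores covering the manifold. *)
Definition C1norm T E (G : normedModType R) (A : atlas T E) (f : T -> G) : R :=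
  supnorm (carrier A) f
  + sup [set r | exists i x, acore A i x /\ r = opnorm (dchart i f x)].

Definition C1selfmap T E (A : atlas T E) (g : T -> T) :=
  forall i j, C1_on (achart A i @` (adom A i `&` g @^-1` adom A j))
                    (achart A j \o g \o aparam A i).

(* [v i x] is the representation at [x], in the chart [i], of the vector
   field. *)
Definition generating_vector_field (T : topologicalType) E (A : atlas T E)
    (Phi : R -> T -> T) (v : aidx A -> T -> E) :=
  forall i,
    (forall x, adom A i x ->
       (fun t : R => t^-1 *: (achart A i (Phi t x) - achart A i x)) @ 0^'+
         --> v i x) /\
    {within adom A i, continuous (v i)}.

(* V . grad f, computed in a chart whose core contains the point; the value
   does not depend on that chart. *)
Definition dirderiv T E (A : atlas T E) (v : aidx A -> T -> E) (f : T -> R^o)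
    (x : T) : R^o :=
  if [pick i | `[< acore A i x >]] is Some i then dchart i f x (v i x)
  else 0.

Definition vfield_opnorm T E (A : atlas T E) (v : aidx A -> T -> E) : R :=
  sup [set supnorm (carrier A) (dirderiv v f)
      | f in [set f : T -> R^o | C1fun A f /\ C1norm A f <= 1]].

End manifold.

Section dynamics.
Context {R : realType} {Omega : pmetricType R}.
Implicit Types (Phi : R -> Omega -> Omega).
Implicit Types (mu : probability (borel Omega) R).

Definition is_flow Phi :=
  [/\ continuous (fun p : R * Omega => Phi p.1 p.2),
      forall x, Phi 0 x = x &
      forall s t x, Phi (s + t) x = Phi s (Phi t x)].

Definition invariant_measure mu Phi :=
  forall t (B : set (borel Omega)), measurable B -> mu (Phi t @^-1` B) = mu B.

Definition ergodic_measure mu Phi :=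
  forall B : set (borel Omega), measurable B ->
    (forall t, Phi t @^-1` B = B) -> mu B = 0%E \/ mu B = 1%E.

Definition msupport mu : set Omega :=
  [set x | forall U : set Omega, open U -> U x -> (0 < mu U)%E].

End dynamics.

Definition koopman {R : realType} (T : Type) (Phi : R -> T -> T) (t : R)
    (f : T -> R[i]) : T -> R[i] :=
  f \o Phi t.

(* Elements of complex L^2 are represented by functions; equality and
   linear independence are meant almost everywhere. *)

Section L2.
Context d (T : measurableType d) {R : realType} (mu : probability T R).
Implicit Types f g : T -> R[i].

Definition L2 f :=
  (@complex.Re R \o f) \in Lfun mu 2%:E /\ (@complex.Im R \o f) \in Lfun mu 2%:E.

Definition Cintegral f : R[i] :=
  (\int[mu]_x complex.Re (f x)) +i* (\int[mu]_x complex.Im (f x)).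

Definition inner f g : R[i] := Cintegral (fun x => (f x)^*%C * g x).

Definition l2norm f : R := Num.sqrt (\int[mu]_x (normc (f x) ^+ 2)).

Definition aeeq f g := {ae mu, forall x, f x = g x}.

Definition cfun (phi : T -> R) : T -> R[i] := fun x => (phi x)%:C.

Definition eigenfunction (K : (T -> R[i]) -> T -> R[i]) (u : R[i]) f :=
  L2 f /\ aeeq (K f) (fun x => u * f x).

Definition point_spectrum (K : (T -> R[i]) -> T -> R[i]) : set R[i] :=
  [set u | exists2 f, eigenfunction K u f & ~ aeeq f (cst 0)].

Definition has_multiplicity (K : (T -> R[i]) -> T -> R[i]) (u : R[i])
    (m : nat) :=
  exists e : 'I_m -> T -> R[i],
    [/\ forall i, eigenfunction K u (e i),
        forall c : 'I_m -> R[i],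
          aeeq (fun x => \sum_i c i * e i x) (cst 0) -> forall i, c i = 0 &
        forall f, eigenfunction K u f ->
          exists c : 'I_m -> R[i], aeeq f (fun x => \sum_i c i * e i x)].

Definition approx_eigenfunction (U : (T -> R[i]) -> T -> R[i]) (eps : R)
    (a : R[i]) f :=
  [/\ L2 f, ~ aeeq f (cst 0) &
      l2norm (fun x => U f x - a * f x) <= eps * l2norm f].

Definition approx_point_spectrum (U : (T -> R[i]) -> T -> R[i]) (eps : R)
    : set R[i] :=
  [set a | exists f, approx_eigenfunction U eps a f].

Definition koopman_deriv (Phi : R -> T -> T) f g :=
  L2 g /\
  (fun t : R => l2norm (fun x => (t^-1)%:C * (koopman Phi t f x - f x) - g x))
    @ 0^' --> (0 : R).

Definition koopman_gen_dom (Phi : R -> T -> T) : set (T -> R[i]) :=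
  [set f | L2 f /\ exists g, koopman_deriv Phi f g].

Definition koopman_gen (Phi : R -> T -> T) f : T -> R[i] :=
  xget (cst 0) [set g | koopman_deriv Phi f g].

Definition integral_operator (k : T -> T -> R) f : T -> R[i] :=
  fun x => Cintegral (fun y => (k x y)%:C * f y).

Definition real_eigenbasis (K : (T -> R[i]) -> T -> R[i]) (lam nu : R)
    (phi psi : T -> R) :=
  [/\ eigenfunction K lam%:C (cfun phi), eigenfunction K nu%:C (cfun psi),
      l2norm (cfun phi) = 1, l2norm (cfun psi) = 1 &
      inner (cfun phi) (cfun psi) = 0].

Definition zfun (phi psi : T -> R) : T -> R[i] :=
  fun x => ((Num.sqrt 2)^-1)%:C * (phi x +i* psi x).

Definition autocorr (Phi : R -> T -> T) (phi psi : T -> R) (t : R) : R[i] :=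
  inner (zfun phi psi) (koopman Phi t (zfun phi psi)).

(* As [inner] is conjugate-linear in its first argument, this is equal to
   <phi, V psi> = - <psi, V phi>. *)
Definition freq (Phi : R -> T -> T) (phi psi : T -> R) : R[i] :=
  'i%C^-1 * inner (zfun phi psi) (koopman_gen Phi (zfun phi psi)).

End L2.

Definition cexp {R : realType} (w : R[i]) : R[i] :=
  (expR (complex.Re w))%:C * (cos (complex.Im w) +i* sin (complex.Im w)).

Section kernel.
Context {R : realType} {Omega : Type} {Y : normedModType R}.
Variables (F : Omega -> Y) (Phi : R -> Omega -> Omega) (h : R -> R) (T : R).

Definition dsq (p : Omega * Omega) : R^o := `|F p.1 - F p.2| ^+ 2.

Definition dTsq (x x' : Omega) : R :=
  T^-1 * \int[lebesgue_measure]_(t in `[0, T]) dsq (Phi t x, Phi t x').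

Definition kT (x x' : Omega) : R := h (dTsq x x').

End kernel.

Definition spectral_gap {R : realType} (sp : set R[i]) (lam nu : R) : R :=
  inf [set Num.min (normc (lam%:C - u)) (normc (nu%:C - u))
      | u in sp `\` [set lam%:C; nu%:C]].

(* Main.v *)
Require Import Defs.
From mathcomp Require Import all_boot all_order all_algebra.
From mathcomp Require Import all_classical all_reals all_analysis.
From mathcomp Require Import measurable_realfun ring lra.
Set Implicit Arguments.
Unset Strict Implicit.
Unset Printing Implicit Defensive.
Import Order.TTheory GRing.Theory Num.Theory.
Import numFieldNormedType.Exports.
Local Open Scope classical_set_scope.
Local Open Scope ring_scope.

(* Work in real L^2(mu) and let W be the orthogonal complement of phi and psi,
   which K leaves invariant. Compactness and the multiplicity hypotheses give
   gamma ||f|| <= ||(K - nu) f|| for f in W. Since d_T(Phi^t x, Phi^t y)^2 and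
   d_T(x, y)^2 are averages over windows that overlap up to a length t, the
   commutator of K and U^t has norm at most C_1 t / T; hence the W-components
   of U^t phi and U^t psi have norm at most s_t. Division by the eigenvalue
   shows that phi and psi belong to the domain of V, with
   ||V phi|| <= ||h|| ||V|| ||d^2|| / lambda. As V is skew, alpha' equals
   i omega alpha up to an error at most ||V phi|| s_t, so exp(- i omega t)
   alpha_t stays within S_t / 2 of 1. Finally,
   ||U^t z - alpha_t z||^2 = 1 - |alpha_t|^2. *)

(** * Compact positive operators for a semi-inner product *)

(** Square-integrable functions are not identified almost everywhere, so the spectral theory is
    developed for a form that is only semidefinite, and its limits come from compactness of [K]
    instead of completeness. Real functions suffice: the kernel is real and symmetric, hence the
    spectrum is real, and the real and imaginary parts of an eigenfunction satisfy the same
    eigenvalue equation. Both [phi] and [psi] are tested against the same operator [K - nu]. It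
    annihilates [psi], while on [phi] it costs [nu - lam], that is sqrt 2 times delta, which is at
    most 3 delta. Adding the commutator bound and dividing by gamma gives s_t. The factor 2 in C_2
    comes from passing to the modulus: if exp(- i omega t) alpha_t is within p of 1, then 1 -
    |alpha_t|^2 <= 2 p, where p is the integral of s_u times the bound on ||V phi||. *)

Record semi_inner_product (R : realType) (E : lmodType R) (ip : E -> E -> R)
    : Prop := {
  ipC : forall x y, ip x y = ip y x ;
  ipDl : forall x y w, ip (x + y) w = ip x w + ip y w ;
  ipZl : forall a x y, ip (a *: x) y = a * ip x y ;
  ip_ge0 : forall x, 0 <= ip x x }.

Section semi_inner_product_theory.
Context {R : realType} {E : lmodType R} {ip : E -> E -> R}.
Hypothesis ipP : semi_inner_product ip.

Lemma ipDr x y w : ip w (x + y) = ip w x + ip w y.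
Proof. by rewrite (ipC ipP) (ipDl ipP) !(ipC ipP w). Qed.

Lemma ipZr a x y : ip x (a *: y) = a * ip x y.
Proof. by rewrite (ipC ipP) (ipZl ipP) (ipC ipP x). Qed.

Lemma ipNl x y : ip (- x) y = - ip x y.
Proof. by rewrite -scaleN1r (ipZl ipP) mulN1r. Qed.

Lemma ipNr x y : ip x (- y) = - ip x y.
Proof. by rewrite (ipC ipP) ipNl (ipC ipP x). Qed.

Definition ipE := (ipDr, ipDl ipP, ipNr, ipNl, ipZr, ipZl ipP).

Lemma ip_cauchy_schwarz x y : ip x y ^+ 2 <= ip x x * ip y y.
Proof.
have [y0|y0] := eqVneq (ip y y) 0.
  rewrite y0 mulr0; suff -> : ip x y = 0 by rewrite expr0n.
  apply/eqP; apply: contraT => xy0.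
  (* As [y] is null, the form at [x + t *: y] is affine in [t]; this [t] gives it the value -1. *)
  pose t := (- ip x x - 1) / (2 * ip x y).
  have := ip_ge0 ipP (x + t *: y).
  rewrite !ipE y0 (ipC ipP y x) /t [leRHS](_ : _ = -1); last by field.
  by rewrite oppr_ge0 ler10.
have yp : 0 < ip y y by rewrite lt_neqAle eq_sym y0 (ip_ge0 ipP).
have := ip_ge0 ipP (x - (ip x y / ip y y) *: y).
rewrite !ipE (ipC ipP y x).
rewrite [leRHS](_ : _ = (ip x x * ip y y - ip x y ^+ 2) / ip y y); last by field.
by rewrite pmulr_lge0 ?invr_gt0// subr_ge0.
Qed.

Lemma ip_null x y : ip x x = 0 -> ip x y = 0.
Proof.
move=> x0; have := ip_cauchy_schwarz x y; rewrite x0 mul0r => h.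
by apply/eqP; rewrite -sqrf_eq0 eq_le h sqr_ge0.
Qed.

Definition ipnorm x := Num.sqrt (ip x x).

Lemma ipnormE x : ipnorm x = Num.sqrt (ip x x). Proof. by []. Qed.

Lemma ipnorm_ge0 x : 0 <= ipnorm x. Proof. exact: sqrtr_ge0. Qed.

Lemma sqr_ipnorm x : ipnorm x ^+ 2 = ip x x.
Proof. by rewrite sqr_sqrtr// (ip_ge0 ipP). Qed.

Lemma ip_le_norm x y : `|ip x y| <= ipnorm x * ipnorm y.
Proof.
rewrite -sqrtrM ?(ip_ge0 ipP)// -sqrtr_sqr.
by rewrite ler_sqrt ?mulr_ge0 ?(ip_ge0 ipP)// ip_cauchy_schwarz.
Qed.

Lemma ipnormD x y : ipnorm (x + y) <= ipnorm x + ipnorm y.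
Proof.
rewrite -(@ler_pXn2r _ 2)// ?nnegrE ?addr_ge0 ?ipnorm_ge0//.
rewrite sqrrD !sqr_ipnorm !ipE (ipC ipP y x).
have := ip_le_norm x y; have := ler_norm (ip x y); lra.
Qed.

Lemma ipnormZ a x : ipnorm (a *: x) = `|a| * ipnorm x.
Proof.
by rewrite /ipnorm !ipE mulrA -expr2 sqrtrM ?sqr_ge0// sqrtr_sqr.
Qed.

Lemma ipnormN x : ipnorm (- x) = ipnorm x.
Proof. by rewrite -scaleN1r ipnormZ normrN1 mul1r. Qed.

Lemma ipnorm_eq0 x : (ipnorm x == 0) = (ip x x == 0).
Proof. by rewrite sqrtr_eq0 eq_le (ip_ge0 ipP) andbT. Qed.

Lemma ip_scale_unit x : ip x x != 0 ->
  ip ((ipnorm x)^-1 *: x) ((ipnorm x)^-1 *: x) = 1.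
Proof.
move=> x0; rewrite !ipE mulrA -sqr_ipnorm -expr2 exprVn mulVf//.
by rewrite sqrf_eq0 ipnorm_eq0.
Qed.

End semi_inner_product_theory.

Section positive_compact_operator.
Context {R : realType} {E : lmodType R} {ip : E -> E -> R}.
Hypothesis ipP : semi_inner_product ip.
Local Notation ipE := (ipE ipP).

(* Equality of vectors is replaced everywhere by [ip (x - y) (x - y) = 0]. *)
Definition eigvec (K : E -> E) (u : R) (x : E) :=
  ip (K x - u *: x) (K x - u *: x) = 0.

(** Stated with a cluster point [g] instead of a convergent subsequence: this is what Tychonoff's
    theorem yields, and it saves every extraction argument. The existence of [g] in [E] stands in
    for completeness. *)
Definition compact_operator (K : E -> E) :=
  forall f : nat -> E, (forall n, ip (f n) (f n) <= 1) ->
  exists g, forall e, 0 < e -> forall N, exists2 n, (N <= n)%N &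
    ip (K (f n) - g) (K (f n) - g) < e.

Record positive_compact (K : E -> E) : Prop := {
  pc_lin : forall a x y, K (a *: x + y) = a *: K x + K y ;
  pc_sym : forall x y, ip x (K y) = ip (K x) y ;
  pc_ge0 : forall x, 0 <= ip x (K x) ;
  pc_bnd : exists B, forall x, ip (K x) (K x) <= B * ip x x ;
  pc_cpt : compact_operator K }.

Variable K : E -> E.
Hypothesis KP : positive_compact K.

Lemma pc_0 : K 0 = 0.
Proof.
have := pc_lin KP 1 0 0; rewrite !scale1r addr0 => h.
by apply: (addrI (K 0)); rewrite -h addr0.
Qed.

Lemma pc_D x y : K (x + y) = K x + K y.
Proof. by have := pc_lin KP 1 x y; rewrite !scale1r. Qed.

Lemma pc_Z a x : K (a *: x) = a *: K x.
Proof. by have := pc_lin KP a x 0; rewrite !addr0 pc_0 addr0. Qed.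

Lemma pc_N x : K (- x) = - K x.
Proof. by rewrite -scaleN1r pc_Z scaleN1r. Qed.

Definition pcE := (pc_D, pc_N, pc_Z).

Lemma eigvec_ipr u x y : eigvec K u x -> ip y (K x) = u * ip y x.
Proof.
move=> /(ip_null ipP) => /(_ y); rewrite !ipE => /eqP; rewrite subr_eq0 => /eqP.
by rewrite (ipC ipP) => ->; rewrite (ipC ipP).
Qed.

Lemma eigvecZ u a x : eigvec K u x -> eigvec K u (a *: x).
Proof.
rewrite /eigvec => h; rewrite pcE scalerA mulrC -scalerA -scalerBr.
by rewrite (ipZl ipP) (ipZr ipP) h !mulr0.
Qed.

Lemma eigvec0 u : eigvec K u 0.
Proof.
by rewrite /eigvec pc_0 scaler0 subr0 -{1}(scale0r 0) (ipZl ipP) mul0r.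
Qed.

Lemma eigvecD u x y : eigvec K u x -> eigvec K u y -> eigvec K u (x + y).
Proof.
rewrite /eigvec pcE scalerDr opprD addrACA.
move: (K x - _) (K y - _) => p q hp hq.
by rewrite (ipDl ipP) (ip_null ipP _ hp) (ipDr ipP) hq (ipC ipP)
  (ip_null ipP _ hp) !addr0.
Qed.

Lemma eigvec_orth u w x y : eigvec K u x -> eigvec K w y -> u != w ->
  ip x y = 0.
Proof.
move=> hx hy uw; have := eigvec_ipr x hy; rewrite (pc_sym KP) (ipC ipP).
rewrite (eigvec_ipr y hx) (ipC ipP y x) => /eqP.
by rewrite -subr_eq0 -mulrBl mulf_eq0 subr_eq0 (negbTE uw) => /eqP.
Qed.

Lemma pc_form_cauchy_schwarz x y :
  ip x (K y) ^+ 2 <= ip x (K x) * ip y (K y).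
Proof.
apply: (@ip_cauchy_schwarz _ _ (fun x y => ip x (K y))); split => //.
- by move=> a b; rewrite (pc_sym KP) (ipC ipP).
- by move=> *; rewrite ipE.
- by move=> *; rewrite ipE.
- exact: (pc_ge0 KP).
Qed.

(** Closedness is for the seminorm, so that [W] contains cluster points of images under [K]. The set
    may be empty, whence the member assumed in [ci_0]. *)
Record closed_invariant (W : set E) : Prop := {
  ci_lin : forall a x y, W x -> W y -> W (a *: x + y) ;
  ci_cl : forall x,
    (forall e, 0 < e -> exists2 y, W y & ip (x - y) (x - y) < e) -> W x ;
  ci_inv : forall x, W x -> W (K x) }.

Lemma ci_0 W x : closed_invariant W -> W x -> W 0.
Proof. by move=> cW Wx; have := ci_lin cW (-1) Wx Wx; rewrite scaleN1r addNr. Qed.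

Lemma ci_Z W a x : closed_invariant W -> W x -> W (a *: x).
Proof.
by move=> cW Wx; have := ci_lin cW a Wx (ci_0 cW Wx); rewrite addr0.
Qed.

Lemma ip_sum3 x y w : ip (x + y + w) (x + y + w) <=
  3 * (ip x x + ip y y + ip w w).
Proof.
have := ip_ge0 ipP (x - y); have := ip_ge0 ipP (x - w).
have := ip_ge0 ipP (y - w); rewrite !ipE (ipC ipP y x) (ipC ipP w x) (ipC ipP w y).
lra.
Qed.

Section top.
Variable W : set E.
Hypothesis cW : closed_invariant W.

Let u := sup [set ip x (K x) | x in [set x | W x /\ ip x x <= 1]].

Lemma rayleigh_bounded :
  exists B, 0 <= B /\ forall x, ip x (K x) <= B * ip x x.
Proof.
(* The square of [1 + |B|] dominates [B], which avoids a square root in Cauchy-Schwarz. *)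
have [B hB] := pc_bnd KP; exists (1 + `|B|); split; first by rewrite addr_ge0.
move=> x; rewrite -(@ler_pXn2r _ 2)//; last 2 first.
- by rewrite nnegrE (pc_ge0 KP).
- by rewrite nnegrE mulr_ge0 ?addr_ge0 ?(ip_ge0 ipP).
have := ip_cauchy_schwarz ipP x (K x); have := hB x.
have := ip_ge0 ipP x; have := ler_norm B; have := normr_ge0 B.
move: (ip x x) (ip (K x) (K x)) (ip x (K x)) `|B| => a b c d; nra.
Qed.

Let hsup x : W x -> has_sup [set ip x (K x) | x in [set x | W x /\ ip x x <= 1]].
Proof.
move=> Wx; split.
  exists (ip 0 (K 0)), 0 => //; split; first exact: ci_0 cW Wx.
  by rewrite -(scale0r x) (ipZl ipP) mul0r.
have [B [B0 hB]] := rayleigh_bounded.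
exists B => _ [y [_ y1] <-]; rewrite (le_trans (hB y))//.
by rewrite ler_piMr.
Qed.

Let u_ge0 x : W x -> 0 <= u.
Proof.
move=> Wx; apply: (sup_upper_bound (hsup Wx)); exists 0.
  split; first exact: ci_0 cW Wx.
  by rewrite -(scale0r x) (ipZl ipP) mul0r.
by rewrite -(scale0r x) (ipZl ipP) mul0r.
Qed.

Let u_ray x : W x -> ip x (K x) <= u * ip x x.
Proof.
move=> Wx; have [x0|x0] := eqVneq (ip x x) 0.
  by rewrite (ip_null ipP)// x0 mulr0.
have : ip ((ipnorm (ip:=ip) x)^-1 *: x) (K ((ipnorm (ip:=ip) x)^-1 *: x)) <= u.
  apply: (sup_upper_bound (hsup Wx)); eexists; last reflexivity.
  by split; [exact: ci_Z cW Wx|rewrite (ip_scale_unit ipP)].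
rewrite pcE !ipE mulrA -expr2 exprVn (sqr_ipnorm ipP) mulrC ler_pdivrMr//.
by rewrite lt_neqAle eq_sym x0 (ip_ge0 ipP).
Qed.

(** The operator inequality K^2 <= u K on [W]. It follows from Cauchy-Schwarz for the form <x, K y>,
    taken at [K x] and [x], without a square root of [K]. *)
Let u_sq x : W x -> ip (K x) (K x) <= u * ip x (K x).
Proof.
move=> Wx; have := pc_form_cauchy_schwarz (K x) x.
have := u_ray (ci_inv cW Wx); have := u_ge0 Wx.
have := pc_ge0 KP x; have := ip_ge0 ipP (K x).
move: (ip (K x) (K x)) (ip (K x) (K (K x))) (ip x (K x)) => a b c a0 c0 u0 bu h.
have [->|a0'] := eqVneq a 0; first exact: mulr_ge0.
have ap : 0 < a by rewrite lt_neqAle eq_sym a0'.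
rewrite -(ler_pM2l ap); nra.
Qed.

(** Variational principle: along a maximising sequence of the Rayleigh quotient, [K f - u f] tends
    to 0 by [u_sq], so a cluster point of the images [K f] is an eigenvector for the supremum
    [u]. *)
Lemma top_eigenvector x0 : W x0 -> ip x0 x0 != 0 ->
  exists u g, [/\ 0 <= u, W g, ip g g = 1, eigvec K u g &
    forall x, W x -> ip x (K x) <= u * ip x x].
Proof.
move=> Wx0 x0n.
(* If [u] is 0, then [u_sq] makes [K] null on [W], and [x0] itself, normalised, is an
   eigenvector. *)
have [u0|u0] := eqVneq u 0.
  exists 0, ((ipnorm (ip:=ip) x0)^-1 *: x0); split => //.
  - exact: ci_Z cW Wx0.
  - exact: ip_scale_unit ipP _ x0n.
  - rewrite /eigvec scale0r subr0; apply/eqP.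
    rewrite eq_le (ip_ge0 ipP) andbT (le_trans (u_sq _)) ?u0 ?mul0r//.
    exact: ci_Z cW Wx0.
  - by move=> x Wx; rewrite -u0 u_ray.
have up : 0 < u by rewrite lt_neqAle eq_sym u0 (u_ge0 Wx0).
have /choice[f hf] : forall n, exists x, [/\ W x, ip x x <= 1 &
    u - n.+1%:R^-1 < ip x (K x)].
  move=> n; have : 0 < n.+1%:R^-1 :> R by rewrite invr_gt0.
  by move=> /sup_adherent/(_ (hsup Wx0))[_ [x [Wx x1] <-] h]; exists x.
have /(pc_cpt KP)[g hg] : forall n, ip (f n) (f n) <= 1.
  by move=> n; have [] := hf n.
have small e : 0 < e -> exists n, [/\ ip (K (f n) - g) (K (f n) - g) < e &
    n.+1%:R^-1 < e].
  move=> e0; have /hg/(_ (Num.truncn e^-1))[n Nn hn] := e0.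
  exists n; split => //; rewrite -(invrK e) ltf_pV2 ?posrE ?invr_gt0//.
  by rewrite (lt_le_trans (truncnS_gt _))// ler_nat ltnS.
(* By [u_sq] and ||f|| <= 1, the left side is at most [u] times the defect of [f n] as a
   maximiser. *)
have res n : ip (K (f n) - u *: f n) (K (f n) - u *: f n) <= u * n.+1%:R^-1.
  have [Wf f1 fu] := hf n; rewrite !ipE (ipC ipP (K (f n)) (f n)).
  have := u_sq Wf; move: (ip (K (f n)) _) fu f1 => a.
  move: (ip (f n) (K _)) (ip (f n) (f n)) n.+1%:R^-1 => b c i bi c1 aub.
  have h1 : 0 <= u * (b - u + i) by rewrite mulr_ge0 ?ltW//; lra.
  have h2 : 0 <= u ^+ 2 * (1 - c) by rewrite mulr_ge0 ?sqr_ge0 ?subr_ge0.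
  lra.
have [B hB] := pc_bnd KP.
(* A null [g] would make ||K f|| smaller than u / 2 for some [f n] with <f, K f> larger than u / 2,
   against Cauchy-Schwarz. *)
have gg : ip g g != 0.
  apply/eqP => g0; have e0 : 0 < Num.min (u / 2) ((u / 2) ^+ 2).
    by rewrite lt_min exprn_gt0 ?andbT ?divr_gt0.
  have [n []] := small _ e0; rewrite !lt_min => /andP[_ h1] /andP[h2 _].
  have [Wf f1 fu] := hf n.
  have := ip_cauchy_schwarz ipP (f n) (K (f n)).
  move: h1; rewrite !ipE g0 (ipC ipP _ g) (ip_null ipP _ g0) => h1.
  have := ip_ge0 ipP (f n); have := ip_ge0 ipP (K (f n)).
  move: h1 fu f1 h2.
  move: (ip (K (f n)) _) (ip (f n) (K _)) (ip (f n) (f n)) n.+1%:R^-1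
    => a b c i h1 h2 h3 h4 h5 h6.
  apply/negP; rewrite -ltNge.
  apply: (@le_lt_trans _ _ a); first by rewrite ler_piMl.
  apply: (@lt_trans _ _ ((u / 2) ^+ 2)); first by lra.
  by rewrite ltr_pXn2r// ?nnegrE; lra.
have Wg : W g.
  apply: (ci_cl cW) => e /small[n [h _]]; exists (K (f n)).
    by apply: (ci_inv cW); have [] := hf n.
  by rewrite -opprB (ipNl ipP) (ipNr ipP) opprK.
have eg : eigvec K u g.
  apply/eqP; rewrite eq_le (ip_ge0 ipP) andbT; apply/ler_addgt0Pr => e e0.
  have B0 : 0 <= `|B| by [].
  (* The three summands are the factors of e / C in the bounds [j1], [j2], [j3] on the telescoping
     of [K g - u g] below; the 1 keeps [C] positive. *)
  pose C := 3 * (`|B| + `|B| * u + u ^+ 2) + 1.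
  have C0 : 0 < C by rewrite ltr_wpDl ?mulr_ge0 ?addr_ge0 ?mulr_ge0 ?sqr_ge0 ?(ltW up).
  have [n [h1 h2]] := small (e / C) (divr_gt0 e0 C0).
  have -> : K g - u *: g = K (g - K (f n)) + K (K (f n) - u *: f n)
      + u *: (K (f n) - g).
    by rewrite !pcE !scalerBr !subrKA.
  rewrite add0r (le_trans (ip_sum3 _ _ _))//.
  have i1 := hB (g - K (f n)); have i2 := hB (K (f n) - u *: f n).
  have i3 := res n.
  have i4 : ip (g - K (f n)) (g - K (f n)) = ip (K (f n) - g) (K (f n) - g).
    by rewrite -opprB (ipNl ipP) (ipNr ipP) opprK.
  have i5 : ip (u *: (K (f n) - g)) (u *: (K (f n) - g)) =
    u ^+ 2 * ip (K (f n) - g) (K (f n) - g).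
    by rewrite (ipZl ipP) (ipZr ipP) mulrA.
  rewrite i4 in i1; rewrite i5.
  have p1 := ip_ge0 ipP (K (f n) - g).
  have p2 := ip_ge0 ipP (K (f n) - u *: f n).
  have dC : e = C * (e / C) by rewrite mulrC divfK// gt_eqF.
  rewrite dC.
  have p3 : 0 < e / C by exact: divr_gt0.
  have lB := ler_norm B.
  have j1 : ip (K (g - K (f n))) (K (g - K (f n))) <= `|B| * (e / C).
    rewrite (le_trans i1)// (@le_trans _ _ (`|B| * ip (K (f n) - g) (K (f n) - g)))//.
      exact: ler_wpM2r.
    by rewrite ler_wpM2l// ltW.
  have j2 : ip (K (K (f n) - u *: f n)) (K (K (f n) - u *: f n)) <= `|B| * u * (e / C).
    rewrite (le_trans i2)// (@le_trans _ _ (`|B| * ip (K (f n) - u *: f n) (K (f n) - u *: f n)))//.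
      exact: ler_wpM2r.
    rewrite -mulrA ler_wpM2l// (le_trans i3)// ler_wpM2l// ltW//.
  have j3 : u ^+ 2 * ip (K (f n) - g) (K (f n) - g) <= u ^+ 2 * (e / C).
    by rewrite ler_wpM2l ?sqr_ge0// ltW.
  rewrite /C; nra.
exists u, ((ipnorm (ip:=ip) g)^-1 *: g); split.
- exact: ltW.
- exact: ci_Z cW Wg.
- exact: ip_scale_unit ipP _ gg.
- exact: eigvecZ.
- exact: u_ray.
Qed.

End top.
End positive_compact_operator.

(** * The spectral gap estimate *)

Section spectral_gap.
Context {R : realType} {E : lmodType R} {ip : E -> E -> R}.
Hypothesis ipP : semi_inner_product ip.
Local Notation ipE := (ipE ipP).
Variable K : E -> E.
Hypothesis KP : positive_compact (ip := ip) K.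
Local Notation pcE := (pcE KP).
Local Notation eigvec := (eigvec (ip := ip)).
Local Notation closed_invariant := (closed_invariant (ip := ip)).

Lemma ip_closed y x : (forall e, 0 < e ->
    exists2 w, ip y w = 0 & ip (x - w) (x - w) < e) -> ip y x = 0.
Proof.
move=> h; apply/eqP; rewrite -sqrf_eq0 eq_le sqr_ge0 andbT.
apply/ler_addgt0Pr => e e0; rewrite add0r.
have y1 : 0 < 1 + ip y y by rewrite ltr_pwDl ?(ip_ge0 ipP).
have [w yw hw] := h (e / (1 + ip y y)) (divr_gt0 e0 y1).
have -> : ip y x = ip y (x - w) by rewrite !ipE yw subr0.
rewrite (le_trans (ip_cauchy_schwarz ipP _ _))//.
move: hw; rewrite ltr_pdivlMr//; have := ip_ge0 ipP y.
have := ip_ge0 ipP (x - w); nra.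
Qed.

Definition perp (W : set E) (s : seq E) : set E :=
  [set x | W x /\ forall y, y \in s -> ip y x = 0].

Lemma perp_closed_invariant W s : closed_invariant K W ->
  (forall y, y \in s -> exists u, eigvec K u y) -> closed_invariant K (perp W s).
Proof.
move=> cW es; split.
- move=> a x y [Wx hx] [Wy hy]; split; first exact: (ci_lin cW).
  by move=> z zs; rewrite !ipE hx// hy// mulr0 addr0.
- move=> x h; split.
    by apply: (ci_cl cW) => e /h[y [Wy _] hy]; exists y.
  move=> y ys; apply: ip_closed => e /h[w [_ hw] xw]; exists w => //.
  exact: hw.
- move=> x [Wx hx]; split; first exact: (ci_inv cW).
  move=> y ys; have [u eu] := es _ ys.
  by rewrite (pc_sym KP) (ipC ipP) (eigvec_ipr ipP _ eu) (ipC ipP) hx// mulr0.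
Qed.

Definition eigsystem (W : set E) (theta : R) (s : seq E) :=
  (forall x, x \in s -> [/\ W x, ip x x = 1 &
     exists2 u, theta <= u & eigvec K u x]) /\
  (forall x y, x \in s -> y \in s -> x != y -> ip x y = 0).

(* Extending orthonormal families indefinitely would produce a sequence whose
   image under [K] has no cluster point. *)
Lemma finite_eigsystem W theta : 0 < theta ->
  exists2 s, eigsystem W theta s &
    forall x, eigsystem W theta (x :: s) -> x \in s.
Proof.
move=> t0; apply: contrapT => h.
have step s : exists x, eigsystem W theta s ->
    eigsystem W theta (x :: s) /\ x \notin s.
  have [es|] := pselect (eigsystem W theta s); last by exists 0.
  apply: contrapT => h'; apply: h; exists s => // x ex.
  by apply: contrapT => /negP xs; apply: h'; exists x.
have [next hnext] := choice step.
pose s_ n := iter n (fun s => next s :: s) [::].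
have es n : eigsystem W theta (s_ n).
  by elim: n => [|n ih] //=; have [] := hnext _ ih.
have mem m n : (m < n)%N -> next (s_ m) \in s_ n.
  elim: n => // n ih; rewrite ltnS leq_eqVlt => /predU1P[->|/ih mn] /=.
    by rewrite inE eqxx.
  by rewrite inE mn orbT.
pose f n := next (s_ n).
have hf n : [/\ W (f n), ip (f n) (f n) = 1 &
     exists2 u, theta <= u & eigvec K u (f n)].
  by have [+ _] := es n.+1; apply; exact: mem.
have /(pc_cpt KP)[g hg] : forall n, ip (f n) (f n) <= 1.
  by move=> n; have [_ h1 _] := hf n; rewrite h1.
(* Images of two orthonormal members are at squared distance at least 2 theta^2, but two points this
   close to [g] are at squared distance less than 3 (theta^2 / 4 + theta^2 / 4). *)
have d0 : 0 < theta ^+ 2 / 4 by rewrite divr_gt0// exprn_gt0.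
have [m _ hm] := hg _ d0 0%N.
have [n mn hn] := hg _ d0 m.+1.
have mn0 : ip (f m) (f n) = 0.
  have [_ /(_ (f m) (f n))] := es n.+1; apply.
  - apply: mem; rewrite ltnS; exact: ltnW.
  - exact: mem.
  - have [_] := hnext _ (es n); apply: contraNneq => fmn; rewrite -/(f n) -fmn; exact: mem.
have [_ m1 [u tu eu]] := hf m; have [_ n1 [w tw ew]] := hf n.
have := ip_sum3 ipP (K (f m) - g) (g - K (f n)) 0.
have -> : ip (g - K (f n)) (g - K (f n)) = ip (K (f n) - g) (K (f n) - g).
  by rewrite -opprB (ipNl ipP) (ipNr ipP) opprK.
rewrite addr0 subrKA.
have -> : ip (K (f m) - K (f n)) (K (f m) - K (f n)) = u ^+ 2 + w ^+ 2.
  rewrite !ipE !(eigvec_ipr ipP _ eu) !(eigvec_ipr ipP _ ew).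
  rewrite !(ipC ipP (K _)) !(eigvec_ipr ipP _ eu) !(eigvec_ipr ipP _ ew).
  by rewrite (ipC ipP (f n) (f m)) mn0 m1 n1 !(mulr0, mulr1); ring.
have -> : ip (0 : E) 0 = 0 by rewrite -[X in ip X _](scale0r 0) (ipZl ipP) mul0r.
move: hm hn; move: (ip _ _) (ip _ _) => a b ha hb.
apply/negP; rewrite -ltNge.
have : theta ^+ 2 <= u ^+ 2 by rewrite ler_pXn2r// nnegrE ltW// (lt_le_trans t0).
have : theta ^+ 2 <= w ^+ 2 by rewrite ler_pXn2r// nnegrE ltW// (lt_le_trans t0).
lra.
Qed.

Variables (phi psi : E) (lam nu : R).
Hypotheses (phi1 : ip phi phi = 1) (psi1 : ip psi psi = 1)
  (phipsi : ip phi psi = 0) (ephi : eigvec K lam phi) (epsi : eigvec K nu psi)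
  (lam0 : 0 < lam) (lamnu : lam <= nu).

Definition orthocomplement : set E :=
  [set f | ip phi f = 0 /\ ip psi f = 0].

(** The form in which the multiplicity hypotheses are used: up to null vectors, the eigenspaces of
    [lam] and [nu] lie in the span of [phi] and [psi]. *)
Hypothesis nonres : forall f, orthocomplement f ->
  eigvec K lam f \/ eigvec K nu f -> ip f f = 0.

Definition real_spectrum : set R :=
  [set u | exists2 f, ip f f != 0 & eigvec K u f].

(** Without further eigenvalues this infimum is 0 by convention, and so is its inverse; in that case
    [orthocomplement] has only null vectors, as [gap_positive] shows. *)
Definition real_gap := inf [set Num.min `|lam - u| `|nu - u|
  | u in real_spectrum `\` [set lam; nu]].

Lemma orthocomplement_closed_invariant : closed_invariant K orthocomplement.
Proof.
split.
- by move=> a x y [hx hx'] [hy hy']; split; rewrite !ipE ?hx ?hy ?hx' ?hy';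
    ring.
- move=> x h; split; apply: ip_closed => e /h[y [y1 y2] xy]; by exists y.
- move=> x [h1 h2]; split; rewrite (pc_sym KP) (ipC ipP).
    by rewrite (eigvec_ipr ipP _ ephi) (ipC ipP) h1 mulr0.
  by rewrite (eigvec_ipr ipP _ epsi) (ipC ipP) h2 mulr0.
Qed.
Let cW := orthocomplement_closed_invariant.

Let spectrum_unit u g : orthocomplement g -> ip g g = 1 -> eigvec K u g ->
  (real_spectrum `\` [set lam; nu]) u.
Proof.
move=> Wg g1 eg; split; first by exists g; rewrite // g1 oner_eq0.
move=> h; have /eqP : ip g g = 0.
  by apply: nonres => //; case: h => <-; [left|right].
by rewrite g1 oner_eq0.
Qed.

Let gap_le u g : orthocomplement g -> ip g g = 1 -> eigvec K u g ->
  real_gap <= `|lam - u| /\ real_gap <= `|nu - u|.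
Proof.
move=> Wg g1 eg; suff : real_gap <= Num.min `|lam - u| `|nu - u|.
  by rewrite le_min => /andP.
apply: ge_inf; first by exists 0 => _ [w _ <-]; rewrite le_min !normr_ge0.
by exists u => //; exact: spectrum_unit eg.
Qed.

(** A threshold separating finitely many eigenvalues from those that stay at distance at least
    [theta] from both [lam] and [nu]. *)
Let theta := lam / 2.
Let theta0 : 0 < theta. Proof. by rewrite divr_gt0. Qed.

(** Otherwise [x] could be added to the maximal family [s]; being a member of [s], it would be
    orthogonal to itself. *)
Let perp_unit s x : eigsystem orthocomplement theta s ->
  (forall x, eigsystem orthocomplement theta (x :: s) -> x \in s) ->
  perp orthocomplement s x -> ip x x = 1 ->
  forall u, eigvec K u x -> u < theta.
Proof.
move=> [s1 s2] smax [Wx hx] x1 u eu; rewrite ltNge; apply/negP => tu.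
have /smax xs : eigsystem orthocomplement theta (x :: s).
  split=> [y|y z].
    rewrite inE => /predU1P[->|/s1//]; split => //; by exists u.
  rewrite !inE => /predU1P[->|ys] /predU1P[->|zs] yz.
  - by rewrite eqxx in yz.
  - by rewrite (ipC ipP) hx.
  - by rewrite hx.
  - exact: s2.
by have := hx _ xs; rewrite x1 => /eqP; rewrite oner_eq0.
Qed.

(** An eigenvector for a further eigenvalue either is orthogonal to the maximal family, so that its
    eigenvalue lies below [theta], or it shares the eigenvalue of one of the finitely many members;
    [c] is the least distance for the latter. *)
Let gap_positive x0 : orthocomplement x0 -> ip x0 x0 != 0 -> 0 < real_gap.
Proof.
move=> Wx0 x0n.
have [s es smax] := finite_eigsystem orthocomplement theta0.
have [c c0 hc] : exists2 c, 0 < c & forall x u, x \in s -> eigvec K u x ->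
    c <= Num.min `|lam - u| `|nu - u|.
  have [s1 s2] := es.
  have : forall x u, x \in s -> eigvec K u x -> 0 < Num.min `|lam - u| `|nu - u|.
    move=> x u xs eu; have [Wx x1 _] := s1 _ xs.
    rewrite lt_min !normr_gt0 !subr_eq0; apply/andP; split; apply/eqP => h.
      have := nonres Wx; rewrite h x1 => /(_ (or_introl eu))/eqP.
      by rewrite oner_eq0.
    have := nonres Wx; rewrite h x1 => /(_ (or_intror eu))/eqP.
    by rewrite oner_eq0.
  have : forall x, x \in s -> ip x x = 1 by move=> x /s1[].
  elim: (s) => [|y t ih] h1 h2; first by exists 1.
  have [||c c0 hc] := ih.
  - by move=> x xt; rewrite h1// inE xt orbT.
  - by move=> x u xt; apply: h2; rewrite inE xt orbT.
  have [[u eu]|nu0] := pselect (exists u, eigvec K u y); last first.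
    exists c => // x u; rewrite inE => /predU1P[->|xt]; last exact: hc.
    by move=> eu; exfalso; apply: nu0; exists u.
  exists (Num.min c (Num.min `|lam - u| `|nu - u|)).
    by rewrite lt_min c0 (h2 y)// inE eqxx.
  move=> x w; rewrite inE => /predU1P[->|xt] ew; last by rewrite ge_min (hc x w).
  suff -> : w = u by rewrite ge_min lexx orbT.
  have y1 : ip y y = 1 by rewrite h1// inE eqxx.
  have := eigvec_ipr ipP y eu; rewrite (eigvec_ipr ipP y ew) y1.
  by rewrite !mulr1.
have key u : (real_spectrum `\` [set lam; nu]) u ->
    Num.min c theta <= Num.min `|lam - u| `|nu - u|.
  move=> [[f fn ef] /not_orP[ul un]].
  have Wf : orthocomplement f.
    split; [apply: (eigvec_orth ipP KP ephi ef)|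
            apply: (eigvec_orth ipP KP epsi ef)]; apply/eqP => h; 
      [exact: ul|exact: un].
  have [fs|] := pselect (perp orthocomplement s f); last first.
    move=> /not_andP[//|/existsNP[x /not_implyP[xs /eqP xf]]].
    have [_ _ [w _ ew]] := es.1 _ xs.
    have [uw|uw] := eqVneq u w; first by rewrite ge_min uw (hc x w).
    by move: xf; rewrite (eigvec_orth ipP KP ew ef) ?eqxx// eq_sym.
  have ut : u < theta.
    apply: (perp_unit es smax _ (ip_scale_unit ipP fn) (eigvecZ ipP KP _ ef)).
    apply: (ci_Z _ _ fs); apply: (perp_closed_invariant cW).
    by move=> y /es.1[_ _ [w _ ew]]; exists w.
  rewrite ge_min; apply/orP; right; rewrite le_min.
  apply/andP; split; rewrite (le_trans _ (ler_norm _))//.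
    by move: ut; rewrite /theta; lra.
  by move: ut lamnu; rewrite /theta; lra.
apply: (@lt_le_trans _ _ (Num.min c theta)); first by rewrite lt_min c0.
apply: lb_le_inf; last by move=> _ [u hu <-]; exact: key.
(* The set under the infimum has to be nonempty: a top eigenvector on [orthocomplement] provides an
   element. *)
have [u [g [_ Wg g1 eg _]]] := top_eigenvector ipP KP cW Wx0 x0n.
by exists (Num.min `|lam - u| `|nu - u|), u => //; exact: spectrum_unit eg.
Qed.

Let res f := K f - nu *: f.

(** The Rayleigh quotient is at most some eigenvalue u < [theta] here, so <f, (nu - K) f> >= (nu -
    u) ||f||^2, and Cauchy-Schwarz turns this into a bound on the residual. *)
Let gap_perp s f : eigsystem orthocomplement theta s ->
  (forall x, eigsystem orthocomplement theta (x :: s) -> x \in s) ->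
  0 < real_gap ->
  perp orthocomplement s f -> real_gap ^+ 2 * ip f f <= ip (res f) (res f).
Proof.
move=> es smax g0 fs.
have [->|fn] := eqVneq (ip f f) 0; first by rewrite mulr0 (ip_ge0 ipP).
have cp : closed_invariant K (perp orthocomplement s).
  apply: (perp_closed_invariant cW).
  by move=> y /es.1[_ _ [w _ ew]]; exists w.
have [u [g [u0 Wg g1 eg hu]]] := top_eigenvector ipP KP cp fs fn.
have ut := perp_unit es smax Wg g1 eg.
have [_ gu] := gap_le Wg.1 g1 eg.
have unu : 0 < nu - u by move: ut lamnu lam0; rewrite /theta; lra.
rewrite gtr0_norm// in gu.
have := ip_cauchy_schwarz ipP f (res f); have := hu _ fs.
have -> : ip f (res f) = ip f (K f) - nu * ip f f by rewrite /res !ipE.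
have fp : 0 < ip f f by rewrite lt_neqAle eq_sym fn (ip_ge0 ipP).
move: (ip f (K f)) (ip (res f) (res f)) (ip f f) fp => b D c c0 bc h.
rewrite -(ler_pM2l c0) (le_trans _ h)// -[leRHS]sqrrN.
have -> : c * (real_gap ^+ 2 * c) = (real_gap * c) ^+ 2 by ring.
have h1 : real_gap * c <= (nu - u) * c by rewrite ler_wpM2r// ltW.
rewrite ler_pXn2r// ?nnegrE; first lra.
  by rewrite mulr_ge0// ltW.
have := ltW unu; nra.
Qed.

Lemma real_gap_ge0 : 0 <= real_gap.
Proof.
have [[u hu]|] := pselect (real_spectrum `\` [set lam; nu] !=set0); last first.
  move=> /set0P/negP/negPn/eqP h; rewrite /real_gap h.
  by rewrite image_set0 inf0.
apply: lb_le_inf; first by exists (Num.min `|lam - u| `|nu - u|), u.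
by move=> _ [w _ <-]; rewrite le_min !normr_ge0.
Qed.

(* No eigenbasis is needed: only finitely many orthonormal eigenvectors have an
   eigenvalue at least [lam / 2], and on the complement of a maximal such
   family the Rayleigh quotient of [K] is attained at a smaller eigenvalue. *)
Lemma gap_lower_bound f : orthocomplement f ->
  ipnorm (ip := ip) f <= real_gap^-1 * ipnorm (ip := ip) (K f - nu *: f).
Proof.
(* A null [f] is set apart because [real_gap] is known to be positive only once [orthocomplement]
   contains a nonnull vector. *)
move=> Wf; have [f0|fn] := eqVneq (ip f f) 0.
  by rewrite {1}/ipnorm f0 sqrtr0 mulr_ge0 ?ipnorm_ge0 ?invr_ge0 ?real_gap_ge0.
have g0 := gap_positive Wf fn.
rewrite ler_pdivlMl// -(@ler_pXn2r _ 2)//; last 2 first.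
- by rewrite nnegrE mulr_ge0 ?ipnorm_ge0 ?ltW.
- by rewrite nnegrE ipnorm_ge0.
rewrite exprMn !(sqr_ipnorm ipP).
have [s es smax] := finite_eigsystem orthocomplement theta0.
(* [s1] lists the members to which [f] need not be orthogonal. Removing the component [c *: x] along
   one of them lowers ||f||^2 by c^2 and the squared residual by c^2 (nu - u)^2, which is at least
   gap^2 c^2. *)
suff : forall (s1 : seq E) f, orthocomplement f ->
    (forall x, x \in s -> x \notin s1 -> ip x f = 0) ->
    real_gap ^+ 2 * ip f f <= ip (res f) (res f).
  by move=> /(_ s f Wf); apply => x xs; rewrite xs.
elim=> [|x s1 ih] {fn}f {}Wf hf.
  by apply: (gap_perp es smax g0); split => // y ys; apply: hf.
have [xs|xs] := boolP (x \in s); last first.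
  by apply: ih => // y ys ys1; apply: hf => //; rewrite inE negb_or ys1 andbT;
    apply: contraNneq xs => <-.
have [[Wx x1 [u _ ex]] s2] := (es.1 _ xs, es.2).
have [_ gu] := gap_le Wx x1 ex.
pose f1 := f - ip x f *: x.
have Wf1 : orthocomplement f1.
  by rewrite /f1 addrC -scaleNr; apply: (ci_lin cW).
have xf1 : ip x f1 = 0 by rewrite /f1 !ipE x1 mulr1 subrr.
have {}/ih : forall y, y \in s -> y \notin s1 -> ip y f1 = 0.
  move=> y ys ys1; have [->//|yx] := eqVneq y x.
  by rewrite /f1 !ipE hf ?inE ?negb_or ?yx// (s2 y x)// mulr0 subr0.
move=> /(_ Wf1).
have : f = f1 + ip x f *: x by rewrite /f1 subrK.
move: Wf1 xf1; clearbody f1; move: (ip x f) => c Wf1 xf1 ->.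
have -> : ip (f1 + c *: x) (f1 + c *: x) = ip f1 f1 + c ^+ 2.
  by rewrite !ipE (ipC ipP f1 x) xf1 x1; ring.
have xr : ip x (res f1) = 0.
  by rewrite /res !ipE (pc_sym KP) (ipC ipP) (eigvec_ipr ipP _ ex) (ipC ipP) xf1;
    ring.
have -> : ip (res (f1 + c *: x)) (res (f1 + c *: x)) =
    ip (res f1) (res f1) + c ^+ 2 * (nu - u) ^+ 2.
  have -> : res (f1 + c *: x) =
      res f1 + ((c * (u - nu)) *: x + c *: (K x - u *: x)).
    rewrite /res !pcE scalerDr scalerA scalerBr scalerA mulrBr scalerBl.
    rewrite opprD addrACA; congr (_ + _).
    by rewrite (mulrC nu) (addrC (_ - _)) subrKA.
  have nx y : ip (K x - u *: x) y = 0 by exact: ip_null.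
  move: (res f1) xr => r xr.
  rewrite !(ipDr ipP) !(ipDl ipP) !(ipZr ipP) !(ipZl ipP) !nx.
  rewrite !(ipC ipP _ (K x - _)) !nx (ipC ipP r x) xr x1.
  ring.
rewrite mulrDr => h; apply: lerD => //; rewrite mulrC ler_wpM2l ?sqr_ge0//.
rewrite -[leRHS]real_normK ?num_real// ler_pXn2r// ?nnegrE//.
exact: ltW.
Qed.

End spectral_gap.

(** * Real square-integrable functions *)

Section real_L2.
Context d (T : measurableType d) {R : realType} (mu : probability T R).

Definition rip (f g : T -> R) : R := \int[mu]_x (f x * g x).

Lemma p12 : (1 <= 2%:E :> \bar R)%E.
Proof. by rewrite lee_fin ler1n. Qed.

(** A type of genuine functions: equality is pointwise, and functions that vanish almost everywhere
    are null vectors of [rip2] (see [rip_eq0]). *)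
Definition E2 := LfunType mu p12.

Definition rip2 (f g : E2) : R := rip f g.

Lemma Rintegral_cst1 (c : R) : \int[mu]_x c = c.
Proof.
rewrite Rintegral_cst//.
suff -> : fine (mu setT) = 1 by rewrite mulr1.
by have -> : mu setT = 1%E by exact: probability_setT.
Qed.

Lemma Lfun_measurable p (f : T -> R) : f \in Lfun mu p -> measurable_fun setT f.
Proof. by rewrite inE => /andP[/[!inE]/=]. Qed.

Lemma Lfun2_integrable_mul (f g : T -> R) :
  f \in Lfun mu 2%:E -> g \in Lfun mu 2%:E ->
  mu.-integrable setT (EFin \o (fun x => f x * g x)).
Proof. by move=> hf hg; apply/Lfun1_integrable; exact: Lfun2_mul_Lfun1. Qed.

Lemma Lfun2_integrable (f : T -> R) :
  f \in Lfun mu 2%:E -> mu.-integrable setT (EFin \o f).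
Proof.
move=> hf; apply/Lfun1_integrable; apply: Lfun_subset12 hf.
exact: fin_num_measure.
Qed.

Lemma Lfun2_sqr_integrable (f : T -> R) : measurable_fun setT f ->
  mu.-integrable setT (EFin \o (fun x => f x ^+ 2)) -> f \in Lfun mu 2%:E.
Proof.
move=> mf /integrableP[_ hf]; rewrite inE; apply/andP; split; rewrite inE//=.
rewrite /finite_norm unlock poweR_lty//.
apply: le_lt_trans hf; rewrite le_eqVlt; apply/orP; left; apply/eqP.
apply: eq_integral => x _ /=.
by rewrite powR_mulrn// normrX.
Qed.

Lemma Lfun2_dominated (f g : T -> R) : measurable_fun setT f ->
  g \in Lfun mu 2%:E -> (forall x, `|f x| <= `|g x|) -> f \in Lfun mu 2%:E.
Proof.
move=> mf hg fg; apply: Lfun2_sqr_integrable => //.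
apply: le_integrable (Lfun2_integrable_sqr hg) => //.
  by apply/measurable_EFinP; exact: measurable_funX.
by move=> x _; rewrite /= lee_fin !normrX ler_pXn2r// nnegrE.
Qed.

Lemma bounded_Lfun2 (f : T -> R) B : measurable_fun setT f ->
  (forall x, `|f x| <= B) -> f \in Lfun mu 2%:E.
Proof.
move=> mf fB; apply: Lfun2_sqr_integrable => //.
apply: measurable_bounded_integrable => //.
- by rewrite -ge0_fin_numE// fin_num_measure.
- exact: measurable_funX.
- exists (B ^+ 2); split; first exact: num_real.
  move=> M BM x _ /=; rewrite (le_trans _ (ltW BM))// normrX.
  by rewrite ler_pXn2r// nnegrE (le_trans _ (fB x)).
Qed.

Lemma rip2_semi_inner : semi_inner_product rip2.
Proof.
split.
- by move=> f g; congr fine; apply: eq_integral => x _; rewrite mulrC.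
- move=> f g w; rewrite /rip2 /rip -RintegralD//; last 2 first.
  + exact: Lfun2_integrable_mul (LfunP f) (LfunP w).
  + exact: Lfun2_integrable_mul (LfunP g) (LfunP w).
  by congr fine; apply: eq_integral => x _; rewrite /= mulrDl.
- move=> a f g; rewrite /rip2 /rip -RintegralZl//; last first.
    exact: Lfun2_integrable_mul (LfunP f) (LfunP g).
  by congr fine; apply: eq_integral => x _; rewrite /= mulrA.
- by move=> f; apply: Rintegral_ge0 => x _; rewrite -expr2 sqr_ge0.
Qed.

Lemma ae_imply (P Q : T -> Prop) : {ae mu, forall x, P x} ->
  (forall x, P x -> Q x) -> {ae mu, forall x, Q x}.
Proof. by move=> hP PQ; apply: filterS hP. Qed.

Lemma ae_imply2 (P Q S : T -> Prop) : {ae mu, forall x, P x} ->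
  {ae mu, forall x, Q x} -> (forall x, P x -> Q x -> S x) ->
  {ae mu, forall x, S x}.
Proof. by move=> hP hQ PQ; apply: filterS2 hP hQ. Qed.

Lemma ae_every (P : T -> Prop) : (forall x, P x) -> {ae mu, forall x, P x}.
Proof. exact: filterE. Qed.

Lemma ae_eq_Rintegral (f g : T -> R) : measurable_fun setT f ->
  measurable_fun setT g -> {ae mu, forall x, f x = g x} ->
  \int[mu]_x f x = \int[mu]_x g x.
Proof.
move=> mf mg fg; congr fine; apply: ae_eq_integral => //.
- exact/measurable_EFinP.
- exact/measurable_EFinP.
- by apply: filterS fg => x -> _.
Qed.

Lemma Rintegral_le_ae (f g : T -> R) : measurable_fun setT f ->
  mu.-integrable setT (EFin \o g) -> {ae mu, forall x, `|f x| <= g x} ->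
  `|\int[mu]_x f x| <= \int[mu]_x g x.
Proof.
move=> mf ig fg; rewrite -lee_fin.
have mF : measurable_fun setT (EFin \o f) by exact/measurable_EFinP.
have mg : measurable_fun setT (EFin \o g) by exact: measurable_int ig.
have gE : (\int[mu]_x `|(g x)%:E| = \int[mu]_x (g x)%:E)%E.
  apply: ae_eq_integral => //; first exact: measurableT_comp.
  apply: filterS fg => x fx _ /=; rewrite ger0_norm//.
  exact: le_trans fx.
have le : (\int[mu]_x `|(f x)%:E| <= \int[mu]_x (g x)%:E)%E.
  rewrite -gE; apply: ae_ge0_le_integral => //.
  - exact: measurableT_comp.
  - exact: measurableT_comp.
  - apply: filterS fg => x fx _; rewrite /= lee_fin (le_trans fx)//.
    exact: ler_norm.
have fing : (\int[mu]_x (g x)%:E)%E \is a fin_num by exact: integrable_fin_num.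
have intf : mu.-integrable setT (EFin \o f).
  apply/integrableP; split => //; apply: le_lt_trans le _.
  by rewrite ltey_eq fing.
rewrite EFin_normr_Rintegral// fineK//.
exact: le_trans (le_abse_integral mu measurableT mF) le.
Qed.

Lemma rip_eq0 (f : E2) : rip2 f f = 0 <-> {ae mu, forall x, f x = 0}.
Proof.
have mf := Lfun_measurable (LfunP f).
have i2 := Lfun2_integrable_mul (LfunP f) (LfunP f).
split=> [h|h].
  have : (\int[mu]_x `|(f x * f x)%:E| = 0)%E.
    rewrite -[RHS](fineK (x := 0))//.
    have -> : fine 0 = rip2 f f by rewrite h.
    rewrite fineK; last exact: integrable_fin_num.
    by apply: eq_integral => x _; rewrite /= ger0_norm// -expr2 sqr_ge0.
  have mi := measurable_int mu i2.
  move/(ae_eq_integral_abs mu measurableT mi).1; apply: filterS => x /(_ I)[].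
  by move=> /eqP; rewrite mulf_eq0 orbb => /eqP.
rewrite /rip2 /rip (@ae_eq_Rintegral _ (cst 0)).
- by rewrite Rintegral_cst// mul0r.
- exact: measurable_funM.
- by [].
- by apply: filterS h => x ->; rewrite mul0r.
Qed.

(** The total mass is 1, so a uniform bound passes to the L^2 norm without a constant. Every
    operator estimate below is obtained through this. *)
Lemma ipnorm_le_bound (f : E2) B : 0 <= B ->
  {ae mu, forall x, `|f x| <= B} -> ipnorm (ip := rip2) f <= B.
Proof.
move=> B0 h; rewrite -(@ler_pXn2r _ 2)// ?nnegrE ?ipnorm_ge0//.
rewrite (sqr_ipnorm rip2_semi_inner) (le_trans (ler_norm _))//.
have -> : B ^+ 2 = \int[mu]_x (cst (B ^+ 2) x).
  by rewrite Rintegral_cst1.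
apply: Rintegral_le_ae.
- by apply: measurable_funM; exact: Lfun_measurable (LfunP f).
- exact: finite_measure_integrable_cst.
- apply: filterS h => x fx; rewrite -expr2 normrX.
  by rewrite ler_pXn2r// nnegrE.
Qed.

End real_L2.

(** * Kernel integral operators *)

(** Tychonoff's theorem on the product of the intervals [- B, B]. It takes the place of a diagonal
    extraction in an Arzela-Ascoli argument. *)
Lemma bounded_pointwise_cluster (R : realType) (I : eqType) (u : nat -> I -> R)
    (B : R) : (forall n i, `|u n i| <= B) ->
  exists g : I -> R, forall (s : seq I) e N, 0 < e ->
    exists2 n, (N <= n)%N & forall i, i \in s -> `|u n i - g i| < e.
Proof.
move=> uB; pose Pi := prod_topology (fun _ : I => R : topologicalType).
pose A (i : I) : set R := [set` `[- B, B]].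
have cA : compact ([set f | forall i, A i (f i)] : set Pi).
  by apply: tychonoff => i; exact: segment_compact.
have FA : ((u : nat -> Pi) @ \oo) [set f | forall i, A i (f i)].
  by exists 0%N => // n _ i; rewrite /A /= in_itv /= -ler_norml.
have [g [_ gc]] := cA _ _ FA.
exists g => s e N e0.
have nb : nbhs (g : Pi) [set f : Pi | forall i, i \in s -> `|f i - g i| < e].
  elim: s => [|i s ih]; first by apply: filterS filterT => f _ i.
  have h : nbhs (g : Pi) [set f : Pi | `|f i - g i| < e].
    have hb : nbhs (g : Pi) (proj i @^-1` ball (g i) e).
      apply: (@proj_continuous I (fun=> R : topologicalType) i g).
      exact: nbhsx_ballx.
    apply: (@filterS _ (nbhs (g : Pi)) _ _ _ _ hb) => f.
    by rewrite /preimage /proj -ball_normE /= distrC.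
  apply: filterS2 h ih => f h1 h2 j; rewrite inE => /predU1P[->//|].
  exact: h2.
have hN : ((u : nat -> Pi) @ \oo) [set u n | n in [set n | (N <= n)%N]].
  by exists N => // n Nn; exists n.
by have [_ [[n Nn <-] h]] := gc _ _ hN nb; exists n.
Qed.

Lemma compact_finite_net (T : ptopologicalType) (X : set T) (U : T -> set T) :
  compact X -> (forall x, X x -> nbhs x (U x)) ->
  exists2 s : seq T, (forall x, x \in s -> X x) &
    forall y, X y -> exists2 x, x \in s & U x y.
Proof.
move=> cX hU; move: (cX); rewrite compact_cover.
move=> /(_ T X (fun x => (U x)^°)) [|y Xy|D DX XD].
- by move=> x _; exact: open_interior.
- by exists y => //; exact: hU.
- exists (finmap.enum_fset D) => [x xD|y /XD[x xD /interior_subset Uxy]].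
    by have := DX x xD; rewrite inE.
  by exists x.
Qed.

Section borel.
Context {R : realType} {Omega : pmetricType R}.

Lemma open_borel (A : set Omega) :
  open A -> measurable (A : set (borel Omega)).
Proof. by move=> oA; apply: sub_sigma_algebra. Qed.

Lemma closed_borel (A : set Omega) :
  closed A -> measurable (A : set (borel Omega)).
Proof.
move=> cA; rewrite -[A]setCK; apply: measurableC.
by apply: open_borel; exact: closed_openC.
Qed.

Lemma compact_borel (A : set Omega) :
  compact A -> measurable (A : set (borel Omega)).
Proof.
by move=> cA; apply: closed_borel; apply: compact_closed => //;
  exact: metric_hausdorff.
Qed.

Lemma continuous_borel (f : Omega -> R) :
  continuous f -> measurable_fun setT (f : borel Omega -> R).
Proof.
move=> cf; apply: (measurability _ (RGenOInfty.measurableE R)).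
move=> _ [_ [x ->] <-]; rewrite setTI; apply: open_borel.
by apply: open_comp => // y _; exact: cf.
Qed.

Lemma continuous_borel_map (f : Omega -> Omega) : continuous f ->
  measurable_fun setT (f : borel Omega -> borel Omega).
Proof.
move=> cf.
have h : @measurable _ (borel Omega) = <<s @open Omega >> by [].
apply: (measurability _ h).
move=> _ [B oB <-]; rewrite setTI; apply: open_borel.
by apply: open_comp => // y _; exact: cf.
Qed.

End borel.

Section kernel_operator.
Context {R : realType} {Omega : pmetricType R}.
Variables (mu : probability (borel Omega) R) (X : set Omega).
Hypotheses (cX : compact X) (muX : mu X = 1%E).

Lemma ae_in : {ae mu, forall x, X x}.
Proof.
exists (~` X); split => //.
  by apply: measurableC; exact: compact_borel.
by rewrite probability_setC ?muX ?subee//; exact: compact_borel.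
Qed.

(** [uk_cont] is continuity in the first variable, uniform over the set [X] that carries [mu].
    Measurability is asked slice by slice. *)
Record uniform_kernel (k : Omega -> Omega -> R) (B : R) : Prop := {
  uk_bnd : forall x y, `|k x y| <= B ;
  uk_cont : forall x0 e, 0 < e ->
    \forall x \near x0, forall y, X y -> `|k x y - k x0 y| <= e ;
  uk_meas : forall x, measurable_fun setT (k x : borel Omega -> R) ;
  uk_sym : forall x y, k x y = k y x }.

Variables (k : Omega -> Omega -> R) (B : R).
Hypothesis hk : uniform_kernel k B.
Local Notation E2 := (E2 mu).
Local Notation rip2 := (@rip2 _ _ R mu).
Local Notation ipnorm := (ipnorm (ip := rip2)).
Local Notation ipP := (rip2_semi_inner mu).

Let B0 : 0 <= B. Proof. exact: le_trans (uk_bnd hk point point). Qed.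

Definition kslice (x : Omega) : E2 :=
  Lfun_Sub p12 (bounded_Lfun2 mu (uk_meas hk x) (uk_bnd hk x)).

(** Written as an inner product with a slice, the integral inherits linearity and all its bounds
    from the semi-inner product. It is defined at every point, as evaluation along orbits
    requires. *)
Definition kint (f : E2) (x : Omega) : R := rip2 (kslice x) f.

Lemma kintE f x : kint f x = rip2 (kslice x) f. Proof. by []. Qed.

Lemma norm_kslice x : ipnorm (kslice x) <= B.
Proof.
apply: ipnorm_le_bound => //; apply: ae_every => y; exact: (uk_bnd hk).
Qed.

Lemma kint_bound f x : `|kint f x| <= B * ipnorm f.
Proof.
rewrite (le_trans (ip_le_norm ipP _ _))// ler_wpM2r ?ipnorm_ge0//.
exact: norm_kslice.
Qed.

Lemma kint_diff f x x' e : 0 <= e ->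
  (forall y, X y -> `|k x y - k x' y| <= e) ->
  `|kint f x - kint f x'| <= e * ipnorm f.
Proof.
move=> e0 h; rewrite /kint -(ipNl ipP) -(ipDl ipP).
rewrite (le_trans (ip_le_norm ipP _ _))// ler_wpM2r ?ipnorm_ge0//.
by apply: ipnorm_le_bound => //; apply: ae_imply ae_in _ => y /h.
Qed.

Lemma kint_near f x e : 0 < e -> \forall x' \near x, `|kint f x' - kint f x| <= e.
Proof.
move=> e0; have d0 : 0 < e / (1 + ipnorm f).
  by rewrite divr_gt0// ltr_pwDl ?ipnorm_ge0.
apply: filterS (uk_cont hk x d0) => x' /(kint_diff f (ltW d0)).
move=> /le_trans; apply; rewrite mulrAC ler_pdivrMr ?ltr_pwDl ?ipnorm_ge0//.
by rewrite ler_pM2l// lerDr.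
Qed.

Lemma kint_continuous f : continuous (kint f).
Proof.
move=> x; apply/cvgrPdist_le => e e0.
by apply: filterS (@kint_near f x e e0) => x'; rewrite distrC.
Qed.

Definition kop (f : E2) : E2 :=
  Lfun_Sub p12 (bounded_Lfun2 mu (continuous_borel (@kint_continuous f))
    (kint_bound f)).

Lemma kopE f x : kop f x = kint f x. Proof. by []. Qed.

Lemma kop_lin a f g : kop (a *: f + g) = a *: kop f + kop g.
Proof.
apply/LfuneqP => x.
rewrite -[LHS]/(kint _ x) -[RHS]/(a * kint f x + kint g x) /kint.
by rewrite !(ipE ipP).
Qed.

Lemma kop_linD f g : kop (f + g) = kop f + kop g.
Proof. by have := kop_lin 1 f g; rewrite !scale1r. Qed.

Lemma kop_bnd : exists C, forall f, rip2 (kop f) (kop f) <= C * rip2 f f.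
Proof.
exists (B ^+ 2) => f; rewrite -!(sqr_ipnorm ipP) -exprMn.
rewrite ler_pXn2r// ?nnegrE ?ipnorm_ge0 ?mulr_ge0 ?ipnorm_ge0//.
apply: ipnorm_le_bound; first by rewrite mulr_ge0 ?ipnorm_ge0.
by apply: ae_every => x; exact: kint_bound.
Qed.

(* A pointwise cluster point of the images is a uniform one on [X], because they
   are equicontinuous. *)
Lemma kop_cpt : compact_operator (ip := rip2) kop.
Proof.
move=> f f1.
have nf n : ipnorm (f n) <= 1 by rewrite /ipnorm -sqrtr1 ler_sqrt.
have uB n x : `|kint (f n) x| <= B.
  by rewrite (le_trans (kint_bound _ _))// ler_piMr.
have [g hg] := bounded_pointwise_cluster (fun n x => uB n x).
have gB x : `|g x| <= B.
  apply/ler_addgt0Pr => e e0; have [n _ hn] := hg [:: x] e 0%N e0.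
  have := hn x; rewrite inE eqxx distrC => /(_ isT) h.
  rewrite -(subrK (kint (f n) x) (g x)) (le_trans (ler_normD _ _))//.
  by rewrite addrC lerD// ltW.
have close n x x' e : 0 <= e -> (forall y, X y -> `|k x y - k x' y| <= e) ->
    `|kint (f n) x - kint (f n) x'| <= e.
  by move=> e0 /(kint_diff (f n) e0)/le_trans; apply; rewrite ler_piMr.
have gclose x x' e : 0 <= e -> (forall y, X y -> `|k x y - k x' y| <= e) ->
    `|g x - g x'| <= e.
  move=> e0 h; apply/ler_addgt0Pr => d d0.
  have [n _ hn] := hg [:: x; x'] (d / 2) 0%N (divr_gt0 d0 (ltr0Sn _ 1)).
  have := hn x; rewrite inE eqxx => /(_ isT) /ltW h1.
  have := hn x'; rewrite !inE eqxx orbT => /(_ isT) /ltW h2.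
  have h3 := close n x x' e e0 h.
  have -> : g x - g x' = - (kint (f n) x - g x) + (kint (f n) x - kint (f n) x')
     + (kint (f n) x' - g x') by ring.
  rewrite (le_trans (ler_normD _ _))// [d]splitr [leRHS]addrA lerD//.
  by rewrite (le_trans (ler_normD _ _))// normrN addrC lerD.
have cg : continuous g.
  move=> x; apply/cvgrPdist_le => e e0.
  by apply: filterS (uk_cont hk x e0) => x' h; rewrite distrC gclose// ltW.
exists (Lfun_Sub p12 (bounded_Lfun2 mu (continuous_borel cg) gB)).
move=> e e0 N.
(* Three errors of size m / 4 with m = min(1, e) add up to 3 m / 4, whose square is below [e]
   because m <= 1. *)
have d0 : 0 < Num.min 1 e / 4 by rewrite divr_gt0// lt_min ltr01.
have [s sX sU] := compact_finite_net cX (fun x _ => uk_cont hk x d0).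
have [n Nn hn] := hg s _ N d0; exists n => //.
rewrite -(sqr_ipnorm ipP).
apply: (@le_lt_trans _ _ ((3 * (Num.min 1 e / 4)) ^+ 2)); last first.
  have m0 : 0 < Num.min 1 e by rewrite lt_min ltr01.
  have m1 : Num.min 1 e <= 1 by rewrite ge_min lexx.
  have m2 : Num.min 1 e <= e by rewrite ge_min lexx orbT.
  move: (Num.min 1 e) m0 m1 m2 => m; nra.
rewrite ler_pXn2r// ?nnegrE ?ipnorm_ge0//; last first.
  exact: mulr_ge0 (ler0n _ 3) (ltW d0).
apply: ipnorm_le_bound; first by rewrite mulr_ge0// ltW.
apply: ae_imply ae_in _ => y /sU[x xs h].
rewrite -[X in `|X|]/(kint (f n) y - g y).
have h1 := close n y x _ (ltW d0) h; have h2 := gclose y x _ (ltW d0) h.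
have h3 := ltW (hn x xs).
have -> : kint (f n) y - g y = (kint (f n) y - kint (f n) x)
  + (kint (f n) x - g x) - (g y - g x) by ring.
rewrite (le_trans (ler_normB _ _))// (_ : 3 * _ = Num.min 1 e / 4 + Num.min 1 e / 4 + Num.min 1 e / 4); last by ring.
by rewrite lerD// (le_trans (ler_normD _ _))// lerD.
Qed.

Lemma L1_integrable (f : E2) : mu.-integrable setT (EFin \o (fun x => `|f x|)).
Proof. exact: integrable_norm (Lfun2_integrable (LfunP f)). Qed.

Lemma rip2_le_ae (f g : E2) c : 0 <= c ->
  {ae mu, forall x, f x != 0 -> `|g x| <= c} ->
  `|rip2 f g| <= c * \int[mu]_x `|f x|.
Proof.
move=> c0 h; rewrite -RintegralZl//; last exact: L1_integrable.
apply: Rintegral_le_ae.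
- exact: measurable_funM (Lfun_measurable (LfunP f)) (Lfun_measurable (LfunP g)).
- have := integrableZl measurableT c (L1_integrable f).
  by apply: eq_integrable.
- apply: ae_imply h _ => x; have [->|f0 /(_ isT) h] := eqVneq (f x) 0.
    by rewrite mul0r normr0 mulr0.
  by rewrite normrM mulrC ler_wpM2r.
Qed.

(** The interior makes this set open, hence Borel, so that functions can be cut off on it. *)
Let near_set e x0 : set Omega :=
  ([set x | forall y, X y -> `|k x y - k x0 y| <= e])^°.

Let restr (U : set Omega) (g : E2) (x : borel Omega) : R := g x * \1_U x.

Let restr_Lfun U g : measurable (U : set (borel Omega)) ->
  restr U g \in Lfun mu 2%:E.
Proof.
move=> mU; apply: (Lfun2_dominated _ (LfunP g)).
  by apply: measurable_funM; [exact: Lfun_measurable (LfunP g)|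
    exact: measurable_indic].
move=> x; rewrite normrM ler_piMr// indicE.
by case: (_ \in _); rewrite ?normr1 ?normr0.
Qed.

Let rip2_cst_r (f : E2) c (hc : (cst c : borel Omega -> R) \in Lfun mu 2%:E) :
  rip2 f (Lfun_Sub p12 hc) = c * \int[mu]_x f x.
Proof.
rewrite -RintegralZl//; last exact: Lfun2_integrable (LfunP f).
by congr fine; apply: eq_integral => x _; rewrite mulrC.
Qed.

(* A finite-rank approximation replaces Fubini's theorem, as [k] is not known
   to be measurable for the product of the Borel sigma-algebras. *)
Let kop_sym_approx e (s : seq Omega) : 0 < e -> forall f g : E2,
  (forall x, X x -> g x != 0 -> exists2 x0, x0 \in s & near_set e x0 x) ->
  `|rip2 g (kop f) - rip2 f (kop g)| <=
    2 * e * ipnorm f * \int[mu]_x `|g x|.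
Proof.
move=> e0; elim: s => [|x0 s ih] f g hg.
  have g0 : rip2 g g = 0.
    apply/rip_eq0; apply: ae_imply ae_in _ => x Xx; apply/eqP.
    by apply: contraT => /(hg _ Xx)[].
  have -> : rip2 f (kop g) = 0.
    rewrite (ipC ipP); apply: (ip_null ipP); apply/rip_eq0; apply: ae_every => x.
    by rewrite kopE /kint (ipC ipP) (ip_null ipP).
  rewrite (ip_null ipP)// subrr normr0 mulr_ge0 ?Rintegral_ge0//.
  by rewrite mulr_ge0 ?ipnorm_ge0// mulr_ge0// ltW.
(* [g] is split into its part on [U] and the rest, whose support is covered by the remaining
   points. *)
pose U := near_set e x0.
have mU : measurable (U : set (borel Omega)).
  by apply: open_borel; exact: open_interior.
pose g1 : E2 := Lfun_Sub p12 (restr_Lfun g mU).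
pose g2 : E2 := Lfun_Sub p12 (restr_Lfun g (measurableC mU)).
have g1E x : g1 x = g x * \1_U x by [].
have g2E x : g2 x = g x * \1_(~` U) x by [].
have gE : g = g1 + g2.
  apply/LfuneqP => x; rewrite -[RHS]/(g1 x + g2 x) g1E g2E !indicE in_setC.
  by case: (_ \in _); rewrite ?mulr1 ?mulr0 ?addr0 ?add0r.
have nE : \int[mu]_x `|g x| = \int[mu]_x `|g1 x| + \int[mu]_x `|g2 x|.
  rewrite -RintegralD//; try exact: L1_integrable.
  congr fine; apply: eq_integral => x _; rewrite g1E g2E !indicE in_setC.
  by case: (_ \in _); rewrite ?mulr1 ?mulr0 ?normr0 ?addr0 ?add0r.
have g1U x : g1 x != 0 -> U x.
  rewrite g1E indicE; have [/set_mem//|_] := boolP (x \in U).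
  by rewrite mulr0 eqxx.
have {}ih : `|rip2 g2 (kop f) - rip2 f (kop g2)| <=
    2 * e * ipnorm f * \int[mu]_x `|g2 x|.
  apply: ih => x Xx; rewrite g2E indicE in_setC.
  have [_|xU] := boolP (x \in U); first by rewrite mulr0 eqxx.
  rewrite mulr1 => /(hg _ Xx)[y]; rewrite inE => /predU1P[->|ys hy].
    by move=> h; move/negP : xU; case; exact/mem_set.
  by exists y.
rewrite nE gE kop_linD !(ipE ipP) mulrDr opprD addrACA.
rewrite (le_trans (ler_normD _ _))// lerD//.
(* On [U] the kernel is within [e] of its slice at [x0], so both sides of the symmetry are close to
   [kint f x0 * c]. *)
pose c := \int[mu]_x g1 x.
have ef : 0 <= e * ipnorm f by rewrite mulr_ge0 ?ipnorm_ge0// ltW.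
have i1 : `|rip2 g1 (kop f) - kint f x0 * c| <=
    e * ipnorm f * \int[mu]_x `|g1 x|.
  have hc : (cst (kint f x0) : borel Omega -> R) \in Lfun mu 2%:E.
    exact: Lfun_cst.
  rewrite /c -(rip2_cst_r _ hc) -(ipNr ipP) -(ipDr ipP).
  apply: rip2_le_ae => //; apply: ae_every => x /g1U/interior_subset h.
  exact: (kint_diff f (ltW e0)).
have i2 : `|rip2 f (kop g1) - kint f x0 * c| <=
    e * ipnorm f * \int[mu]_x `|g1 x|.
  rewrite /kint (ipC ipP _ f) (mulrC (rip2 _ _)) -(ipZr ipP) -(ipNr ipP) -(ipDr ipP).
  rewrite (le_trans (ip_le_norm ipP _ _))// mulrAC mulrC.
  rewrite ler_wpM2r ?ipnorm_ge0//.
  have eg : 0 <= e * \int[mu]_x `|g1 x| by rewrite mulr_ge0 ?Rintegral_ge0// ltW.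
  apply: ipnorm_le_bound => //; apply: ae_imply ae_in _ => y Xy.
  rewrite -[X in `|X|]/(kint g1 y - c * k x0 y) mulrC /c.
  have hc : (cst (k x0 y) : borel Omega -> R) \in Lfun mu 2%:E.
    exact: Lfun_cst.
  rewrite -(rip2_cst_r _ hc) /kint (ipC ipP (kslice y)) -(ipNr ipP) -(ipDr ipP).
  apply: rip2_le_ae => //; first exact: ltW.
  apply: ae_every => x /g1U/interior_subset h.
  rewrite -[X in `|X|]/(k y x - k x0 y) (uk_sym hk y x).
  exact: h.
rewrite -(subrKA (kint f x0 * c)) (le_trans (ler_normD _ _))//.
have -> : 2 * e * ipnorm f = e * ipnorm f + e * ipnorm f.
  by rewrite -mulrA mulr_natl mulr2n.
by rewrite mulrDl; apply: (lerD i1); rewrite distrC; exact: i2.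
Qed.

Lemma kop_sym f g : rip2 f (kop g) = rip2 (kop f) g.
Proof.
rewrite (ipC ipP (kop f)); apply/esym/eqP; rewrite -subr_eq0 -normr_le0.
apply/ler_addgt0Pr => e e0; rewrite add0r.
pose C := 1 + 2 * ipnorm f * \int[mu]_x `|g x|.
have C1 : 0 < C.
  by rewrite ltr_pwDl// mulr_ge0 ?Rintegral_ge0// mulr_ge0// ipnorm_ge0.
have d0 : 0 < e / C by exact: divr_gt0.
have [s sX sU] : exists2 s : seq Omega, (forall x, x \in s -> X x) &
    forall y, X y -> exists2 x, x \in s & near_set (e / C) x y.
  apply: compact_finite_net => // x _; apply: nbhs_interior.
  exact: (uk_cont hk x d0).
have /(_ f g) := kop_sym_approx d0 (s := s).
move=> /(_ (fun x Xx _ => sU x Xx))/le_trans; apply.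
have eC : e = (e / C) * C by rewrite divfK// gt_eqF.
have CE : C = 1 + 2 * ipnorm f * \int[mu]_x `|g x| by [].
rewrite [leRHS]eC; move: (e / C) d0 => d d0; rewrite CE.
by move: (ipnorm f) (Rintegral _ _ _) => N L; lra.
Qed.

Lemma kop_positive_compact : (forall f, 0 <= rip2 f (kop f)) ->
  positive_compact (ip := rip2) kop.
Proof.
move=> h; split => //; [exact: kop_lin|exact: kop_sym|exact: kop_bnd|exact: kop_cpt].
Qed.

End kernel_operator.

(** * Composition with measure-preserving maps *)

Section measure_preserving.
Context d (T : measurableType d) {R : realType} (mu : probability T R).
Local Notation E2 := (E2 mu).
Local Notation rip2 := (@rip2 _ _ R mu).
Local Notation ipP := (rip2_semi_inner mu).

Record measure_preserving (S : T -> T) : Prop := {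
  mp_meas : measurable_fun setT S ;
  mp_inv : forall B, measurable B -> mu (S @^-1` B) = mu B }.

Variable S : T -> T.
Hypothesis hS : measure_preserving S.

Lemma mp_integral (f : T -> \bar R) : measurable_fun setT f ->
  (forall x, 0 <= f x)%E -> (\int[mu]_x f (S x) = \int[mu]_x f x)%E.
Proof.
move=> mf f0; rewrite -[LHS]/(\int[mu]_(x in S @^-1` setT) (f \o S) x)%E.
rewrite -(ge0_integral_pushforward (mp_meas hS) mu measurableT)//.
apply: eq_measure_integral; first exact: mp_meas hS.
by move=> mS A mA _; exact: (mp_inv hS mA).
Qed.

Lemma mp_Lfun2 (f : T -> R) : f \in Lfun mu 2%:E -> f \o S \in Lfun mu 2%:E.
Proof.
move=> hf; have mf := Lfun_measurable hf.
have mfS : measurable_fun setT (f \o S) by apply: measurableT_comp (mp_meas hS).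
apply: Lfun2_sqr_integrable => //; apply/integrableP; split.
  by apply/measurable_EFinP; exact: measurable_funX.
have /integrableP[m2 i2] := Lfun2_integrable_sqr hf.
rewrite (le_lt_trans _ i2)// le_eqVlt; apply/orP; left; apply/eqP.
apply: (@mp_integral (fun x => `|(f x ^+ 2)%:E|%E)) => //.
exact: measurableT_comp.
Qed.

Definition compop (f : E2) : E2 := Lfun_Sub (p12 (R := R)) (mp_Lfun2 (LfunP f)).

Lemma compop_lin a f g : compop (a *: f + g) = a *: compop f + compop g.
Proof. by apply/LfuneqP. Qed.

Lemma compop_isometry_sqr f : rip2 (compop f) (compop f) = rip2 f f.
Proof.
congr fine; apply: (@mp_integral (fun x => (f x * f x)%:E)).
- have mf := Lfun_measurable (LfunP f).
  by apply/measurable_EFinP; exact: measurable_funM.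
- by move=> x; rewrite lee_fin -expr2 sqr_ge0.
Qed.

(** By polarisation, since [mp_integral] is about nonnegative integrands. *)
Lemma compop_isometry f g : rip2 (compop f) (compop g) = rip2 f g.
Proof.
have := compop_isometry_sqr (f + g); rewrite -[f]scale1r compop_lin !scale1r.
rewrite !(ipE ipP) !compop_isometry_sqr (ipC ipP (compop g)) (ipC ipP g f).
by move: (rip2 _ _) (rip2 _ _) (rip2 _ _) (rip2 _ _) => a b c e; lra.
Qed.

End measure_preserving.

(** * Kernel operators along the flow: commutator and derivative *)

Section kernel_flow.
Context {R : realType} {Omega : pmetricType R}.
Variables (mu : probability (borel Omega) R) (X : set Omega).
Hypotheses (cX : compact X) (muX : mu X = 1%E).
Variables (k : Omega -> Omega -> R) (B : R).
Hypothesis hk : uniform_kernel X k B.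
Local Notation E2 := (E2 mu).
Local Notation rip2 := (@rip2 _ _ R mu).
Local Notation ipnorm := (ipnorm (ip := rip2)).
Local Notation ipP := (rip2_semi_inner mu).
Local Notation kslice := (kslice mu hk).
Local Notation kint := (kint hk).
Local Notation kop := (kop cX muX hk).

(** Invariance of [mu] writes [K f] at [S x] as the integral over y of k(S x, S y) f(S y), to be
    compared with the integral of k(x, y) f(S y): only the variation of the kernel remains. *)
Lemma kop_commutator (S : Omega -> Omega) (hS : measure_preserving mu S) c f :
  (forall x, X x -> X (S x)) -> 0 <= c ->
  (forall x y, X x -> X y -> `|k (S x) (S y) - k x y| <= c) ->
  ipnorm (kop (compop hS f) - compop hS (kop f)) <= c * ipnorm f.
Proof.
move=> XS c0 h; apply: ipnorm_le_bound; first by rewrite mulr_ge0 ?ipnorm_ge0.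
apply: ae_imply (ae_in cX muX) _ => x Xx.
rewrite -[X in `|X|]/(kint (compop hS f) x - kint f (S x)).
rewrite !kintE -(compop_isometry hS (kslice (S x)) f) -(ipNl ipP) -(ipDl ipP).
rewrite (le_trans (ip_le_norm ipP _ _))//.
have -> : ipnorm (compop hS f) = ipnorm f by rewrite !ipnormE compop_isometry.
rewrite ler_wpM2r ?ipnorm_ge0//; apply: ipnorm_le_bound => //.
apply: ae_imply (ae_in cX muX) _ => y Xy.
rewrite -[X in `|X|]/(k x y - k (S x) (S y)) distrC.
exact: h.
Qed.

(** The difference quotients of [kint f] along the flow are uniformly Cauchy on [X]. The derivative
    is built as their limit, not as the integral of [kappa] against [f], because nothing is assumed
    on the measurability of [kappa]. *)
Lemma kop_derivative (Phi : R -> Omega -> Omega)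
    (hPhi : forall t, measure_preserving mu (Phi t))
    (kappa : Omega -> Omega -> R) C f :
  (forall x y, X x -> X y -> `|kappa x y| <= C) -> 0 <= C ->
  (forall e, 0 < e -> \forall s \near 0^', forall x y, X x -> X y ->
     `|s^-1 * (k (Phi s x) y - k x y) - kappa x y| <= e) ->
  exists g : E2, ipnorm g <= C * ipnorm f /\
    forall e, 0 < e -> \forall s \near (0 : R)^',
      ipnorm (s^-1 *: (compop (hPhi s) (kop f) - kop f) - g) <= e.
Proof.
move=> kC C0 hkappa.
have aux (d N : R) : 0 < d -> 2 * d * N < d * (2 * N + 1) by lra.
pose q s x := s^-1 * (kint f (Phi s x) - kint f x).
have qE s x : q s x = rip2 (s^-1 *: (kslice (Phi s x) - kslice x)) f.
  by rewrite /q !kintE !(ipE ipP).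
have cauchy e : 0 < e -> \forall s \near (0 : R)^', forall s' x, X x ->
    (forall x y, X x -> X y ->
       `|s'^-1 * (k (Phi s' x) y - k x y) - kappa x y| <= e) ->
    `|q s x - q s' x| <= 2 * e * ipnorm f.
  move=> e0; apply: filterS (@hkappa e e0) => s hs s' x Xx hs'.
  rewrite !qE -(ipNl ipP) -(ipDl ipP) (le_trans (ip_le_norm ipP _ _))//.
  rewrite ler_wpM2r ?ipnorm_ge0//; apply: ipnorm_le_bound.
    by rewrite mulr_ge0// ltW.
  apply: ae_imply (ae_in cX muX) _ => y Xy.
  rewrite -[X in `|X|]/(s^-1 * (k (Phi s x) y - k x y)
                        - s'^-1 * (k (Phi s' x) y - k x y)).
  rewrite -(subrKA (kappa x y)) (le_trans (ler_normD _ _))//.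
  by rewrite mulr_natl mulr2n lerD ?hs// distrC hs'.
have bound e : 0 < e -> \forall s \near (0 : R)^', forall x, X x ->
    `|q s x| <= (C + e) * ipnorm f.
  move=> e0; apply: filterS (@hkappa e e0) => s hs x Xx.
  rewrite !qE (le_trans (ip_le_norm ipP _ _))//.
  rewrite ler_wpM2r ?ipnorm_ge0//; apply: ipnorm_le_bound.
    by rewrite addr_ge0// ltW.
  apply: ae_imply (ae_in cX muX) _ => y Xy.
  rewrite -[X in `|X|]/(s^-1 * (k (Phi s x) y - k x y)).
  rewrite -(subrK (kappa x y) (_ * _)) (le_trans (ler_normD _ _))//.
  by rewrite addrC lerD ?hs// kC.
pose t_ n : R := n.+1%:R^-1.
have t0 (A : R -> Prop) : (\forall s \near (0 : R)^', A s) ->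
    \forall n \near \oo, A (t_ n).
  move=> hA.
  have h : \forall y \near (0 : R), y != 0 -> A y by exact: hA.
  have := cvg_harmonic (R := R); move=> /(_ _ h) h'.
  apply: (@filterS _ \oo _ _ _ _ h') => n /=; apply.
  by apply: invr_neq0; rewrite pnatr_eq0.
have qc x : X x -> cvgn (fun n => q (t_ n) x).
  move=> Xx; apply: cauchy_cvg; apply: cauchy_exP => e e0.
  pose d := e / (2 * ipnorm f + 1).
  have D0 : 0 < 2 * ipnorm f + 1 by rewrite ltr_pwDr// mulr_ge0 ?ipnorm_ge0.
  have d0 : 0 < d by exact: divr_gt0.
  have c1 := t0 _ (@cauchy d d0); have c2 := t0 _ (@hkappa d d0).
  have [N hN] := filter_ex c2.
  exists (q (t_ N) x); apply: filterS c1 => n /(_ _ _ Xx hN) h.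
  rewrite -ball_normE /= distrC (le_lt_trans h)//.
  have dE : e = d * (2 * ipnorm f + 1) by rewrite /d divfK// gt_eqF.
  by rewrite [ltRHS]dE aux.
(* The sequence of times and the indicator make [g0] an everywhere convergent limit of measurable
   functions. *)
pose g0 x := limn (fun n => q (t_ n) x * \1_X x).
have ind1 x : X x -> (fun n => q (t_ n) x * \1_X x) = (fun n => q (t_ n) x).
  by move=> Xx; apply/funext => n; rewrite indicE mem_set// mulr1.
have ind0 x : ~ X x -> (fun n => q (t_ n) x * \1_X x) = cst 0.
  by move=> Xx; apply/funext => n; rewrite indicE memNset// mulr0.
have gX x : X x -> (fun n => q (t_ n) x) @ \oo --> g0 x.
  by move=> Xx; rewrite /g0 ind1//; exact: qc.
have gN x : ~ X x -> g0 x = 0.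
  by move=> Xx; rewrite /g0 ind0// lim_cst.
have gB x : `|g0 x| <= C * ipnorm f.
  have Cf : 0 <= C * ipnorm f by rewrite mulr_ge0// ipnorm_ge0.
  have [Xx|Xx] := pselect (X x); last by rewrite gN// normr0.
  apply/ler_addgt0Pr => e e0.
  pose d := e / (ipnorm f + 1).
  have D0 : 0 < ipnorm f + 1 by rewrite ltr_pwDr// ipnorm_ge0.
  have d0 : 0 < d / 2 by rewrite !divr_gt0.
  have c1 := t0 _ (@bound _ d0).
  have /cvgrPdist_lt/(_ _ d0) c2 := gX x Xx.
  have [n [h1 h2]] := filter_ex (filterI c1 c2).
  rewrite -(subrK (q (t_ n) x) (g0 x)) (le_trans (ler_normD _ _))//.
  have dE : e = d * (ipnorm f + 1) by rewrite divfK// gt_eqF.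
  have := h1 x Xx; have := ltW h2; rewrite dE.
  have := ipnorm_ge0 (ip := rip2) f; have : 0 < d by exact: divr_gt0.
  move: (ipnorm f) (`|_ - _|) (`|q _ _|) => N a b; nra.
have mg : measurable_fun setT (g0 : borel Omega -> R).
  apply: (@measurable_fun_cvg _ _ _ setT
    (fun n (x : borel Omega) => q (t_ n) x * \1_X x)).
    move=> n; apply: measurable_funM; last first.
      by apply: measurable_indic; exact: compact_borel.
    apply: measurable_funM => //; apply: measurable_funB.
      apply: (measurableT_comp (Lfun_measurable (LfunP (kop f)))).
      exact: (mp_meas (hPhi _)).
    exact: (Lfun_measurable (LfunP (kop f))).
  move=> x _; have [Xx|Xx] := pselect (X x).
    by rewrite ind1//; exact: gX.
  by rewrite gN// ind0//; exact: cvg_cst.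
pose g : E2 := Lfun_Sub p12 (bounded_Lfun2 mu mg gB).
exists g; split.
  apply: ipnorm_le_bound; first by rewrite mulr_ge0// ipnorm_ge0.
  by apply: ae_every => x; exact: gB.
move=> e e0; pose d := e / (2 * ipnorm f + 1).
have D0 : 0 < 2 * ipnorm f + 1 by rewrite ltr_pwDr// mulr_ge0 ?ipnorm_ge0.
have d0 : 0 < d by exact: divr_gt0.
apply: filterS (@cauchy d d0) => s hs.
apply: ipnorm_le_bound; first exact: ltW.
apply: ae_imply (ae_in cX muX) _ => x Xx.
rewrite -[X in `|X|]/(q s x - g0 x).
apply/ler_addgt0Pr => r r0.
have /cvgrPdist_lt/(_ _ r0) c1 := gX x Xx.
have [n [h1 h2]] := filter_ex (filterI c1 (t0 _ (@hkappa d d0))).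
have h3 := hs _ _ Xx h2.
rewrite -(subrKA (q (t_ n) x)) (le_trans (ler_normD _ _))//.
rewrite [X in _ + X]distrC lerD ?(ltW h1)// (le_trans h3)//.
have dE : e = d * (2 * ipnorm f + 1) by rewrite /d divfK// gt_eqF.
by rewrite [leRHS]dE ltW// aux.
Qed.

End kernel_flow.

(** * Derivatives in charts *)

Section within_derivative.
Context {R : realType}.
Implicit Types E G : normedModType R.

Lemma linear_0 E G (L : E -> G) : linear L -> L 0 = 0.
Proof.
move=> lL; have := lL 1 0 0; rewrite !scale1r addr0 => h.
by apply: (addrI (L 0)); rewrite -h addr0.
Qed.

Lemma linear_D E G (L : E -> G) x y : linear L -> L (x + y) = L x + L y.
Proof. by move=> lL; have := lL 1 x y; rewrite !scale1r. Qed.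

Lemma linear_Z E G (L : E -> G) a x : linear L -> L (a *: x) = a *: L x.
Proof. by move=> lL; have := lL a x 0; rewrite addr0 (linear_0 lL) addr0. Qed.

Lemma linear_N E G (L : E -> G) x : linear L -> L (- x) = - L x.
Proof. by move=> lL; rewrite -scaleN1r linear_Z// scaleN1r. Qed.

(* Chain rule along a curve that is only differentiable from the right. *)
Lemma within_deriv_curve E G (S : set E) (f : E -> G) x L (c : R -> E) w :
  has_deriv_within S f x L ->
  (\forall t \near (0 : R)^'+, S (c t)) ->
  (fun t : R => t^-1 *: (c t - x)) @ 0^'+ --> w ->
  (fun t : R => t^-1 *: (f (c t) - f x)) @ 0^'+ --> L w.
Proof.
move=> [lL cL dL] Sc cw.
have cx : c t @[t --> 0^'+] --> x.
  have h : (fun t : R => x + t *: (t^-1 *: (c t - x))) @ 0^'+ --> x + 0 *: w.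
    apply: cvgD; first exact: cvg_cst.
    apply: cvgZ => //; apply: cvg_at_right_filter; exact: cvg_id.
  rewrite scale0r addr0 in h.
  apply: cvg_trans h; apply: near_eq_cvg.
  near=> t; have t0 : t != 0 by near: t; exact: nbhs_right_neq.
  by rewrite scalerA divff// scale1r addrC subrK.
have Lw : (fun t : R => L (t^-1 *: (c t - x))) @ 0^'+ --> L w.
  by apply: cvg_comp cw _; exact: cL.
suff h : (fun t : R => t^-1 *: (f (c t) - f x) - L (t^-1 *: (c t - x)))
    @ 0^'+ --> (0 : G).
  have h' : (fun t : R => (t^-1 *: (f (c t) - f x) - L (t^-1 *: (c t - x)))
      + L (t^-1 *: (c t - x))) @ 0^'+ --> L w.
    by rewrite -[L w]add0r; exact: cvgD h Lw.
  apply: cvg_trans h'; apply: near_eq_cvg.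
  by near=> t; rewrite subrK.
apply/cvgrPdist_le => e e0.
have w1 : 0 < `|w| + 1 by rewrite ltr_wpDl.
have d0 : 0 < e / (`|w| + 1) by exact: divr_gt0.
have := dL _ d0; rewrite /within /= => hd.
have {}hd : \forall t \near (0 : R)^'+, S (c t) ->
    `|f (c t) - f x - L (c t - x)| <= e / (`|w| + 1) * `|c t - x|.
  exact: cx hd.
have wb : \forall t \near (0 : R)^'+, `|t^-1 *: (c t - x)| <= `|w| + 1.
  have /cvgrPdist_le/(_ 1 ltr01) := cw; apply: filterS => t h.
  rewrite -[X in `|X|](subKr w) (le_trans (ler_normB _ _))//.
  by rewrite lerD2l.
near=> t; have t0 : 0 < t by near: t; exact: nbhs_right_gt.
have St : S (c t) by near: t.
have bt : `|t^-1 *: (c t - x)| <= `|w| + 1 by near: t.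
have ht : `|f (c t) - f x - L (c t - x)| <= e / (`|w| + 1) * `|c t - x|.
  by move: St; near: t.
rewrite sub0r normrN (linear_Z _ _ lL) -scalerBr normrZ gtr0_norm ?invr_gt0//.
rewrite ler_pdivrMl// (le_trans ht)//.
rewrite normrZ gtr0_norm ?invr_gt0// ler_pdivrMl// in bt.
rewrite (le_trans (ler_wpM2l (ltW d0) bt))//.
by rewrite mulrCA divfK// gt_eqF.
Unshelve. all: by end_near. Qed.

Definition tangent E (S : set E) (x w : E) :=
  \forall t \near (0 : R)^'+, S (x + t *: w).

(* Linear forms are determined by the directions pointing into [S], so that the
   derivative within [S] is unique at [x]. *)
Definition ample E (S : set E) (x : E) :=
  forall L : E -> R^o, linear L -> (forall w, tangent S x w -> L w = 0) ->
  forall w, L w = 0.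

(** Both values are right derivatives along the segments x + t w with [w] tangent, and [ample]
    extends the agreement to all directions. As [deriv_within] is an arbitrary choice, its values
    are accessible only through this uniqueness. *)
Lemma within_deriv_unique E (S : set E) (f : E -> R^o) x L L' :
  ample S x -> has_deriv_within S f x L -> has_deriv_within S f x L' ->
  forall w, L w = L' w.
Proof.
move=> aS hL hL' w; apply/eqP; rewrite -subr_eq0; apply/eqP.
have [lL _ _] := hL; have [lL' _ _] := hL'.
apply: (aS (fun w => L w - L' w)) => [a u u'|{}w tw].
  by rewrite /= lL lL' scalerBr opprD addrACA.
have cw : (fun t : R => t^-1 *: (x + t *: w - x)) @ 0^'+ --> w.
  have h : (fun _ : R => w) @ (0 : R)^'+ --> w by exact: cvg_cst.
  apply: cvg_trans h; apply: near_eq_cvg.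
  near=> t; have t0 : t != 0 by near: t; exact: nbhs_right_neq.
  by rewrite (addrC x) addrK scalerA mulVf// scale1r.
have h := within_deriv_curve hL tw cw; have h' := within_deriv_curve hL' tw cw.
by rewrite (cvg_unique _ h h') ?subrr//; exact: norm_hausdorff.
Unshelve. all: by end_near. Qed.

Lemma within_derivZ E (S : set E) (f : E -> R^o) x L (c : R) :
  has_deriv_within S f x L ->
  has_deriv_within S (fun y => c * f y : R^o) x (fun w => c * L w : R^o).
Proof.
move=> [lL cL dL]; split.
- by move=> a u w; rewrite lL mulrDr; congr (_ + _); exact: mulrCA.
- by move=> w; apply: cvgM; [exact: cvg_cst|exact: cL].
- move=> e e0; have c1 : 0 < `|c| + 1 by rewrite ltr_wpDl.
  apply: filterS (dL _ (divr_gt0 e0 c1)) => y hy.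
  have -> : (c * f y : R) - c * f x - c * L (y - x) = c * (f y - f x - L (y - x)).
    by rewrite !mulrBr.
  rewrite normrM (@le_trans _ _ ((`|c| + 1) * (e / (`|c| + 1) * `|y - x|)))//.
    by rewrite ler_pM// lerDl.
  by rewrite mulrA mulrCA divff ?mulr1// gt_eqF.
Qed.

Lemma deriv_withinP E G (S : set E) (f : E -> G) x L :
  has_deriv_within S f x L -> has_deriv_within S f x (deriv_within S f x).
Proof. by move=> h; apply: xgetPex; exists L. Qed.

(** The half-space is a convex cone, so each of its vectors is tangent at [x]; and for every [w],
    either [w] or [- w] belongs to it. *)
Lemma ample_halfspace n b (O : set 'rV[R]_n) x : open O ->
  (O `&` halfspace b) x -> ample (O `&` halfspace b) x.
Proof.
move=> oO [Ox Hx] L lL hL.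
have nO w : \forall t \near (0 : R)^'+, O (x + t *: w).
  have c : x + t *: w @[t --> (0 : R)^'+] --> x + 0 *: w.
    apply: cvgD; first exact: cvg_cst.
    by apply: cvgZl; apply: cvg_at_right_filter; exact: cvg_id.
  rewrite scale0r addr0 in c; apply: c.
  exact: open_nbhs_nbhs.
have cone w : halfspace b w -> L w = 0.
  move=> Hw; apply: hL; near=> t.
  have t0 : 0 < t by near: t; exact: nbhs_right_gt.
  split; first by near: t; exact: nO.
  by move=> i bt i0; rewrite !mxE addr_ge0// ?Hx// mulr_ge0// ?(ltW t0)// Hw.
move=> w; have [Hw|Hw] := pselect (halfspace b w); first exact: cone.
have Hw' : halfspace b (- w).
  move=> i bt i0; rewrite mxE oppr_ge0 leNgt; apply/negP => wi.
  apply: Hw => j _ j0; suff -> : j = i by exact: ltW.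
  by apply: val_inj; rewrite /= j0 i0.
by have := cone _ Hw'; rewrite (linear_N _ lL) => /eqP; rewrite oppr_eq0 => /eqP.
Unshelve. all: by end_near. Qed.

(** A product of two half-spaces has a corner and is no half-space, yet ampleness survives: [L]
    splits into its restrictions to the factors. *)
Lemma ample_setX E E' (S : set E) (S' : set E') x x' :
  S x -> S' x' -> ample S x -> ample S' x' -> ample (S `*` S') (x, x').
Proof.
move=> Sx Sx' aS aS' L lL hL [w w'].
have -> : (w, w') = (w, 0) + (0, w') :> E * E'.
  by rewrite -[RHS]/(w + 0, 0 + w') addr0 add0r.
rewrite (linear_D _ _ lL).
have -> : L (w, 0) = 0.
  apply: (aS (fun w => L (w, 0))) => [a u u'|{}w tw].
    rewrite -lL; congr L.
    by rewrite -[RHS]/(a *: u + u', a *: 0 + 0) scaler0 addr0.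
  apply: hL; move: tw; apply: filterS => t h.
  rewrite -[_ + _]/(x + t *: w, x' + t *: 0) scaler0 addr0; split => //.
rewrite add0r; apply: (aS' (fun w => L (0, w))) => [a u u'|{}w' tw].
  rewrite -lL; congr L.
  by rewrite -[RHS]/(a *: 0 + 0, a *: u + u') scaler0 addr0.
apply: hL; move: tw; apply: filterS => t h.
rewrite -[_ + _]/(x + t *: 0, x' + t *: w') scaler0 addr0; split => //.
Qed.

(* A supremum of an unbounded set is [0] by convention: this bound makes
   [opnorm] meaningful. *)
Definition finite_basis E := exists bs : seq E,
  forall L : E -> R^o, linear L -> forall w, `|w| <= 1 ->
  `|L w| <= \sum_(b <- bs) `|L b|.

Lemma rV_finite_basis n : finite_basis 'rV[R]_n.
Proof.
exists [seq delta_mx 0 i | i : 'I_n] => L lL w w1.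
rewrite {1}[w]row_sum_delta (big_morph L (fun x y => linear_D x y lL) (linear_0 lL)).
rewrite big_image /= (le_trans (ler_norm_sum _ _ _))// ler_sum// => i _.
rewrite (linear_Z _ _ lL) normrZ ler_piMl// (le_trans _ w1)//.
rewrite [leRHS]mx_normrE.
exact: (le_bigmax _ (fun ij : 'I_1 * 'I_n => `|w ij.1 ij.2|) (ord0, i)).
Qed.

Lemma prod_finite_basis E E' : finite_basis E -> finite_basis E' ->
  finite_basis (E * E')%type.
Proof.
move=> [bs hbs] [bs' hbs'].
exists ([seq (b, 0) | b <- bs] ++ [seq (0, b) | b <- bs']) => L lL [w w'].
rewrite prod_normE ge_max /= => /andP[w1 w'1].
have -> : (w, w') = (w, 0) + (0, w') :> E * E'.
  by rewrite -[RHS]/(w + 0, 0 + w') addr0 add0r.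
rewrite (linear_D _ _ lL) big_cat !big_map /= (le_trans (ler_normD _ _))//.
apply: lerD.
  apply: (hbs (fun w => L (w, 0))) => // a u u'.
  rewrite -lL; congr L.
  by rewrite -[RHS]/(a *: u + u', a *: 0 + 0) scaler0 addr0.
apply: (hbs' (fun w => L (0, w))) => // a u u'.
rewrite -lL; congr L.
by rewrite -[RHS]/(a *: 0 + 0, a *: u + u') scaler0 addr0.
Qed.

Section opnorm.
Variables (E : normedModType R) (bE : finite_basis E) (L : E -> R^o).
Hypothesis lL : linear L.

Let has_sup_opnorm : has_sup [set `|L w| | w in [set w : E | `|w| <= 1]].
Proof.
split; first by exists `|L 0|, 0 => //=; rewrite normr0.
have [bs hbs] := bE; exists (\sum_(b <- bs) `|L b|) => _ [w w1 <-].
exact: hbs.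
Qed.

Lemma opnorm_ge0 : 0 <= opnorm L.
Proof.
apply: (sup_upper_bound has_sup_opnorm); exists 0; first by rewrite /= normr0.
by rewrite (linear_0 lL) normr0.
Qed.

Lemma le_opnorm w : `|L w| <= opnorm L * `|w|.
Proof.
have [->|w0] := eqVneq w 0; first by rewrite (linear_0 lL) !normr0 mulr0.
have wp : 0 < `|w| by rewrite normr_gt0.
rewrite -ler_pdivrMr//.
have -> : `|L w| / `|w| = `|L (`|w|^-1 *: w)|.
  by rewrite (linear_Z _ _ lL) normrZ gtr0_norm ?invr_gt0// mulrC.
apply: (sup_upper_bound has_sup_opnorm); eexists; last reflexivity.
by rewrite /= normrZ gtr0_norm ?invr_gt0// mulVf// gt_eqF.
Qed.

Lemma opnorm_le c : (forall w, `|w| <= 1 -> `|L w| <= c) -> opnorm L <= c.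
Proof.
by move=> h; apply: ge_sup; [exact: has_sup_opnorm.1|move=> _ [w w1 <-]; exact: h].
Qed.

End opnorm.

Lemma within_continuous_comp (T U W : topologicalType) (D : set T) (g : T -> U)
    (h : U -> W) : {within D, continuous g} ->
  {within g @` D, continuous h} -> {within D, continuous (h \o g)}.
Proof.
move=> /subspace_continuousP cg /subspace_continuousP ch.
apply/subspace_continuousP => x Dx.
have gx : (g @` D) (g x) by exists x.
move=> P /(ch _ gx) hP; have cgx := cg x Dx _ hP.
apply: (@filterS _ (nbhs x) _ _ _ _ cgx) => y h1 Dy.
by apply: (h1 Dy); exists y.
Qed.

Lemma compact_within_bounded (T : topologicalType) (G : normedModType R)
    (D K : set T) (g : T -> G) : compact K -> K `<=` D ->
  {within D, continuous g} -> exists B, forall x, K x -> `|g x| <= B.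
Proof.
move=> cK KD cg.
have /compact_bounded[B [_ hB]] : compact (g @` K).
  by apply: continuous_compact => //; exact: continuous_subspaceW KD cg.
exists (B + 1) => x Kx; apply: (hB (B + 1)); last by exists x.
by rewrite ltrDl.
Qed.

Section atlas.
Context {T : topologicalType} {E : normedModType R} (A : atlas T E).
Hypothesis bE : finite_basis E.

Local Notation image i := (achart (i : aidx A) @` adom (i : aidx A)).

(* What the atlases of the manifold and of its square have in common. *)
Record regular_atlas : Prop := {
  ra_ample : forall (i : aidx A) x, adom i x -> ample (image i) (achart i x) ;
  ra_chart : forall i : aidx A, {within adom i, continuous (achart i)} ;
  ra_core : forall i : aidx A, compact (acore i) ;
  ra_sub : forall i : aidx A, acore i `<=` adom i }.

Hypothesis rA : regular_atlas.
Variable f : T -> R^o.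
Hypothesis fC1 : C1fun A f.

Lemma dchartP (i : aidx A) x : adom i x ->
  has_deriv_within (image i) (f \o aparam i) (achart i x) (dchart i f x).
Proof.
move=> Dx; have [Df [hD _]] := fC1 i.
by apply: deriv_withinP (hD _ _); exists x.
Qed.

(** By uniqueness the chosen derivative coincides with the continuous one that [C1fun] provides. *)
Lemma dchart_continuous (i : aidx A) w :
  {within adom i, continuous (fun x => dchart i f x w)}.
Proof.
have [Df [hD cD]] := fC1 i.
have h := within_continuous_comp (@ra_chart rA i) (cD w).
apply/subspace_continuousP => x Dx.
have e y : adom i y -> dchart i f y w = Df (achart i y) w.
  move=> Dy; have iy : image i (achart i y) by exists y.
  by apply: (within_deriv_unique (ra_ample rA Dy) (dchartP Dy)); exact: hD.
move/subspace_continuousP : h => /(_ x Dx); move=> hx.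
have {}hx : (fun y => Df (achart i y) w) @ within (adom i) (nbhs x) -->
    dchart i f x w by rewrite e//; exact: hx.
apply: cvg_trans hx; apply: near_eq_cvg; rewrite near_withinE.
by apply: filterE => y Dy; first [exact: e|apply/esym; exact: e].
Qed.

(** A finite basis reduces the operator norm to finitely many continuous functions on compact cores.
    This guarantees that the supremum in [C1norm] is not a default value. *)
Lemma dchart_bounded :
  exists B, forall (i : aidx A) x, acore i x -> opnorm (dchart i f x) <= B.
Proof.
have [bs hbs] := bE.
have hi (i : aidx A) : exists B, forall x, acore i x -> opnorm (dchart i f x) <= B.
  have : exists B, forall x, acore i x ->
      \sum_(b <- bs) `|dchart i f x b| <= B.
    elim: (bs) => [|b t [B hB]].
      by exists 0 => x _; rewrite big_nil.
    have [B' hB'] := compact_within_bounded (@ra_core rA i) (@ra_sub rA i)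
      (@dchart_continuous i b).
    by exists (B' + B) => x cx; rewrite big_cons lerD ?hB ?hB'.
  move=> [B hB]; exists B => x cx.
  have [lL _ _] := dchartP (ra_sub rA cx).
  apply: opnorm_le => // w w1; rewrite (le_trans _ (hB _ cx))//.
  exact: hbs.
have [B hB] := choice hi.
exists (\sum_i `|B i|) => i x cx; rewrite (le_trans (hB i x cx))//.
rewrite (bigD1 i)//= (le_trans (ler_norm _))// lerDl.
by apply: sumr_ge0.
Qed.

End atlas.

End within_derivative.

Lemma cvg_sum (R : realType) (I T : Type) (F : set_system T) {FF : Filter F}
    (r : seq I) (f : I -> T -> R) (l : I -> R) :
  (forall i, f i @ F --> l i) ->
  (fun t => \sum_(i <- r) f i t) @ F --> \sum_(i <- r) l i.
Proof.
move=> h; elim: r => [|i r ih].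
  by rewrite big_nil; under eq_fun do rewrite big_nil; exact: cvg_cst.
rewrite big_cons; under eq_fun do rewrite big_cons.
by apply: cvgD; [exact: h|exact: ih].
Qed.

(** * Derivatives along the flow *)

Section flow_on_manifold.
Context {R : realType} {Omega : topologicalType} {n : nat}.
Variables (M : set Omega) (A : atlas Omega 'rV[R]_n).
Variables (Phi : R -> Omega -> Omega) (v : aidx A -> Omega -> 'rV[R]_n).
Hypothesis mM : compact_C1_manifold M A.
Hypothesis Phi_cont : forall x, continuous (fun t : R => Phi t x).
Hypothesis Phi0 : forall x, Phi 0 x = x.
Hypothesis PhiM : forall t x, 0 <= t -> M x -> M (Phi t x).
Hypothesis vP : generating_vector_field Phi v.
Implicit Types (i j : aidx A).

Local Notation AA := (prod_atlas A A).

Lemma adom_sub i : adom i `<=` M.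
Proof. by have [W _ ->] := dom_open mM i; move=> x []. Qed.

Lemma carrierE : carrier A = M.
Proof.
apply/seteqP; split=> [x [i xi]|x Mx]; first exact: (adom_sub xi).
by have [i ci] := core_cover mM Mx; exists i; exact: (core_sub mM).
Qed.

Lemma carrier_prodE : carrier AA = M `*` M.
Proof.
rewrite -carrierE; apply/seteqP; split=> [[x y] [[i j] [/= xi yj]]|[x y] [[i xi] [j yj]]].
  by split; [exists i|exists j].
by exists (i, j).
Qed.

Lemma manifold_regular : regular_atlas A.
Proof.
split.
- move=> i x xi; have : (achart i @` adom i) (achart i x) by exists x.
  have [b' [W' oW' E]] := img_open mM i.
  by rewrite E => h; exact: ample_halfspace.
- exact: (chart_cont mM).
- exact: (core_compact mM).
- exact: (core_sub mM).
Qed.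

Let rA := manifold_regular.

Lemma prod_image (i j : aidx A) :
  achart ((i, j) : aidx AA) @` adom ((i, j) : aidx AA) =
  (achart i @` adom i) `*` (achart j @` adom j).
Proof.
apply/seteqP; split=> [_ [[x y] [/= xi yj] <-]|[z w] [[x xi /= xz] [y yj /= yw]]].
  by split; [exists x|exists y].
by exists (x, y) => //; rewrite /= xz yw.
Qed.

Lemma manifold_prod_regular : regular_atlas AA.
Proof.
split.
- move=> [i j] [x y] [/= xi yj]; rewrite prod_image.
  apply: ample_setX; [by exists x|by exists y|exact: (ra_ample rA)..].
- move=> [i j]; apply/subspace_continuousP => -[x y] [/= xi yj].
  have /subspace_continuousP/(_ x xi) cx := @ra_chart _ _ _ _ rA i.
  have /subspace_continuousP/(_ y yj) cy := @ra_chart _ _ _ _ rA j.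
  have c1 : (fun p : Omega * Omega => achart i p.1)
      @ within (adom i `*` adom j) (nbhs (x, y)) --> achart i x.
    move=> P /cx; rewrite /within /= => h.
    exists ([set z | adom i z -> P (achart i z)], setT).
      by split => //; exact: filterT.
    by move=> [a b] /= [h1 _] [ai _]; exact: h1.
  have c2 : (fun p : Omega * Omega => achart j p.2)
      @ within (adom i `*` adom j) (nbhs (x, y)) --> achart j y.
    move=> P /cy; rewrite /within /= => h.
    exists (setT, [set z | adom j z -> P (achart j z)]).
      by split => //; exact: filterT.
    by move=> [a b] /= [_ h1] [_ bj]; exact: h1.
  exact: cvg_pair c1 c2.
- by move=> [i j]; apply: compact_setX; exact: (ra_core rA).
- by move=> [i j] [x y] [/= xi yj]; split; exact: (ra_sub rA).
Qed.

Let rAA := manifold_prod_regular.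

Let bE : finite_basis 'rV[R]_n := @rV_finite_basis R n.
Let bEE : finite_basis ('rV[R]_n * 'rV[R]_n)%type := prod_finite_basis bE bE.

(** Restricted to positive times because [M] is only forward invariant; this is why one-sided
    derivatives appear throughout. *)
Lemma flow_stays_adom i x : adom i x -> \forall t \near (0 : R)^'+, adom i (Phi t x).
Proof.
have [W oW E] := dom_open mM i; rewrite E => -[Mx Wx].
have h : \forall t \near (0 : R)^'+, W (Phi t x).
  have c : Phi t x @[t --> (0 : R)^'+] --> Phi 0 x.
    by apply: cvg_at_right_filter; exact: Phi_cont.
  by apply: c; rewrite Phi0; exact: open_nbhs_nbhs.
near=> t; split; last by near: t.
by apply: PhiM => //; apply: ltW; near: t; exact: nbhs_right_gt.
Unshelve. all: by end_near. Qed.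

Lemma dchart_right_deriv (f : Omega -> R^o) i x : C1fun A f -> adom i x ->
  (fun t : R => t^-1 *: (f (Phi t x) - f x)) @ 0^'+ --> dchart i f x (v i x).
Proof.
move=> fC1 xi.
have hc : \forall t \near (0 : R)^'+, (achart i @` adom i) (achart i (Phi t x)).
  by apply: filterS (flow_stays_adom xi) => t ti; exists (Phi t x).
have h := within_deriv_curve (dchartP fC1 xi) hc ((vP i).1 x xi).
apply: cvg_trans h; apply: near_eq_cvg.
apply: filterS (flow_stays_adom xi) => t ti /=.
by rewrite !(chartK mM).
Qed.

Lemma dirderiv_core (f : Omega -> R^o) x : M x ->
  exists2 i, acore i x & dirderiv v f x = dchart i f x (v i x).
Proof.
move=> Mx; rewrite /dirderiv; case: pickP => [i /asboolP ci|h].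
  by exists i.
by have [i ci] := core_cover mM Mx; have := h i; rewrite asboolT.
Qed.

Lemma dirderiv_right_deriv (f : Omega -> R^o) x : C1fun A f -> M x ->
  (fun t : R => t^-1 *: (f (Phi t x) - f x)) @ 0^'+ --> dirderiv v f x.
Proof.
move=> fC1 Mx; have [i ci ->] := dirderiv_core f Mx.
by apply: dchart_right_deriv => //; exact: (ra_sub rA).
Qed.

(** Independence of the chart without transition maps: in every chart the value is the right
    derivative of [f] along the orbit. *)
Lemma dirderivE (f : Omega -> R^o) i x : C1fun A f -> adom i x ->
  dirderiv v f x = dchart i f x (v i x).
Proof.
move=> fC1 xi; have h := dirderiv_right_deriv fC1 (adom_sub xi).
by apply: (cvg_unique _ h (dchart_right_deriv fC1 xi)); exact: norm_hausdorff.
Qed.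

Lemma vector_field_bounded :
  exists2 B, 0 <= B & forall i x, acore i x -> `|v i x| <= B.
Proof.
have /choice[B hB] : forall i, exists B, forall x, acore i x -> `|v i x| <= B.
  by move=> i; exact: (compact_within_bounded (@ra_core _ _ _ _ rA i) (@ra_sub _ _ _ _ rA i)
    (vP i).2).
exists (\sum_i `|B i|); first exact: sumr_ge0.
move=> i x cx; rewrite (le_trans (hB i x cx))//.
rewrite (bigD1 i)//= (le_trans (ler_norm _))// lerDl.
exact: sumr_ge0.
Qed.

Lemma le_supnorm (T : Type) (G : normedModType R) (D : set T) (f : T -> G) B x :
  (forall x, D x -> `|f x| <= B) -> D x -> `|f x| <= supnorm D f.
Proof.
move=> hB Dx; apply: (@sup_upper_bound _ [set `|f x| | x in D]); last by exists x.
split; first by exists `|f x|; exists x.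
by exists B => _ [y Dy <-]; exact: hB.
Qed.

Lemma supnorm_ge0 (T : Type) (G : normedModType R) (D : set T) (f : T -> G) :
  0 <= supnorm D f.
Proof.
rewrite /supnorm; have [[x Dx]|] := pselect (has_sup [set `|f x| | x in D]).
  case: x => r [y Dy yr]; apply: (@le_trans _ _ r); first by rewrite -yr.
  by apply: (ub_le_sup Dx); exists y.
by move/sup_out => ->.
Qed.

Lemma supnorm_le (T : Type) (G : normedModType R) (D : set T) (f : T -> G) B :
  0 <= B -> (forall x, D x -> `|f x| <= B) -> supnorm D f <= B.
Proof.
move=> B0 h; rewrite /supnorm; have [->|/set0P[_ [x Dx _]]] := eqVneq [set `|f x| | x in D] set0.
  by rewrite sup0.
by apply: ge_sup; [exists `|f x|; exists x|move=> _ [y Dy <-]; exact: h].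
Qed.

Section C1norm_bounds.
Context (T : topologicalType) (E : normedModType R) (B : atlas T E).
Hypotheses (rB : regular_atlas B) (bB : finite_basis E).

Let dset (f : T -> R^o) := [set r | exists (i : aidx B) x, acore i x /\ r = opnorm (dchart i f x)].

Lemma opnorm_dchart_le (f : T -> R^o) (i : aidx B) x : C1fun B f -> acore i x ->
  opnorm (dchart i f x) <= sup (dset f).
Proof.
move=> fC1 ci; have [C hC] := dchart_bounded bB rB fC1.
apply: (@sup_upper_bound _ (dset f)); last by exists i, x.
split; first by exists (opnorm (dchart i f x)), i, x.
by exists C => _ [j [y [cj ->]]]; exact: hC.
Qed.

Lemma sup_dchart_ge0 (f : T -> R^o) : C1fun B f -> 0 <= sup (dset f).
Proof.
move=> fC1; have [->|/set0P[_ [i [x [ci _]]]]] := eqVneq (dset f) set0.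
  by rewrite sup0.
apply: le_trans (opnorm_dchart_le fC1 ci).
have [lL _ _] := dchartP fC1 (ra_sub rB ci).
exact: opnorm_ge0.
Qed.

Lemma opnorm_dchart_le_C1norm (f : T -> R^o) (i : aidx B) x : C1fun B f ->
  acore i x -> opnorm (dchart i f x) <= C1norm B f.
Proof.
move=> fC1 ci; rewrite (le_trans (opnorm_dchart_le fC1 ci))// lerDr.
exact: supnorm_ge0.
Qed.

Lemma C1norm_ge0 (f : T -> R^o) : C1fun B f -> 0 <= C1norm B f.
Proof.
by move=> fC1; rewrite addr_ge0 ?supnorm_ge0//; exact: sup_dchart_ge0.
Qed.

Lemma C1norm_le (f : T -> R^o) a b : 0 <= a -> 0 <= b ->
  (forall x, carrier B x -> `|f x| <= a) ->
  (forall (i : aidx B) x, acore i x -> opnorm (dchart i f x) <= b) ->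
  C1norm B f <= a + b.
Proof.
move=> a0 b0 ha hb; apply: lerD; first exact: supnorm_le.
rewrite -[X in X <= _]/(sup (dset f)).
have [->|/set0P[r [i [x [ci _]]]]] := eqVneq (dset f) set0; first by rewrite sup0.
apply: ge_sup; first by exists (opnorm (dchart i f x)), i, x.
by move=> _ [j [y [cj ->]]]; exact: hb.
Qed.

End C1norm_bounds.

Lemma dirderiv_le_bound B (f : Omega -> R^o) x :
  (forall i x, acore i x -> `|v i x| <= B) -> C1fun A f -> M x ->
  `|dirderiv v f x| <= C1norm A f * B.
Proof.
move=> hB fC1 Mx; have [i ci ->] := dirderiv_core f Mx.
have [lL _ _] := dchartP fC1 (ra_sub rA ci).
rewrite (le_trans (le_opnorm bE lL _))// ler_pM ?opnorm_ge0 ?hB//.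
exact: opnorm_dchart_le_C1norm.
Qed.

Lemma dirderiv_le_opnorm (f : Omega -> R^o) x : C1fun A f -> C1norm A f <= 1 ->
  M x -> `|dirderiv v f x| <= vfield_opnorm v.
Proof.
move=> fC1 f1 Mx; have [B B0 hB] := vector_field_bounded.
have bnd g y : C1fun A g -> C1norm A g <= 1 -> M y -> `|dirderiv v g y| <= B.
  move=> gC1 g1 My; rewrite (le_trans (dirderiv_le_bound hB gC1 My))//.
  by rewrite ler_piMl.
apply: (@le_trans _ _ (supnorm (carrier A) (dirderiv v f))).
  by apply: (@le_supnorm _ _ _ _ B); rewrite carrierE// => y; exact: bnd.
apply: (@sup_upper_bound _ [set supnorm (carrier A) (dirderiv v f)
      | f in [set f : Omega -> R^o | C1fun A f /\ C1norm A f <= 1]]); last by exists f.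
split; first by exists (supnorm (carrier A) (dirderiv v f)), f.
exists B => _ [g [gC1 g1] <-]; apply: supnorm_le => //.
by rewrite carrierE => y; exact: bnd.
Qed.

Section slices.
Variable g : Omega * Omega -> R^o.
Hypothesis gC1 : C1fun AA g.

Local Notation slice y := (fun x => g (x, y) : R^o).
Local Notation dg i j x y := (dchart ((i, j) : aidx AA) g (x, y)).

Lemma slice_deriv i j x y : adom i x -> adom j y ->
  has_deriv_within (achart i @` adom i) (slice y \o aparam i) (achart i x)
    (fun w => dg i j x y (w, 0)).
Proof.
move=> xi yj.
have xy : adom ((i, j) : aidx AA) (x, y) by split.
have [lL cL dL] := dchartP gC1 xy; split.
- move=> a u w; rewrite -lL; congr (dchart _ _ _ _).
  by rewrite -[RHS]/(a *: u + w, a *: 0 + 0) scaler0 addr0.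
- move=> w; apply: (@cvg_comp _ _ _ (fun w => (w, 0)) (dg i j x y)
    _ (nbhs ((w, 0) : 'rV[R]_n * 'rV[R]_n))); last exact: cL.
  exact: cvg_pair (@cvg_id _ (nbhs w)) (cvg_cst 0).
- move=> e e0.
  have c : (fun z => (z, achart j y)) @ nbhs (achart i x) -->
      (achart i x, achart j y).
    exact: cvg_pair (@cvg_id _ (nbhs (achart i x))) (cvg_cst (achart j y)).
  have h := c _ (dL e e0).
  apply: (@filterS _ (nbhs (achart i x)) _ _ _ _ h) => z hz zi.
  have /hz : (achart ((i, j) : aidx AA) @` adom ((i, j) : aidx AA)) (z, achart j y).
    by rewrite prod_image; split => //=; exists y.
  rewrite /= !(chartK mM)//.
  have -> : (z, achart j y) - (achart i x, achart j y) = (z - achart i x, 0).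
    by rewrite -[LHS]/(z - achart i x, achart j y - achart j y) subrr.
  by rewrite prod_normE /= normr0 (max_idPl (normr_ge0 _)).
Qed.

Lemma slice_C1 y : M y -> C1fun A (slice y).
Proof.
rewrite -{1}carrierE => -[j yj] i.
exists (fun z w => dg i j (aparam i z) y (w, 0)); split.
  move=> _ [x xi <-]; rewrite (chartK mM)//; exact: slice_deriv.
move=> w; apply/subspace_continuousP => _ [x xi <-].
have /subspace_continuousP/(_ (achart i x)) cp :
    {within achart i @` adom i, continuous (aparam i)} by exact: (param_cont mM).
have xi' : (achart i @` adom i) (achart i x) by exists x.
have {}cp := cp xi'.
have xy : adom ((i, j) : aidx AA) (aparam i (achart i x), y).
  by split => //=; rewrite (chartK mM).
have /subspace_continuousP/(_ _ xy) cd :=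
  @dchart_continuous _ _ _ _ rAA g gC1 ((i, j) : aidx AA) (w, 0).
move=> P /cd [[P1 P2] [/= h1 h2] h12].
have h1' := cp _ h1.
apply: (@filterS _ (nbhs (achart i x)) _ _ _ _ h1') => z hz zi.
apply: (h12 (aparam i z, y)).
  by split => /=; [exact: hz|exact: nbhs_singleton h2].
by split => //=; have [x' x'i <-] := zi; rewrite (chartK mM).
Qed.

Lemma slice_dchart i j x y w : adom i x -> adom j y ->
  dchart i (slice y) x w = dg i j x y (w, 0).
Proof.
move=> xi yj; have My := adom_sub yj.
have h := slice_deriv xi yj.
exact: (within_deriv_unique (ra_ample rA xi) (dchartP (slice_C1 My) xi) h).
Qed.

Lemma C1funZ (f : Omega -> R^o) c : C1fun A f -> C1fun A (fun x => c * f x : R^o).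
Proof.
move=> fC1 i; have [Df [hD cD]] := fC1 i.
exists (fun z w => c * Df z w : R^o); split.
  by move=> z /hD; exact: within_derivZ.
by move=> w z; apply: cvgM; [exact: cvg_cst|exact: cD].
Qed.

Lemma dchartZ (f : Omega -> R^o) c i x w : C1fun A f -> adom i x ->
  dchart i (fun x => c * f x : R^o) x w = c * dchart i f x w.
Proof.
move=> fC1 xi.
have h := within_derivZ c (dchartP fC1 xi).
exact: (within_deriv_unique (ra_ample rA xi) (dchartP (C1funZ c fC1) xi) h).
Qed.

Variable B : R.
Hypothesis gB : forall x y, M x -> M y -> `|g (x, y)| <= B.

(** The factor [c] serves to scale a slice into the unit ball over which [vfield_opnorm] is a
    supremum. *)
Lemma slice_C1norm y c : M y -> 0 <= c ->
  C1norm A (fun x => c * g (x, y) : R^o) <= c * C1norm AA g.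
Proof.
move=> My c0; rewrite [leRHS]mulrDr.
have [j yj] := core_cover mM My; have yj' := ra_sub rA yj.
apply: C1norm_le.
- by rewrite mulr_ge0 ?supnorm_ge0.
- by rewrite mulr_ge0 ?(sup_dchart_ge0 rAA bEE gC1).
- move=> x; rewrite carrierE => Mx; rewrite normrM ger0_norm// ler_wpM2l//.
  apply: (@le_supnorm _ _ (carrier AA) (g : _ -> R^o) B (x, y)).
    by rewrite carrier_prodE => -[a b] [/= Ma Mb]; exact: gB.
  by rewrite carrier_prodE.
- move=> i x xi; have xi' := ra_sub rA xi.
  have [lL _ _] := dchartP (C1funZ c (slice_C1 My)) xi'.
  apply: (opnorm_le bE lL) => w w1.
  rewrite (dchartZ c _ (slice_C1 My))// (slice_dchart _ xi' yj').
  rewrite normrM ger0_norm// ler_wpM2l//.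
  have xy : acore ((i, j) : aidx AA) (x, y) by split.
  have [lL' _ _] := dchartP gC1 (ra_sub rAA xy).
  apply: le_trans (opnorm_dchart_le rAA bEE gC1 xy).
  rewrite (le_trans (le_opnorm bEE lL' _))// ler_piMr ?(opnorm_ge0 bEE)//.
  by rewrite prod_normE /= normr0 (max_idPl (normr_ge0 _)).
Qed.

Lemma dirderivZ (f : Omega -> R^o) c x : C1fun A f -> M x ->
  dirderiv v (fun x => c * f x : R^o) x = c * dirderiv v f x.
Proof.
move=> fC1 Mx; have h := dirderiv_right_deriv (C1funZ c fC1) Mx.
have h' : (fun t : R => c * (t^-1 *: (f (Phi t x) - f x))) @ 0^'+ -->
    c * dirderiv v f x.
  by apply: cvgM; [exact: cvg_cst|exact: dirderiv_right_deriv].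
apply: (cvg_unique _ h); first exact: norm_hausdorff.
apply: cvg_trans h'; apply: near_eq_cvg; apply: filterE => t /=.
by rewrite -[LHS]/(c * (t^-1 * (f (Phi t x) - f x))) mulrCA mulrBr.
Qed.

Lemma vfield_opnorm_ge0 : 0 <= vfield_opnorm v.
Proof.
rewrite /vfield_opnorm; set S := [set _ | _ in _].
have [hS|/sup_out ->//] := pselect (has_sup S).
have [[r [f hf fr]] ub] := hS.
apply: (@le_trans _ _ r); first by rewrite -fr supnorm_ge0.
by apply: (ub_le_sup ub); exists f.
Qed.

Lemma dirderiv_slice_le x y : M x -> M y ->
  `|dirderiv v (slice y) x| <= vfield_opnorm v * C1norm AA g.
Proof.
move=> Mx My; set N := C1norm AA g.
have N0 : 0 <= N by apply: (C1norm_ge0 rAA bEE gC1).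
have V0 := vfield_opnorm_ge0; have gyC1 := slice_C1 My.
(* The slice is divided by [N + e] since [N] may vanish. *)
have key e : 0 < e -> `|dirderiv v (slice y) x| <= (N + e) * vfield_opnorm v.
  move=> e0; have Ne : 0 < N + e by rewrite ltr_wpDl.
  have c0 : 0 <= (N + e)^-1 by rewrite invr_ge0 ltW.
  rewrite -ler_pdivrMl//.
  have -> : (N + e)^-1 * `|dirderiv v (slice y) x| =
      `|dirderiv v (fun x => (N + e)^-1 * g (x, y) : R^o) x|.
    by rewrite dirderivZ// normrM (ger0_norm c0).
  apply: dirderiv_le_opnorm => //; first exact: C1funZ.
  rewrite (le_trans (slice_C1norm My c0))// ler_pdivrMl// mulr1.
  by rewrite lerDl ltW.
apply/ler_addgt0Pr => e e0.
have V1 : 0 < vfield_opnorm v + 1 by rewrite ltr_wpDl.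
rewrite (le_trans (key _ (divr_gt0 e0 V1)))// mulrDl mulrC lerD2l.
by rewrite mulrAC ler_pdivrMr// ler_pM2l// lerDl.
Qed.

Lemma dirderiv_sliceE i j x y : adom i x -> adom j y ->
  dirderiv v (slice y) x = dg i j x y (v i x, 0).
Proof.
move=> xi yj; have My := adom_sub yj.
by rewrite (dirderivE (slice_C1 My) xi) (slice_dchart _ xi yj).
Qed.

(** [C1fun] gives continuity of the derivative in each fixed direction, while the direction [v i x]
    varies with [x]. Expanding it in coordinates leaves a finite sum of products of continuous
    functions. *)
Lemma dirderiv_slice_continuous :
  {within M `*` M, continuous (fun p => dirderiv v (slice p.2) p.1)}.
Proof.
apply/subspace_continuousP => -[x y] [/= Mx My].
have : carrier A x by rewrite carrierE.
have : carrier A y by rewrite carrierE.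
move=> [j yj] [i xi].
have [W1 oW1 E1] := dom_open mM i; have [W2 oW2 E2] := dom_open mM j.
have hW : \forall p \near nbhs (x, y), (M `*` M) p -> (adom i `*` adom j) p.
  exists (W1, W2) => /=.
    by split; apply: open_nbhs_nbhs; split => //; [move: xi; rewrite E1 => -[]|
      move: yj; rewrite E2 => -[]].
  by move=> [a b] [/= wa wb] [/= Ma Mb]; split => /=; rewrite ?E1 ?E2.
have xy : (adom i `*` adom j) (x, y) by split.
have eq a b : adom i a -> adom j b -> dirderiv v (slice b) a =
    \sum_l v i a ord0 l * dg i j a b (delta_mx 0 l, 0).
  move=> ai bj; rewrite (dirderiv_sliceE ai bj).
  have ab : adom ((i, j) : aidx AA) (a, b) by split.
  have [lL _ _] := dchartP gC1 ab.
  rewrite {1}[v i a]row_sum_delta.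
  have lL0 : linear (fun w => dg i j a b (w, 0)).
    move=> c u w; rewrite -lL; congr (dchart _ _ _ _).
    by rewrite -[RHS]/(c *: u + w, c *: 0 + 0) scaler0 addr0.
  rewrite (big_morph (fun w => dg i j a b (w, 0))
    (fun u w => linear_D u w lL0) (linear_0 lL0)).
  by apply: eq_bigr => l _; rewrite (linear_Z _ _ lL0).
pose sm (p : Omega * Omega) : R^o :=
  \sum_l v i p.1 ord0 l * dg i j p.1 p.2 (delta_mx 0 l, 0).
suff h : sm @ within (adom i `*` adom j) (nbhs (x, y)) --> sm (x, y).
  have {}h : sm @ within (M `*` M) (nbhs (x, y)) --> sm (x, y).
    move=> P /h hP; apply: (@filterS2 _ (nbhs (x, y)) _ _ _ _ _ hW hP).
    by move=> p h1 h2 MM; exact: (h2 (h1 MM)).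
  have e0 : sm (x, y) = dirderiv v (slice y) x by rewrite (eq x y).
  rewrite e0 in h.
  apply: cvg_trans h; apply: near_eq_cvg.
  apply: (@filterS _ (nbhs (x, y)) _ _ _ _ hW) => -[a b] h1 MM.
  have [ai bj] := h1 MM.
  by first [exact: (eq a b ai bj)|exact: (esym (eq a b ai bj))].
rewrite /sm /=.
apply: cvg_sum => l.
apply: cvgM.
  have vc : v i p.1 @[p --> within (adom i `*` adom j) (nbhs (x, y))] --> v i x.
    have /subspace_continuousP/(_ _ xi) cv := (vP i).2.
    move=> P /cv; rewrite /within /= => h.
    exists ([set z | adom i z -> P (v i z)], setT).
      by split => //; exact: filterT.
    by move=> [a b] /= [h1 _] [ai _]; exact: h1.
  exact: cvg_comp vc (@coord_continuous _ _ _ ord0 l (v i x)).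
have xyA : adom ((i, j) : aidx AA) (x, y) by split.
have /subspace_continuousP/(_ _ xyA) cd :=
  @dchart_continuous _ _ _ _ rAA g gC1 ((i, j) : aidx AA) (delta_mx 0 l, 0).
apply: cvg_trans cd; apply: near_eq_cvg; apply: filterE.
by case.
Qed.

End slices.

End flow_on_manifold.

(** * Mean value inequalities for right derivatives, and integrals over shifted windows *)

Section real_calculus.
Context {R : realType}.
Implicit Types f : R -> R.

(* A mean value inequality of Dini type: charts only provide right derivatives
   along orbits. *)
Lemma right_increment_le f (a b c : R) : a <= b ->
  {within `[a, b], continuous f} ->
  (forall s, a <= s < b -> forall e, 0 < e ->
     \forall h \near (0 : R)^'+, f (s + h) - f s <= (c + e) * h) ->
  f b - f a <= c * (b - a).
Proof.
move=> ab cf hf; apply/ler_addgt0Pr => e0 e0p.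
have [->|anb] := eqVneq a b; first by rewrite !subrr mulr0 add0r ltW.
have {anb} ab' : a < b by rewrite lt_neqAle anb.
pose e := e0 / (b - a).
have ep : 0 < e by rewrite divr_gt0// subr_gt0.
have -> : c * (b - a) + e0 = (c + e) * (b - a).
  by rewrite mulrDl divfK// gt_eqF// subr_gt0.
(* Continuous induction: [S] collects the points up to which the bound with slope [c + e] holds
   throughout. *)
pose S := [set s | a <= s <= b /\ forall r, a <= r <= s -> f r - f a <= (c + e) * (r - a)].
have Sa : S a.
  split; first by rewrite lexx.
  move=> r; rewrite -eq_le => /eqP <-.
  by rewrite !subrr mulr0.
have hS : has_sup S.
  by split; [exists a|exists b => s [/andP[]]].
pose m := sup S.
have am : a <= m by exact: (sup_upper_bound hS).
have mb : m <= b by apply: ge_sup; [exists a|move=> s [/andP[]]].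
have below r : a <= r -> r < m -> f r - f a <= (c + e) * (r - a).
  move=> ar; rewrite -subr_gt0 => /sup_adherent/(_ hS)[s [_ sS]].
  rewrite subKr => rs; apply: sS; rewrite ar ltW//.
have Sm : S m.
  split; first by rewrite am.
  move=> r /andP[ar]; rewrite le_eqVlt => /predU1P[->|]; last exact: below.
  apply/ler_addgt0Pr => d d0.
  have [<-|anm] := eqVneq a m; first by rewrite !subrr mulr0 add0r ltW.
  have am' : a < m by rewrite lt_neqAle anm.
  have mI : `[a, b]%classic m by rewrite /= in_itv /= am.
  have /subspace_continuousP/(_ m mI)/cvgrPdist_lt/(_ (d / 2)) := cf.
  rewrite divr_gt0// => /(_ isT); rewrite near_withinE => h1.
  have [C [C0 hC]] : exists C, 0 < C /\ `|c + e| <= C.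
    by exists (`|c + e| + 1); rewrite ltr_wpDl// lerDl.
  have h2 : \forall t \near m, `|m - t| < d / 2 / C.
    have : nbhs m (ball m (d / 2 / C)) by apply: nbhsx_ballx; rewrite !divr_gt0.
    by rewrite -ball_normE.
  have h3 : \forall t \near m^'-, a < t by exact: nbhs_left_gt.
  have h4 : \forall t \near m^'-, t < m by exact: nbhs_left_lt.
  have hh1 : \forall t \near m^'-, `[a, b]%classic t -> `|f m - f t| < d / 2.
    by rewrite /at_left near_withinE; apply: filterS h1 => t ht _.
  have hh2 : \forall t \near m^'-, `|m - t| < d / 2 / C.
    by rewrite /at_left near_withinE; apply: filterS h2 => t ht _.
  have [t [[t1 t2] [t3 t4]]] := filter_ex (filterI (filterI hh1 hh2) (filterI h3 h4)).
  have tI : `[a, b]%classic t.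
    by rewrite /= in_itv /= (ltW t3) (le_trans (ltW t4) mb).
  have {}t1 := t1 tI.
  have fb := below t (ltW t3) t4.
  have k1 : f m - f t <= d / 2 by rewrite (le_trans (ler_norm _))// ltW.
  have k2 : (c + e) * (t - m) <= d / 2.
    rewrite (le_trans (ler_norm _))// normrM distrC.
    rewrite (@le_trans _ _ (C * (d / 2 / C)))//; first by rewrite ler_pM// ltW.
    by rewrite mulrCA divff ?mulr1// gt_eqF.
  have -> : (c + e) * (m - a) = (c + e) * (t - a) - (c + e) * (t - m) by ring.
  lra.
have [mb'|] := ltP m b; last first.
  move=> bm; have <- : m = b by apply/eqP; rewrite eq_le mb.
  by apply: Sm.2; rewrite am lexx.
exfalso; have amb : a <= m < b by rewrite am.
(* If the supremum [m] were below [b], the increment bound to its right would put [m + h] into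
   [S]. *)
have [d /= d0 hd] := hf m amb e ep.
pose h := Num.min (d / 2) (b - m).
have h0 : 0 < h by rewrite lt_min divr_gt0// subr_gt0.
have hd2 : h <= d / 2 by rewrite ge_min lexx.
have hbm : h <= b - m by rewrite ge_min lexx orbT.
have : S (m + h).
  split; first by apply/andP; split; [rewrite ler_wpDr// ltW|move: hbm; lra].
  move=> r /andP[ar rm]; have [rm'|mr] := leP r m.
    by apply: Sm.2; rewrite ar.
  have h1 : f (m + (r - m)) - f m <= (c + e) * (r - m).
    apply: hd; last by rewrite subr_gt0.
    rewrite /ball /= sub0r normrN gtr0_norm ?subr_gt0//; move: rm hd2; lra.
  rewrite subrKC in h1.
  have := Sm.2 m; rewrite am lexx => /(_ isT).
  have -> : (c + e) * (r - a) = (c + e) * (r - m) + (c + e) * (m - a) by ring.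
  lra.
by move=> /(sup_upper_bound hS); rewrite -/m; lra.
Qed.

Lemma right_derivative_lipschitz f (a b c : R) : a <= b ->
  {within `[a, b], continuous f} ->
  (forall s, a <= s < b -> exists2 l, `|l| <= c &
     (fun h => h^-1 * (f (s + h) - f s)) @ 0^'+ --> l) ->
  `|f b - f a| <= c * (b - a).
Proof.
move=> ab cf hf.
have key s l e h : 0 < h -> `|l - h^-1 * (f (s + h) - f s)| <= e ->
    `|h * l - (f (s + h) - f s)| <= e * h.
  move=> h0 H; have hn : h != 0 by rewrite gt_eqF.
  rewrite -[f (s + h) - f s](mulVKf hn) -mulrBr normrM gtr0_norm// mulrC.
  by rewrite ler_pM2r.
rewrite ler_norml; apply/andP; split.
  rewrite lerNl opprB.
  have := @right_increment_le (fun x => - f x) a b c ab.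
  rewrite /= opprK [- f b + _]addrC; apply.
    by move=> x; apply: cvgN; exact: cf.
  move=> s /hf[l lc /cvgrPdist_le hl] e e0.
  near=> h; have h0 : 0 < h by near: h; exact: nbhs_right_gt.
  have /(key _ _ _ _ h0) : `|l - h^-1 * (f (s + h) - f s)| <= e.
    by near: h; exact: hl.
  move=> /(le_trans (ler_norm _)); move: lc; rewrite ler_norml => /andP[lc _].
  nra.
apply: right_increment_le => // s /hf[l lc /cvgrPdist_le hl] e e0.
near=> h; have h0 : 0 < h by near: h; exact: nbhs_right_gt.
have /(key _ _ _ _ h0) : `|l - h^-1 * (f (s + h) - f s)| <= e.
  by near: h; exact: hl.
rewrite distrC => /(le_trans (ler_norm _)); move: lc; rewrite ler_norml => /andP[_ lc].
nra.
Unshelve. all: by end_near. Qed.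

Let leb := @lebesgue_measure R.

Lemma continuous_integrable f a b : continuous f ->
  leb.-integrable `[a, b] (EFin \o f).
Proof.
move=> cf; apply: continuous_compact_integrable; first exact: segment_compact.
exact: continuous_subspaceT.
Qed.

(** The windows [s, T + s] and [0, T] differ by the two intervals [T, T + s] and [0, s]. Subtracting
    primitives in this order also covers s > T. *)
Lemma shift_integral_le f (T s B : R) : continuous f -> 0 < T -> 0 <= s ->
  (forall t, `|f t| <= B) ->
  `|\int[leb]_(t in `[0, T]) f (t + s) - \int[leb]_(t in `[0, T]) f t|
    <= 2 * s * B.
Proof.
move=> cf T0 s0 fB.
(* The base point -1 makes 0 an interior point, so that [G] has a two-sided derivative there. *)
pose G (x : R) : R := \int[leb]_(t in `[-1, x]) f t.
have dG (x : R) : -1 < x -> derivable G x 1 /\ derive1 G x = f x.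
  move=> x1; apply: (@continuous_FTC1_closed R f (-1) x (x + 1)) => //.
  - by rewrite ltrDl.
  - exact: continuous_integrable.
  - exact: cf.
have isG (x : R) : -1 < x -> is_derive x 1 G (f x).
  by move=> /dG[d1 d2]; apply: (DeriveDef d1); rewrite -derive1E; exact: d2.
have cG (x : R) : -1 < x -> {for x, continuous G}.
  by move=> /dG[d1 _]; apply: differentiable_continuous; apply/derivable1_diffP.
have lipG (x y : R) : -1 < x -> x <= y -> `|G y - G x| <= B * (y - x).
  move=> x1 xy; have [||c ci ->] := @MVT_segment R G f x y xy.
  - by move=> z; rewrite in_itv /= => /andP[xz _]; apply: isG; exact: lt_trans xz.
  - apply: continuous_in_subspaceT => z; rewrite inE /= in_itv /= => /andP[xz _].
    by apply: cG; exact: lt_le_trans xz.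
  - by rewrite normrM [`|y - x|]ger0_norm ?subr_ge0// ler_wpM2r ?subr_ge0.
(* The shifted integral is evaluated with the primitive [G (t + r)], in place of a change of
   variables. *)
have shiftE (r : R) : 0 <= r -> \int[leb]_(t in `[0, T]) f (t + r) = G (T + r) - G r.
  move=> r0; pose H (t : R) : R := G (t + r).
  have isH (t : R) : -1 < t -> is_derive t 1 H (f (t + r)).
    move=> t1; have := isG (t + r); rewrite (lt_le_trans t1) ?lerDl// => /(_ isT) h.
    have h' : is_derive t 1 (fun t : R => t + r) (1 + 0) by exact: is_deriveD.
    have h2 := @is_derive1_comp R G (fun t => t + r) t (f (t + r)) (1 + 0) h h'.
    by rewrite addr0 mulr1 in h2.
  have -> : G (T + r) - G r = H T - H 0 by rewrite /H add0r.
  rewrite /Rintegral (@continuous_FTC2 R (fun t => f (t + r)) H)//.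
  - apply: continuous_subspaceT => t; apply: continuous_comp; last exact: cf.
    by apply: cvgD; [exact: cvg_id|exact: cvg_cst].
  - split.
    + move=> t; rewrite in_itv /= => /andP[t0 _].
      by have [] := isH t (lt_trans (ltrN10 R) t0).
    + apply: cvg_at_right_filter; apply: differentiable_continuous.
      by apply/derivable1_diffP; have [] := isH 0 (ltrN10 R).
    + apply: cvg_at_left_filter; apply: differentiable_continuous.
      by apply/derivable1_diffP; have [] := isH T (lt_trans (ltrN10 R) T0).
  - move=> t; rewrite in_itv /= => /andP[t0 _].
    by rewrite derive1E; have [_ ->] := isH t (lt_trans (ltrN10 R) t0).
rewrite shiftE//.
have -> : \int[leb]_(t in `[0, T]) f t = G T - G 0.
  have := shiftE 0 (lexx _); rewrite addr0 => <-.
  by under [RHS]eq_Rintegral do rewrite addr0.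
have -> : G (T + s) - G s - (G T - G 0) = (G (T + s) - G T) - (G s - G 0) by ring.
rewrite (le_trans (ler_normB _ _))//.
have n1 : -1 < 0 :> R by exact: ltrN10.
have := lipG T (T + s) (lt_trans n1 T0); rewrite lerDl => /(_ s0).
have := lipG 0 s n1 s0; rewrite subr0 addrAC subrr add0r; lra.
Qed.

End real_calculus.

Lemma within_comp_continuous (T U V : topologicalType) (W : set T) (S : set U)
    (q : T -> U) (h : U -> V) : continuous q -> (forall z, W z -> S (q z)) ->
  {within S, continuous h} -> {within W, continuous (fun z => h (q z))}.
Proof.
move=> cq WS /subspace_continuousP ch; apply/subspace_continuousP => z Wz.
move=> P /(ch _ (WS _ Wz)) hP; have c := cq z _ hP.
by apply: (@filterS _ (nbhs z) _ _ _ _ c) => y h1 Wy; exact: (h1 (WS _ Wy)).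
Qed.

Lemma continuous_pair (T U V : topologicalType) (f : T -> U) (g : T -> V) :
  continuous f -> continuous g -> continuous (fun z => (f z, g z)).
Proof. by move=> cf cg z; exact: cvg_pair (cf z) (cg z). Qed.

Lemma continuous_fun_comp (T U V : topologicalType) (f : T -> U) (g : U -> V) :
  continuous f -> continuous g -> continuous (fun z => g (f z)).
Proof. by move=> cf cg z P /cg /cf. Qed.

Lemma continuous_fst (T U : topologicalType) :
  continuous (fst : T * U -> T).
Proof. by move=> z; exact: cvg_fst. Qed.

Lemma continuous_snd (T U : topologicalType) :
  continuous (snd : T * U -> U).
Proof. by move=> z; exact: cvg_snd. Qed.

(** A tube lemma: continuity at the points of the compact slice over [i0] becomes uniform for nearby
    [i]. *)
Lemma uniform_near (R : realType) (I T : topologicalType) (i0 : I) (K : set T)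
    (W : set (I * T)) (g : I * T -> R) : compact K ->
  {within W, continuous g} -> (forall x, K x -> W (i0, x)) ->
  forall e, 0 < e -> \forall i \near i0, forall x, K x -> W (i, x) ->
    `|g (i, x) - g (i0, x)| <= e.
Proof.
move=> /compact_near_coveringP cK /subspace_continuousP cg KW e e0.
pose P i x := K x -> W (i, x) -> `|g (i, x) - g (i0, x)| <= e.
have : \forall i \near i0, K `<=` P i.
  apply: cK => x Kx.
  have := cg _ (KW x Kx); move=> /cvgrPdist_lt/(_ (e / 2)).
  rewrite divr_gt0// => /(_ isT) [[A B] /= [Ai Bx] AB].
  exists (B, A) => // -[x' i] /= [Bx' Ai'] Kx' Wi.
  have h1 : `|g (i0, x) - g (i, x')| < e / 2 by apply: (AB (i, x')).
  have h2 : `|g (i0, x) - g (i0, x')| < e / 2.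
    apply: (AB (i0, x')); last exact: KW.
    by split => //=; exact: nbhs_singleton.
  rewrite distrC in h1.
  rewrite -(subrKA (g (i0, x))) (le_trans (ler_normD _ _))// [leRHS]splitr.
  by rewrite lerD// ltW.
by apply: filterS => i h x Kx; exact: h.
Qed.

(** * Uniform difference quotients and time averages along the flow *)

Section flow_calculus.
Context {R : realType} {Omega : topologicalType}.
Variables (Phi : R -> Omega -> Omega) (X : set Omega).
Hypotheses (Phi_cont : continuous (fun p : R * Omega => Phi p.1 p.2))
  (Phi0 : forall x, Phi 0 x = x)
  (PhiD : forall s t x, Phi (s + t) x = Phi s (Phi t x))
  (cX : compact X) (XPhi : forall t x, X x -> X (Phi t x)).

Lemma flow_comp_continuous (T : topologicalType) (a : T -> R) (b : T -> Omega) :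
  continuous a -> continuous b -> continuous (fun z => Phi (a z) (b z)).
Proof.
move=> ca cb.
exact: (continuous_fun_comp (continuous_pair ca cb) Phi_cont).
Qed.

Lemma orbit_continuous x : continuous (fun t => Phi t x).
Proof.
apply: flow_comp_continuous => [z|z]; [exact: cvg_id|exact: cvg_cst].
Qed.

(** Upgrades pointwise right derivatives to uniform two-sided quotients. At [s] the right derivative
    of f(Phi s x, y) is kappa(Phi s x, y), which is uniformly close to kappa(x, y) for small [s];
    the mean value inequality then applies on either side of 0, as [X] is invariant for all
    times. *)
Lemma uniform_quotient (f kappa : Omega * Omega -> R) :
  (forall x y, X x -> X y -> continuous (fun s => f (Phi s x, y))) ->
  {within X `*` X, continuous kappa} ->
  (forall x y, X x -> X y ->
     (fun s : R => s^-1 * (f (Phi s x, y) - f (x, y))) @ 0^'+ --> kappa (x, y)) ->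
  forall e, 0 < e -> \forall s \near (0 : R)^', forall x y, X x -> X y ->
    `|s^-1 * (f (Phi s x, y) - f (x, y)) - kappa (x, y)| <= e.
Proof.
move=> cf ck hd e e0.
have U : \forall s \near (0 : R), forall p, (X `*` X) p ->
    ([set: R] `*` (X `*` X)) (s, p) ->
    `|kappa (Phi s p.1, p.2) - kappa (Phi 0 p.1, p.2)| <= e.
  apply: (@uniform_near R R _ 0 (X `*` X) ([set: R] `*` (X `*` X))
    (fun z => kappa (Phi z.1 z.2.1, z.2.2))) => //.
  - exact: compact_setX.
  - apply: within_comp_continuous ck.
    + apply: continuous_pair; last first.
        exact: (continuous_fun_comp (@continuous_snd _ _) (@continuous_snd _ _)).
      apply: flow_comp_continuous; first exact: continuous_fst.
      exact: (continuous_fun_comp (@continuous_snd _ _) (@continuous_fst _ _)).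
    + by move=> [s [x y]] [_ [/= Xx Xy]]; split => //=; exact: XPhi.
have [r /= r0 hr] := U.
have main x y a b : X x -> X y -> a <= b -> - r < a -> b < r ->
    `|f (Phi b x, y) - f (Phi a x, y) - kappa (x, y) * (b - a)| <= e * (b - a).
  move=> Xx Xy ab ra br.
  (* Subtracting the linear part leaves a function whose right derivative is at most [e]. *)
  pose G s := f (Phi s x, y) - kappa (x, y) * s.
  have -> : f (Phi b x, y) - f (Phi a x, y) - kappa (x, y) * (b - a) = G b - G a.
    by rewrite /G; ring.
  apply: right_derivative_lipschitz => //.
    apply: continuous_subspaceT => s; apply: cvgB; first exact: cf.
    by apply: cvgM; [exact: cvg_cst|exact: cvg_id].
  move=> s /andP[as_ sb]; exists (kappa (Phi s x, y) - kappa (x, y)).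
    have sr : `|0 - s| < r.
      by rewrite sub0r normrN ltr_norml; apply/andP; split;
        [exact: lt_le_trans as_|exact: lt_trans br].
    have := hr s sr (x, y); rewrite /= Phi0; apply; split => //.
  have h := hd (Phi s x) y (XPhi s Xx) Xy.
  have h2 : (fun h : R => h^-1 * (f (Phi h (Phi s x), y) - f (Phi s x, y)) - kappa (x, y))
      @ 0^'+ --> kappa (Phi s x, y) - kappa (x, y).
    by apply: cvgB => //; exact: cvg_cst.
  apply: cvg_trans h2; apply: near_eq_cvg; near=> u.
  have u0 : u != 0 by near: u; exact: nbhs_right_neq.
  rewrite /G -PhiD [u + s]addrC.
  have -> : f (Phi (s + u) x, y) - kappa (x, y) * (s + u) -
    (f (Phi s x, y) - kappa (x, y) * s) =
    (f (Phi (s + u) x, y) - f (Phi s x, y)) - u * kappa (x, y) by ring.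
  by rewrite [in RHS]mulrBr mulKf.
exists r => //= s; rewrite /ball_ /= sub0r normrN ltr_norml => /andP[rs sr] s0 x y Xx Xy.
have r0' : - r < 0 by rewrite oppr_lt0.
have key : `|f (Phi s x, y) - f (x, y) - kappa (x, y) * s| <= e * `|s|.
  have [s0'|s0'] := leP 0 s.
    have := main x y 0 s Xx Xy s0' r0' sr; by rewrite Phi0 subr0 [`|s|]ger0_norm.
  have := main x y s 0 Xx Xy (ltW s0') rs r0.
  rewrite Phi0 sub0r [`|s|]ltr0_norm// distrC.
  by have -> : kappa (x, y) * - s - (f (x, y) - f (Phi s x, y)) =
    f (Phi s x, y) - f (x, y) - kappa (x, y) * s by ring.
have -> : s^-1 * (f (Phi s x, y) - f (x, y)) - kappa (x, y) =
    s^-1 * (f (Phi s x, y) - f (x, y) - kappa (x, y) * s).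
  by rewrite [in RHS]mulrBr; congr (_ - _); rewrite mulrCA mulVf// mulr1.
rewrite normrM normfV ler_pdivrMl ?normr_gt0// [leRHS]mulrC; exact: key.
Unshelve. all: by end_near. Qed.

Section average.
Variable T : R.
Hypothesis T0 : 0 < T.
Let leb := @lebesgue_measure R.

(** Convertible to [dTsq] when [f] is [dsq F]; the derivative of [dsq F] along the flow is averaged
    as well. *)
Definition avg (f : Omega * Omega -> R) (p : Omega * Omega) : R :=
  T^-1 * \int[leb]_(t in `[0, T]) f (Phi t p.1, Phi t p.2).

Lemma Rintegral_cst_itv (c : R) : \int[leb]_(t in `[0, T]) c = c * T.
Proof.
have h : leb `[0, T]%classic = T%:E.
  by rewrite /leb lebesgue_measure_itv /= lte_fin T0 -EFinD subr0.
rewrite Rintegral_cst//; congr (_ * _).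
by rewrite -[RHS]/(fine T%:E) -h.
Qed.

Lemma time_average_le (u : R -> R) e : continuous u ->
  (forall t, 0 <= t <= T -> `|u t| <= e) ->
  `|T^-1 * \int[leb]_(t in `[0, T]) u t| <= e.
Proof.
move=> cu h; rewrite normrM gtr0_norm ?invr_gt0// ler_pdivrMl//.
rewrite (le_trans (le_normr_Rintegral _ (continuous_integrable 0 T cu)))//.
rewrite mulrC -Rintegral_cst_itv; apply: le_Rintegral => //.
- apply: integrable_norm; exact: continuous_integrable.
- apply: continuous_integrable; exact: cst_continuous.
Qed.

Lemma time_averageB (u w : R -> R) : continuous u -> continuous w ->
  T^-1 * \int[leb]_(t in `[0, T]) u t - T^-1 * \int[leb]_(t in `[0, T]) w t =
  T^-1 * \int[leb]_(t in `[0, T]) (u t - w t).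
Proof.
move=> cu cw; rewrite -mulrBr RintegralB//; exact: continuous_integrable.
Qed.

Lemma avg_continuous_uniform (f : Omega * Omega -> R) (K : set Omega) x0 e :
  continuous f -> compact K -> 0 < e ->
  \forall x \near x0, forall y, K y -> `|avg f (x, y) - avg f (x0, y)| <= e.
Proof.
move=> cf cK e0.
have U : \forall x \near x0, forall p, (`[0, T]%classic `*` K) p -> [set: Omega * (R * Omega)] (x, p) ->
    `|f (Phi p.1 x, Phi p.1 p.2) - f (Phi p.1 x0, Phi p.1 p.2)| <= e.
  apply: (@uniform_near R Omega _ x0 (`[0, T]%classic `*` K) setT
    (fun z => f (Phi z.2.1 z.1, Phi z.2.1 z.2.2))) => //.
    by apply: compact_setX => //; exact: segment_compact.
  apply: continuous_subspaceT.
  have c21 : continuous (fun z : Omega * (R * Omega) => z.2.1).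
    exact: (continuous_fun_comp (@continuous_snd _ _) (@continuous_fst _ _)).
  have c22 : continuous (fun z : Omega * (R * Omega) => z.2.2).
    exact: (continuous_fun_comp (@continuous_snd _ _) (@continuous_snd _ _)).
  have c : continuous (fun z : Omega * (R * Omega) =>
      (Phi z.2.1 z.1, Phi z.2.1 z.2.2)).
    apply: continuous_pair; apply: flow_comp_continuous => //.
    exact: continuous_fst.
  exact: (continuous_fun_comp c cf).
have co x y : continuous (fun t => f (Phi t x, Phi t y)).
  have c := continuous_pair (@orbit_continuous x) (@orbit_continuous y).
  exact: (continuous_fun_comp c cf).
apply: filterS U => x h y Ky; rewrite /avg time_averageB//.
apply: time_average_le => [t|t tT]; first by apply: cvgB; exact: co.
by apply: (h (t, y)) => //; split => //=; rewrite in_itv.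
Qed.

Section on_invariant_set.
Variable D : Omega * Omega -> R.
Hypothesis cD : {within X `*` X, continuous D}.

Lemma orbit_pair_continuous x y : X x -> X y ->
  continuous (fun t => D (Phi t x, Phi t y)).
Proof.
move=> Xx Xy.
have h : {within [set: R], continuous (fun t => D (Phi t x, Phi t y))}.
  apply: (@within_comp_continuous _ _ _ _ (X `*` X) (fun t => (Phi t x, Phi t y)) D) => //.
    exact: continuous_pair (@orbit_continuous x) (@orbit_continuous y).
  by move=> t _; split; exact: XPhi.
move/subspace_continuousP : h => h t P /(h t I) hP.
by apply: (@filterS _ (nbhs t) _ _ _ _ hP) => u; apply.
Qed.

Lemma avg_within_continuous : {within X `*` X, continuous (avg D)}.
Proof.
apply/subspace_continuousP => p0 Xp0; apply/cvgrPdist_le => e e0.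
have U : \forall p \near p0, forall t, `[0, T]%classic t ->
    ((X `*` X) `*` [set: R]) (p, t) ->
    `|D (Phi t p.1, Phi t p.2) - D (Phi t p0.1, Phi t p0.2)| <= e.
  apply: (@uniform_near R _ R p0 `[0, T]%classic ((X `*` X) `*` [set: R])
    (fun z => D (Phi z.2 z.1.1, Phi z.2 z.1.2))) => //.
    exact: segment_compact.
  apply: (within_comp_continuous _ _ cD).
    apply: continuous_pair; apply: flow_comp_continuous;
      try exact: continuous_snd.
      exact: (continuous_fun_comp (@continuous_fst _ _) (@continuous_fst _ _)).
    exact: (continuous_fun_comp (@continuous_fst _ _) (@continuous_snd _ _)).
  by move=> [[x y] t] [[/= Xx Xy] _]; split; exact: XPhi.
rewrite near_withinE; apply: filterS U => p h Xp.
have [Xx Xy] := Xp; have [Xx0 Xy0] := Xp0.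
rewrite distrC /avg time_averageB; try exact: orbit_pair_continuous.
apply: time_average_le => [t|t tT].
  by apply: cvgB; exact: orbit_pair_continuous.
by apply: h => //=; rewrite in_itv.
Qed.

Lemma avg_quotient (f : Omega * Omega -> R) : continuous f ->
  (forall e, 0 < e -> \forall s \near (0 : R)^', forall x y, X x -> X y ->
    `|s^-1 * (f (Phi s x, y) - f (x, y)) - D (x, y)| <= e) ->
  forall e, 0 < e -> \forall s \near (0 : R)^', forall x y, X x -> X y ->
    `|s^-1 * (avg f (Phi s x, y) - avg f (x, y)) - avg D (x, y)| <= e.
Proof.
move=> cf h e e0; apply: filterS (h e e0) => s hs x y Xx Xy.
have co x' y' : continuous (fun t => f (Phi t x', Phi t y')).
  have c := continuous_pair (@orbit_continuous x') (@orbit_continuous y').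
  exact: (continuous_fun_comp c cf).
have cB : continuous (fun t => f (Phi t (Phi s x), Phi t y) - f (Phi t x, Phi t y)).
  by move=> t; apply: cvgB; exact: co.
have cZ : continuous (fun t => s^-1 * (f (Phi t (Phi s x), Phi t y) - f (Phi t x, Phi t y))).
  by move=> t; apply: cvgM; [exact: cvg_cst|exact: cB].
rewrite /avg time_averageB// mulrCA -RintegralZl//; last exact: continuous_integrable.
rewrite time_averageB//; last exact: orbit_pair_continuous.
apply: time_average_le => [t|t tT].
  by apply: cvgB; [exact: cZ|exact: orbit_pair_continuous].
have -> : Phi t (Phi s x) = Phi s (Phi t x) by rewrite -!PhiD addrC.
by apply: hs; exact: XPhi.
Qed.

Lemma avg_le B : (forall x y, X x -> X y -> `|D (x, y)| <= B) ->
  forall x y, X x -> X y -> `|avg D (x, y)| <= B.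
Proof.
move=> hB x y Xx Xy; apply: time_average_le; first exact: orbit_pair_continuous.
by move=> t _; apply: hB; exact: XPhi.
Qed.

Lemma avg_flow_le B s : (forall x y, X x -> X y -> `|D (x, y)| <= B) -> 0 <= s ->
  forall x y, X x -> X y ->
  `|avg D (Phi s x, Phi s y) - avg D (x, y)| <= 2 * s * B / T.
Proof.
move=> hB s0 x y Xx Xy; rewrite /avg /= -mulrBr normrM gtr0_norm ?invr_gt0//.
rewrite mulrC ler_pM2r ?invr_gt0//.
have -> : \int[leb]_(t in `[0, T]) D (Phi t (Phi s x), Phi t (Phi s y)) =
    \int[leb]_(t in `[0, T]) D (Phi (t + s) x, Phi (t + s) y).
  by apply: eq_Rintegral => t _; rewrite !PhiD.
apply: (@shift_integral_le R (fun t => D (Phi t x, Phi t y))) => //.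
  exact: orbit_pair_continuous.
by move=> t; apply: hB; exact: XPhi.
Qed.

End on_invariant_set.
End average.
End flow_calculus.

Lemma near_right_punctured (R : realType) (P : R -> Prop) :
  (\forall s \near (0 : R)^', P s) -> \forall s \near (0 : R)^'+, P s.
Proof.
rewrite /dnbhs /at_right !near_withinE; apply: filterS => s hs s0.
by apply: hs; rewrite gt_eqF.
Qed.

(** * The delay-coordinate kernel *)

Section shape_function.
Context {R : realType}.
Variables (h : R -> R) (B : R).
Hypotheses (h0 : forall s, 0 <= s -> 0 < h s)
  (hC1 : C1_on Rplus (h : R^o -> R^o))
  (hB : forall s, 0 <= s ->
    h s <= B /\ opnorm (deriv_within Rplus (h : R^o -> R^o) s) <= B).

Local Notation hd := (deriv_within Rplus (h : R^o -> R^o)).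
Local Notation H := (C1norm_Rplus h).

Lemma real_finite_basis : finite_basis (R^o : normedModType R).
Proof.
exists [:: (1 : R^o)] => L lL w w1; rewrite big_seq1.
have -> : w = w *: (1 : R^o) by rewrite -[RHS]/(w * 1) mulr1.
by rewrite (linear_Z _ _ lL) normrZ ler_piMl.
Qed.

Lemma ample_Rplus (s : R^o) : 0 <= s -> ample (Rplus : set R^o) s.
Proof.
move=> s0 L lL hL w; have -> : w = w *: (1 : R^o) by rewrite -[RHS]/(w * 1) mulr1.
rewrite (linear_Z _ _ lL) hL ?scaler0//.
near=> t; have t0 : 0 < t by near: t; exact: nbhs_right_gt.
by rewrite /Rplus /= addr_ge0// -[_ *: _]/(t * 1) mulr1 ltW.
Unshelve. all: by end_near. Qed.

Lemma shape_derivP s : 0 <= s -> has_deriv_within Rplus (h : R^o -> R^o) s (hd s).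
Proof. by move=> s0; have [Df [hD _]] := hC1; exact: deriv_withinP (hD s s0). Qed.

Lemma shape_derivE s w : 0 <= s -> hd s w = w * hd s 1.
Proof.
move=> /shape_derivP[lL _ _]; have := linear_Z w (1 : R^o) lL.
by rewrite -[w *: (1 : R^o)]/(w * 1) mulr1.
Qed.

Lemma shape_deriv_le s : 0 <= s -> `|hd s 1| <= H.
Proof.
move=> s0; have [lL _ _] := shape_derivP s0.
have := le_opnorm real_finite_basis lL 1; rewrite normr1 mulr1 => /le_trans; apply.
apply: (@le_trans _ _ (sup [set opnorm (hd s) | s in Rplus])).
  apply: sup_upper_bound; last by exists s.
  split; first by exists (opnorm (hd s)), s.
  by exists B => _ [r r0 <-]; exact: (hB r0).2.
by rewrite lerDr; exact: supnorm_ge0.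
Qed.

Lemma shape_norm_ge0 : 0 <= H.
Proof. by apply: le_trans (shape_deriv_le (lexx 0)). Qed.

Lemma shape_deriv_continuous : {within Rplus, continuous (fun s : R^o => hd s 1 : R)}.
Proof.
have [Df [hD cD]] := hC1.
apply/subspace_continuousP => s s0.
have e r : 0 <= r -> hd r 1 = Df r 1.
  move=> r0.
  exact: (within_deriv_unique (ample_Rplus r0) (shape_derivP r0) (hD r r0)).
have /subspace_continuousP/(_ s s0) hx := cD 1.
have {}hx : (fun y => Df y 1) @ within Rplus (nbhs s) --> hd s 1.
  by rewrite e//; exact: hx.
apply: cvg_trans hx; apply: near_eq_cvg; rewrite near_withinE.
by apply: filterE => y y0; first [exact: e|apply/esym; exact: e].
Qed.

Lemma shape_within_continuous : {within Rplus, continuous (h : R^o -> R)}.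
Proof.
apply/subspace_continuousP => s s0; apply/cvgrPdist_le => e e0.
have [lL cL dL] := shape_derivP s0.
have d1 := dL 1 ltr01.
have c1 : 0 < H + 1 by rewrite ltr_wpDl ?shape_norm_ge0.
have d2 : \forall y \near within Rplus (nbhs s), `|s - y| < e / (H + 1).
  apply: cvg_within.
  have : nbhs s (ball s (e / (H + 1))) by apply: nbhsx_ballx; rewrite divr_gt0.
  by rewrite -ball_normE.
apply: filterS2 d1 d2 => y hy sy.
rewrite distrC -(subrK (hd s (y - s)) (_ - _)) (le_trans (ler_normD _ _))//.
have hw : `|hd s (y - s)| <= `|s - y| * H.
  by rewrite shape_derivE// normrM distrC ler_wpM2l// shape_deriv_le.
rewrite mul1r in hy; rewrite ltr_pdivlMr// mulrDr mulr1 addrC in sy.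
by apply: le_trans (lerD hy hw) _; rewrite (distrC y s) ltW.
Qed.

Lemma shape_lipschitz_le a b : 0 <= a -> a <= b -> `|h b - h a| <= H * (b - a).
Proof.
move=> a0 ab; apply: right_derivative_lipschitz => //.
  apply: continuous_subspaceW shape_within_continuous => s.
  by rewrite /= in_itv /= => /andP[as_ _]; exact: le_trans as_.
move=> s /andP[as_ _]; have s0 := le_trans a0 as_.
exists (hd s 1); first exact: shape_deriv_le.
have := @within_deriv_curve R R^o R^o Rplus h s (hd s) (fun t => s + t) 1
  (shape_derivP s0).
apply; first by near=> t; rewrite /Rplus /= addr_ge0.
have c : (fun _ : R => 1 : R^o) @ (0 : R)^'+ --> (1 : R^o) by exact: cvg_cst.
apply: cvg_trans c; apply: near_eq_cvg; near=> t.
have t0 : t != 0 by near: t; exact: nbhs_right_neq.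
by rewrite addrAC subrr add0r -[_ *: _]/(t^-1 * t) mulVf.
Unshelve. all: by end_near. Qed.

Lemma shape_lipschitz a b : 0 <= a -> 0 <= b -> `|h b - h a| <= H * `|b - a|.
Proof.
move=> a0 b0; have [ab|ba] := leP a b.
  by rewrite [`|b - a|]ger0_norm ?subr_ge0//; exact: shape_lipschitz_le.
have := shape_lipschitz_le b0 (ltW ba).
by rewrite distrC [`|b - a|]distrC [`|a - b|]gtr0_norm ?subr_gt0.
Qed.

End shape_function.

Section delay_kernel.
Context {R : realType} {Omega : pmetricType R} {Y : normedModType R} {n : nat}.
Variables (Phi : R -> Omega -> Omega) (X M : set Omega) (A : atlas Omega 'rV[R]_n)
  (v : aidx A -> Omega -> 'rV[R]_n) (F : Omega -> Y) (h : R -> R) (T B : R).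
Hypotheses (flowP : is_flow Phi) (cX : compact X)
  (XPhi : forall t x, X x -> X (Phi t x)) (XM : X `<=` M)
  (mM : compact_C1_manifold M A)
  (PhiM : forall t x, 0 <= t -> M x -> M (Phi t x))
  (vP : generating_vector_field Phi v) (cF : continuous F)
  (FC1 : C1fun (prod_atlas A A) (dsq F))
  (h0 : forall s, 0 <= s -> 0 < h s)
  (hC1 : C1_on Rplus (h : R^o -> R^o))
  (hB : forall s, 0 <= s ->
    h s <= B /\ opnorm (deriv_within Rplus (h : R^o -> R^o) s) <= B)
  (T0 : 0 < T).

Local Notation k := (kT F Phi h T).
Local Notation H := (C1norm_Rplus h).
Local Notation f := (dsq F).
Local Notation d2 := (avg Phi T f).
Local Notation hd := (deriv_within Rplus (h : R^o -> R^o)).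

Let Phi_cont : continuous (fun p : R * Omega => Phi p.1 p.2).
Proof. by have [] := flowP. Qed.
Let Phi0 x : Phi 0 x = x. Proof. by have [_ + _] := flowP; apply. Qed.
Let PhiD s t x : Phi (s + t) x = Phi s (Phi t x).
Proof. by have [_ _] := flowP; apply. Qed.

Lemma dsq_continuous : continuous f.
Proof.
have c : continuous (fun p : Omega * Omega => F p.1 - F p.2).
  move=> p; apply: cvgB.
    exact: (continuous_fun_comp (@continuous_fst _ _) cF).
  exact: (continuous_fun_comp (@continuous_snd _ _) cF).
have c2 : continuous (fun p : Omega * Omega => `|F p.1 - F p.2| : R^o).
  exact: (continuous_fun_comp c (@norm_continuous R Y)).
have -> : f = (fun p => `|F p.1 - F p.2| * `|F p.1 - F p.2| : R^o).
  by apply/funext => p; rewrite /dsq expr2.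
by move=> p; apply: cvgM; exact: c2.
Qed.

Lemma dsq_ge0 p : 0 <= f p. Proof. by rewrite /dsq sqr_ge0. Qed.

Lemma dTsq_ge0 p : 0 <= d2 p.
Proof.
rewrite mulr_ge0 ?invr_ge0 ?(ltW T0)//.
by apply: Rintegral_ge0 => t _; exact: dsq_ge0.
Qed.

Lemma kernel_diff x y x' y' : `|k x y - k x' y'| <= H * `|d2 (x, y) - d2 (x', y')|.
Proof.
exact: (shape_lipschitz hC1 hB (dTsq_ge0 (x', y')) (dTsq_ge0 (x, y))).
Qed.

Lemma kernel_near (K : set Omega) x0 e : compact K -> 0 < e ->
  \forall x \near x0, forall y, K y -> `|k x y - k x0 y| <= e.
Proof.
move=> cK e0; have H1 : 0 < H + 1 by rewrite ltr_wpDl ?(shape_norm_ge0 hC1 hB).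
have U := avg_continuous_uniform Phi_cont T0 x0 dsq_continuous cK (divr_gt0 e0 H1).
apply: filterS U => x hx y Ky; rewrite (le_trans (kernel_diff _ _ _ _))//.
have := hx y Ky; rewrite ler_pdivlMr//.
have := normr_ge0 (d2 (x, y) - d2 (x0, y)).
have := shape_norm_ge0 hC1 hB; nra.
Qed.

Lemma kernel_sym x y : k x y = k y x.
Proof.
rewrite /kT /dTsq; congr (h (_ * _)); apply: eq_Rintegral => t _.
by rewrite /dsq /= distrC.
Qed.

Lemma kernel_continuous y : continuous (fun x => k x y).
Proof.
move=> x0; apply/cvgrPdist_le => e e0.
have U := kernel_near x0 (@compact_set1 _ y) e0.
apply: (@filterS _ (nbhs x0) _ _ _ _ U) => x hx.
by rewrite distrC; exact: (hx y erefl).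
Qed.

Lemma kernel_uniform : uniform_kernel X k B.
Proof.
split.
- move=> x y; have d0 := dTsq_ge0 (x, y).
  have kp : 0 < k x y by exact: (h0 d0).
  by rewrite gtr0_norm//; have [] := hB d0.
- by move=> x0 e e0; exact: kernel_near.
- move=> x; apply: continuous_borel.
  have -> : k x = (fun y => k y x) by apply/funext => y; exact: kernel_sym.
  exact: kernel_continuous.
- exact: kernel_sym.
Qed.

Lemma dsq_le_supnorm x y : X x -> X y ->
  `|f (x, y)| <= supnorm (X `*` X) f.
Proof.
move=> Xx Xy.
have [C hC] := compact_within_bounded (compact_setX cX cX) (@subset_refl _ _)
  (continuous_subspaceT dsq_continuous).
by apply: (le_supnorm hC).
Qed.

(** The origin of C_1: the Lipschitz constant of [h] times the effect 2 t ||d^2|| / T of shifting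
    the averaging window by [t]. *)
Lemma kernel_flow_le t : 0 <= t -> forall x y, X x -> X y ->
  `|k (Phi t x) (Phi t y) - k x y| <=
    2 * H * supnorm (X `*` X) f * t / T.
Proof.
move=> t0 x y Xx Xy; rewrite (le_trans (kernel_diff _ _ _ _))//.
have := @avg_flow_le _ _ _ _ Phi_cont PhiD XPhi T T0 f
  (continuous_subspaceT dsq_continuous) _ t dsq_le_supnorm t0 x y Xx Xy.
move=> /(ler_wpM2l (shape_norm_ge0 hC1 hB))/le_trans; apply.
rewrite le_eqVlt; apply/orP; left; apply/eqP; ring.
Qed.

Let D p := dirderiv v (fun x => f (x, p.2) : R^o) p.1.

(** The origin of C_2, apart from its factor 2: the derivative of d^2 along the flow is at most
    ||V|| times its C^1 norm, averaging preserves the bound, and composing with [h] multiplies it by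
    the norm of [h]. *)
Lemma kernel_derivative : exists kappa : Omega -> Omega -> R,
  (forall x y, X x -> X y ->
     `|kappa x y| <= H * (vfield_opnorm v * C1norm (prod_atlas A A) f)) /\
  (forall e, 0 < e -> \forall s \near (0 : R)^', forall x y, X x -> X y ->
     `|s^-1 * (k (Phi s x) y - k x y) - kappa x y| <= e).
Proof.
have oc := orbit_continuous Phi_cont.
have rAA := manifold_prod_regular mM.
(* Boundedness on all of [M] ensures that the supremum norm inside [C1norm] is a true supremum; the
   compact cores provide it. *)
have [C hC] : exists C, forall x y, M x -> M y -> `|f (x, y)| <= C.
  have /choice[b hb] : forall i : aidx (prod_atlas A A), exists b,
      forall p, acore i p -> `|f p| <= b.
    move=> i; apply: (compact_within_bounded (@ra_core _ _ _ _ rAA i) (@subset_refl _ _)).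
    exact: continuous_subspaceT dsq_continuous.
  exists (\sum_i `|b i|) => x y Mx My.
  have [i xi] := core_cover mM Mx; have [j yj] := core_cover mM My.
  rewrite (le_trans (hb (i, j) (x, y) _))//.
  rewrite (bigD1 (i, j))//= (le_trans (ler_norm _))// lerDl.
  exact: sumr_ge0.
have cD : {within X `*` X, continuous D}.
  apply: continuous_subspaceW (dirderiv_slice_continuous mM oc Phi0 PhiM vP FC1).
  by move=> [x y] [/= Xx Xy]; split; exact: XM.
have Dle x y : X x -> X y -> `|D (x, y)| <= vfield_opnorm v * C1norm (prod_atlas A A) f.
  move=> Xx Xy.
  exact: (dirderiv_slice_le mM oc Phi0 PhiM vP FC1 hC (XM Xx) (XM Xy)).
have fq := uniform_quotient Phi_cont Phi0 PhiD cX XPhi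
  (f := f) (kappa := D).
have {}fq : forall e, 0 < e -> \forall s \near (0 : R)^', forall x y, X x -> X y ->
    `|s^-1 * (f (Phi s x, y) - f (x, y)) - D (x, y)| <= e.
  apply: fq => //.
  - move=> x y _ _.
    have c := continuous_pair (oc x) (@cst_continuous _ _ y).
    exact: (continuous_fun_comp c dsq_continuous).
  - move=> x y Xx Xy.
    exact: (dirderiv_right_deriv mM oc Phi0 PhiM vP
      (slice_C1 mM FC1 (XM Xy)) (XM Xx)).
have aq := avg_quotient Phi_cont PhiD XPhi T0 cD dsq_continuous fq.
(* The chain rule, where [hd (d2 p) 1] is the derivative of [h] at [d2 p]. It gives right
   derivatives only, so [uniform_quotient] is applied again, now to the kernel. *)
pose kappa (p : Omega * Omega) : R := avg Phi T D p * hd (d2 p) 1.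
exists (fun x y => kappa (x, y)); split.
  move=> x y Xx Xy; rewrite normrM mulrC ler_pM//.
    exact: (shape_deriv_le hC1 hB (dTsq_ge0 _)).
  exact: (avg_le Phi_cont XPhi T0 cD Dle Xx Xy).
apply: (uniform_quotient Phi_cont Phi0 PhiD cX XPhi (f := fun p => k p.1 p.2) (kappa := kappa)).
- move=> x y _ _; exact: (continuous_fun_comp (oc x) (@kernel_continuous y)).
- apply/subspace_continuousP => p Xp; apply: cvgM.
    have /subspace_continuousP := avg_within_continuous Phi_cont XPhi T0 cD.
    by apply.
  have ca := avg_within_continuous Phi_cont XPhi T0
    (continuous_subspaceT dsq_continuous).
  have ch : {within d2 @` (X `*` X), continuous (fun s : R^o => hd s 1 : R)}.
    apply: continuous_subspaceW (shape_deriv_continuous hC1).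
    by move=> _ [q _ <-]; exact: dTsq_ge0.
  by have /subspace_continuousP := within_continuous_comp ca ch; apply.
- move=> x y Xx Xy; rewrite /kappa -(shape_derivE hC1 _ (dTsq_ge0 (x, y))).
  have := @within_deriv_curve R R^o R^o Rplus h (d2 (x, y)) (hd (d2 (x, y)))
    (fun t => d2 (Phi t x, y)) (avg Phi T D (x, y)) (shape_derivP hC1 (dTsq_ge0 _)).
  apply; first by apply: filterE => t; exact: dTsq_ge0.
  apply/cvgrPdist_le => e e0.
  apply: near_right_punctured; apply: filterS (aq e e0) => s hs.
  by rewrite distrC; exact: hs.
Qed.

End delay_kernel.

(** * Unitary groups and the coherent pair *)

Section pointwise_derivatives.
Context {R : realType}.
Implicit Types (f g : R -> R).

Lemma is_derive_funD f g (t df dg : R) : is_derive t 1 f df -> is_derive t 1 g dg ->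
  is_derive t 1 (fun x => f x + g x) (df + dg).
Proof. by move=> hf hg; exact: is_deriveD. Qed.

Lemma is_derive_funB f g (t df dg : R) : is_derive t 1 f df -> is_derive t 1 g dg ->
  is_derive t 1 (fun x => f x - g x) (df - dg).
Proof. by move=> hf hg; exact: is_deriveB. Qed.

Lemma is_derive_funM f g (t df dg : R) : is_derive t 1 f df -> is_derive t 1 g dg ->
  is_derive t 1 (fun x => f x * g x) (f t * dg + g t * df).
Proof. by move=> hf hg; exact: is_deriveM. Qed.

Lemma is_derive_funZ f (t df c : R) : is_derive t 1 f df ->
  is_derive t 1 (fun x => c * f x) (c * df).
Proof. by move=> hf; exact: is_deriveZ. Qed.

Lemma is_derive_scaled (c t : R) : is_derive t 1 (fun x => c * x) c.
Proof.
have h : is_derive t 1 (fun x : R => x) (1 : R) by exact: is_derive_id.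
by have := is_derive_funZ c h; rewrite mulr1.
Qed.

Lemma is_derive_cos_scaled (w t : R) :
  is_derive t 1 (fun x => cos (w * x)) (- (w * sin (w * t))).
Proof.
have := is_derive1_comp (is_derive_cos (w * t)) (is_derive_scaled w t).
by rewrite mulNr mulrC.
Qed.

Lemma is_derive_sin_scaled (w t : R) :
  is_derive t 1 (fun x => sin (w * x)) (w * cos (w * t)).
Proof.
have := is_derive1_comp (is_derive_sin (w * t)) (is_derive_scaled w t).
by rewrite mulrC.
Qed.

Lemma is_derive_quotient f (t l : R) :
  (fun s : R => s^-1 * (f (s + t) - f t)) @ 0^' --> l -> is_derive t 1 f l.
Proof.
move=> h; have h' : (fun s : R => s^-1 *: (f (s *: 1 + t) - f t)) @ 0^' --> l.
  apply: cvg_trans h; apply: near_eq_cvg; apply: filterE => s.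
  by rewrite -[s *: 1]/(s * 1) mulr1.
have d : derivable f t 1 by apply/cvg_ex; exists l; exact: h'.
by apply: (DeriveDef d); exact: cvg_lim h'.
Qed.

Lemma is_derive_increment_le f df (a b : R) : a <= b ->
  (forall t, a <= t <= b -> is_derive t 1 f (df t)) ->
  (forall t, a <= t <= b -> df t <= 0) -> f b <= f a.
Proof.
move=> ab hf hdf; rewrite -subr_le0.
have [||c ci ->] := @MVT_segment R f df a b ab.
- by move=> t; rewrite in_itv /= => /andP[at_ tb]; apply: hf; rewrite !ltW.
- apply: continuous_in_subspaceT => t; rewrite inE /= in_itv /= => /hf[d _].
  by apply: differentiable_continuous; apply/derivable1_diffP.
by rewrite mulr_le0_ge0 ?subr_ge0// hdf//; move: ci; rewrite in_itv.
Qed.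

End pointwise_derivatives.

Section unitary_group.
Context {R : realType} {E : lmodType R} {ip : E -> E -> R}.
Hypothesis ipP : semi_inner_product ip.
Local Notation ipnorm := (ipnorm (ip := ip)).
Variable U : R -> E -> E.
Hypotheses (U_lin : forall t a x y, U t (a *: x + y) = a *: U t x + U t y)
  (U_iso : forall t x y, ip (U t x) (U t y) = ip x y)
  (U_0 : forall x, U 0 x = x)
  (U_D : forall s t x, U (s + t) x = U s (U t x)).

(** A relation, as the derivative [vx] of the orbit at time 0 is determined only up to null
    vectors. *)
Definition generator (x vx : E) := forall e, 0 < e ->
  \forall s \near (0 : R)^', ipnorm (s^-1 *: (U s x - x) - vx) <= e.

Lemma U_adjoint t x y : ip x (U t y) = ip (U (- t) x) y.
Proof. by rewrite -(U_iso (- t)) -U_D addNr U_0. Qed.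

Lemma punctured_opp (P : R -> Prop) : (\forall s \near (0 : R)^', P s) ->
  \forall s \near (0 : R)^', P (- s).
Proof.
move=> [r /= r0 hr]; exists r => //= s; rewrite /ball_ /= sub0r normrN => sr s0.
by apply: hr; rewrite /ball_ /= ?sub0r ?opprK ?oppr_eq0.
Qed.

Lemma ip_cvg (T : Type) (F : set_system T) (FF : Filter F) (f : T -> E) l y :
  (forall e, 0 < e -> \forall s \near F, ipnorm (f s - l) <= e) ->
  (fun s => ip (f s) y) @ F --> ip l y.
Proof.
move=> h; apply/cvgrPdist_le => e e0.
have y1 : 0 < ipnorm y + 1 by rewrite ltr_wpDl ?ipnorm_ge0.
apply: filterS (h _ (divr_gt0 e0 y1)) => s hs.
rewrite distrC -(ipNl ipP) -(ipDl ipP) (le_trans (ip_le_norm ipP _ _))//.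
rewrite ler_pdivlMr// in hs; rewrite (le_trans _ hs)// ler_wpM2l ?ipnorm_ge0//.
by rewrite lerDl.
Qed.

(** The time increment is moved to the left argument by unitarity, so that only [x] has to be in the
    domain of the generator. *)
Lemma orbit_derivative x vx y (t : R) : generator x vx ->
  is_derive t 1 (fun t : R => ip x (U t y) : R) (- ip vx (U t y)).
Proof.
move=> gx; apply: is_derive_quotient.
have h : (fun s => ip ((- s)^-1 *: (U (- s) x - x)) (U t y)) @ (0 : R)^' -->
    ip vx (U t y).
  by apply: ip_cvg => e e0; exact: punctured_opp (gx e e0).
have {}h : (fun s => - ip ((- s)^-1 *: (U (- s) x - x)) (U t y)) @ (0 : R)^' -->
    - ip vx (U t y) by exact: cvgN.
apply: cvg_trans h; apply: near_eq_cvg; apply: filterE => s.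
have -> : ip x (U (s + t) y) = ip (U (- s) x) (U t y) by rewrite U_D U_adjoint.
by rewrite (ipZl ipP) (ipDl ipP) (ipNl ipP) invrN mulNr opprK.
Qed.

(** Both sides are the derivative of <x, U t y> at 0, computed once by moving the increment onto [x]
    and once on [y]. *)
Lemma generator_skew x vx y vy : generator x vx -> generator y vy ->
  ip x vy = - ip vx y.
Proof.
move=> gx gy; have := orbit_derivative y 0 gx; rewrite U_0 => h.
have d : derivable (fun t : R => ip x (U t y) : R) 0 1 by case: h.
have -> : - ip vx y = 'D_1 (fun t : R => ip x (U t y) : R) 0 by case: h.
have c : (fun s : R => ip (s^-1 *: (U s y - y)) x) @ 0^' --> ip vy x.
  by apply: ip_cvg.
have {}c : (fun s : R => s^-1 *: (ip x (U (s *: 1 + 0) y) - ip x (U 0 y))) @ 0^'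
    --> ip x vy.
  rewrite (ipC ipP x vy); apply: cvg_trans c; apply: near_eq_cvg.
  apply: filterE => s; rewrite addr0 -[s *: 1]/(s * 1) mulr1 U_0 (ipC ipP _ x).
  by rewrite (ipZr ipP) (ipDr ipP) (ipNr ipP).
by symmetry; exact: cvg_lim c.
Qed.

End unitary_group.

Section coherent_pair.
Context {R : realType} {E : lmodType R} {ip : E -> E -> R}.
Hypothesis ipP : semi_inner_product ip.
Local Notation ipE := (ipE ipP).
Local Notation ipnorm := (ipnorm (ip := ip)).
Variable U : R -> E -> E.
Hypotheses (U_lin : forall t a x y, U t (a *: x + y) = a *: U t x + U t y)
  (U_iso : forall t x y, ip (U t x) (U t y) = ip x y)
  (U_0 : forall x, U 0 x = x)
  (U_D : forall s t x, U (s + t) x = U s (U t x)).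
Variable K : E -> E.
Hypothesis KP : positive_compact (ip := ip) K.
(** [W] bounds the generator on the pair, [c * t] the commutator of [K] with [U t], and [d]
    dominates [nu - lam]. In the theorem they are [CK / lam], [C1 / T] and [3 * delta]. *)
Variables (phi psi vphi vpsi : E) (lam nu W c d : R).
Hypotheses (phi1 : ip phi phi = 1) (psi1 : ip psi psi = 1)
  (phipsi : ip phi psi = 0) (ephi : eigvec (ip := ip) K lam phi)
  (epsi : eigvec (ip := ip) K nu psi)
  (lam0 : 0 < lam) (lamnu : lam <= nu)
  (nonres : forall f, orthocomplement (ip := ip) phi psi f ->
    eigvec (ip := ip) K lam f \/ eigvec (ip := ip) K nu f -> ip f f = 0)
  (gphi : generator (ip := ip) U phi vphi) (gpsi : generator (ip := ip) U psi vpsi)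
  (phiW : ipnorm vphi <= W) (psiW : ipnorm vpsi <= W)
  (c0 : 0 <= c) (nud : nu - lam <= d)
  (UK : forall t x, 0 <= t -> ipnorm (K (U t x) - U t (K x)) <= c * t * ipnorm x).

Local Notation gap := (real_gap (ip := ip) K lam nu).

(* [pair_re +i* pair_im] is the autocorrelation of [(phi + i psi) / sqrt 2]. *)
Definition pair_re t := (ip phi (U t phi) + ip psi (U t psi)) / 2.
Definition pair_im t := (ip phi (U t psi) - ip psi (U t phi)) / 2.
Let a := pair_re.
Let b := pair_im.
Let w := ip phi vpsi.
(** The leakage of the orbit out of the span of [phi] and [psi], the only obstruction to an exact
    rotation. *)
Let q x t := U t x - (ip phi (U t x) *: phi + ip psi (U t x) *: psi).

Let psiphi : ip psi phi = 0. Proof. by rewrite (ipC ipP). Qed.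

Let W0 : 0 <= W. Proof. exact: le_trans (ipnorm_ge0 _) phiW. Qed.

Let d0 : 0 <= d. Proof. by move: lamnu nud; lra. Qed.

Let q_perp x t : orthocomplement (ip := ip) phi psi (q x t).
Proof.
by split; rewrite /q !ipE ?phi1 ?psi1 ?phipsi ?psiphi; ring.
Qed.

Let U_norm t x : ipnorm (U t x) = ipnorm x.
Proof. by rewrite !ipnormE U_iso. Qed.

Let U_B t x y : U t (x - y) = U t x - U t y.
Proof.
by have := U_lin t (-1) y x; rewrite !scaleN1r addrC => ->; rewrite addrC.
Qed.

Let U_Z t e x : U t (e *: x) = e *: U t x.
Proof.
have U0 : U t 0 = 0.
  have := U_lin t 1 0 0; rewrite !scale1r addr0 => h.
  by apply: (addrI (U t 0)); rewrite -h addr0.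
by have := U_lin t e x 0; rewrite !addr0 U0 addr0.
Qed.

Let res x := K x - nu *: x.

Let resZ e x : res (e *: x) = e *: res x.
Proof. by rewrite /res !(pcE KP) scalerBr !scalerA mulrC. Qed.

Let resD x y : res (x + y) = res x + res y.
Proof. by rewrite /res !(pcE KP) scalerDr opprD addrACA. Qed.

(** Up to null vectors, K - nu preserves both the span of the pair and its orthogonal complement, so
    the residuals obey Pythagoras. *)
Let q_res x t : ipnorm (res (q x t)) <= ipnorm (res (U t x)).
Proof.
have Wq := q_perp x t.
have cW := orthocomplement_closed_invariant ipP KP ephi epsi.
have Wr : orthocomplement (ip := ip) phi psi (res (q x t)).
  have h := ci_lin cW (- nu) Wq (ci_inv cW Wq).
  by rewrite /res addrC -scaleNr.
have -> : U t x = q x t + (ip phi (U t x) *: phi + ip psi (U t x) *: psi).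
  by rewrite subrK.
move: (q x t) Wq Wr => f [f1 f2] [r1 r2].
rewrite 2!resD !resZ; move: (ip phi (U t x)) (ip psi (U t x)) => e1 e2.
have n1 y : ip (res psi) y = 0 by exact: ip_null.
have n2 y : ip y (res psi) = 0 by rewrite (ipC ipP) n1.
have n3 y : ip (K phi - lam *: phi) y = 0 by exact: ip_null.
have n4 y : ip y (K phi - lam *: phi) = 0 by rewrite (ipC ipP) n3.
have -> : res phi = (K phi - lam *: phi) + (lam - nu) *: phi.
  by rewrite /res scalerBl addrA subrK.
rewrite ler_sqrt ?(ip_ge0 ipP)//; move: (res f) r1 r2 => r r1 r2.
move: (res psi) n1 n2 (K phi - lam *: phi) n3 n4 => u n1 n2 u' n3 n4.
rewrite !(ipDr ipP) !(ipDl ipP) !(ipZr ipP) !(ipZl ipP).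
rewrite !(ipDr ipP) !(ipDl ipP) !(ipZr ipP) !(ipZl ipP).
rewrite !n1 !n2 !n3 !n4 (ipC ipP r phi) r1 phi1.
(* The discarded part: K - nu is null on [psi] and multiplies [phi] by [lam - nu]. *)
rewrite -subr_ge0 (_ : _ - _ = (e1 * (lam - nu)) ^+ 2) ?sqr_ge0//.
by move: (ip r r) => z; ring.
Qed.

Let q_norm x t m : ipnorm (res (U t x)) <= m -> ipnorm (q x t) <= gap^-1 * m.
Proof.
move=> h; apply: le_trans
  (gap_lower_bound ipP KP ephi epsi lam0 lamnu nonres (q_perp x t)) _.
rewrite ler_wpM2l ?invr_ge0 ?real_gap_ge0//.
exact: le_trans (q_res x t) h.
Qed.

(** The eigenvalue is written [nu - e] to serve [phi], with [e = nu - lam], and [psi], with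
    [e = 0]. *)
Let res_U x t e : 0 <= t -> ip x x = 1 -> ipnorm (K x - (nu - e) *: x) = 0 ->
  ipnorm (res (U t x)) <= c * t + `|e|.
Proof.
move=> t0 x1 hx; have nx : ipnorm x = 1 by rewrite ipnormE x1 sqrtr1.
have -> : res (U t x) = (K (U t x) - U t (K x)) +
    (U t (K x - (nu - e) *: x) + (- e) *: U t x).
  rewrite /res U_B U_Z scalerBl scaleNr opprB [e *: _ - _]addrC.
  by rewrite [U t (K x) + _]addrA addrK subrKA.
apply: le_trans (ipnormD ipP _ _) _; apply: lerD.
  by have := UK x t0; rewrite nx mulr1.
apply: le_trans (ipnormD ipP _ _) _.
by rewrite U_norm hx add0r (ipnormZ ipP) U_norm nx mulr1 normrN.
Qed.

Let eig0 u x : eigvec (ip := ip) K u x -> ipnorm (K x - u *: x) = 0.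
Proof. by rewrite /eigvec ipnormE => ->; rewrite sqrtr0. Qed.

(** This is s_t for the constants of the theorem. *)
Let M t := gap^-1 * (c * t + d).

Let q_phi t : 0 <= t -> ipnorm (q phi t) <= M t.
Proof.
move=> t0; apply: q_norm; apply: le_trans (res_U (e := nu - lam) t0 phi1 _) _.
  by rewrite subKr eig0.
by rewrite lerD2l ger0_norm// subr_ge0.
Qed.

Let q_psi t : 0 <= t -> ipnorm (q psi t) <= M t.
Proof.
move=> t0; apply: q_norm; apply: le_trans (res_U (e := 0) t0 psi1 _) _.
  by rewrite subr0 eig0.
by rewrite normr0 lerD2l.
Qed.

Let sk_phi : ip phi vphi = 0.
Proof.
have := generator_skew ipP U_iso U_0 U_D gphi gphi; rewrite (ipC ipP vphi).
lra.
Qed.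

Let sk_psi : ip psi vpsi = 0.
Proof.
have := generator_skew ipP U_iso U_0 U_D gpsi gpsi; rewrite (ipC ipP vpsi).
lra.
Qed.

Let sk1 : ip vphi psi = - w.
Proof. by rewrite /w (generator_skew ipP U_iso U_0 U_D gphi gpsi) opprK. Qed.

Let sk2 : ip vpsi phi = w. Proof. by rewrite (ipC ipP). Qed.

Let ip_decomp y x t : ip y (U t x) =
  ip phi (U t x) * ip y phi + ip psi (U t x) * ip y psi + ip y (q x t).
Proof. by rewrite /q !ipE; ring. Qed.

(** [e1] and [e2] are the errors in the rotation equations a' = - w b + e1 and b' = w a + e2; both
    come from the leakage. *)
Let e1 t := - (ip vphi (q phi t) + ip vpsi (q psi t)) / 2.
Let e2 t := (ip vpsi (q phi t) - ip vphi (q psi t)) / 2.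

Let da (t : R) : is_derive t 1 a (- w * b t + e1 t).
Proof.
have h1 := orbit_derivative ipP U_iso U_0 U_D phi t gphi.
have h2 := orbit_derivative ipP U_iso U_0 U_D psi t gpsi.
have h := is_derive_funZ 2^-1 (is_derive_funD h1 h2).
have -> : a = (fun x => 2^-1 * (ip phi (U x phi) + ip psi (U x psi))).
  by apply/funext => x; rewrite /a /pair_re mulrC.
apply: is_derive_eq h _; rewrite /b /pair_im /e1.
rewrite (ip_decomp vphi) (ip_decomp vpsi) sk1 sk2 (ipC ipP vphi phi) sk_phi.
rewrite (ipC ipP vpsi psi) sk_psi.
move: (ip vphi _) (ip vpsi _) (ip phi _) (ip psi _) (ip phi _) (ip psi _).
by move=> x1 x2 x3 x4 x5 x6; field.
Qed.

Let db (t : R) : is_derive t 1 b (w * a t + e2 t).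
Proof.
have h1 := orbit_derivative ipP U_iso U_0 U_D psi t gphi.
have h2 := orbit_derivative ipP U_iso U_0 U_D phi t gpsi.
have h := is_derive_funZ 2^-1 (is_derive_funB h1 h2).
have -> : b = (fun x => 2^-1 * (ip phi (U x psi) - ip psi (U x phi))).
  by apply/funext => x; rewrite /b /pair_im mulrC.
apply: is_derive_eq h _; rewrite /a /pair_re /e2.
rewrite (ip_decomp vphi) (ip_decomp vpsi) sk1 sk2 (ipC ipP vphi phi) sk_phi.
rewrite (ipC ipP vpsi psi) sk_psi.
move: (ip vphi _) (ip vpsi _) (ip phi _) (ip psi _) (ip phi _) (ip psi _).
by move=> x1 x2 x3 x4 x5 x6; field.
Qed.

(** Grouping by [vphi] and [vpsi] pairs each with a rotated combination of the two leakages.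
    Rotation preserves the sum of their squared norms, so n1 + n2 <= 2 M, and no factor sqrt 2 is
    lost. *)
Let err_le t x y : 0 <= t -> x ^+ 2 + y ^+ 2 = 1 ->
  x * e1 t + y * e2 t <= W * M t.
Proof.
move=> t0 xy1; have := q_phi t0; have := q_psi t0; rewrite /e1 /e2.
move: (q phi t) (q psi t) => f g g_le f_le.
have -> : x * (- (ip vphi f + ip vpsi g) / 2) +
    y * ((ip vpsi f - ip vphi g) / 2) = (ip vphi (- (x *: f + y *: g))
   + ip vpsi (y *: f - x *: g)) / 2.
  rewrite !ipE.
  by move: (ip _ _) (ip _ _) (ip _ _) (ip _ _) => z1 z2 z3 z4; field.
have M0 : 0 <= M t by exact: le_trans (ipnorm_ge0 _) f_le.
pose n1 := ipnorm (x *: f + y *: g).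
pose n2 := ipnorm (y *: f - x *: g).
have sq : n1 ^+ 2 + n2 ^+ 2 <= 2 * M t ^+ 2.
  have -> : n1 ^+ 2 + n2 ^+ 2 = (x ^+ 2 + y ^+ 2) *
      (ipnorm f ^+ 2 + ipnorm g ^+ 2).
    rewrite /n1 /n2 !(sqr_ipnorm ipP) !ipE (ipC ipP g f).
    by move: (ip _ _) (ip _ _) (ip _ _) => z1 z2 z3; ring.
  rewrite xy1 mul1r mulr_natl mulr2n.
  by apply: lerD; rewrite ler_pXn2r// ?nnegrE ?ipnorm_ge0// ?f_le ?g_le.
have n12 : n1 + n2 <= 2 * M t.
  rewrite -(@ler_pXn2r _ 2)//; last 2 first.
  - by rewrite nnegrE addr_ge0 ?ipnorm_ge0.
  - by rewrite nnegrE mulr_ge0.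
  have := sqr_ge0 (n1 - n2); move: sq; lra.
have h1 : ip vphi (- (x *: f + y *: g)) <= W * n1.
  apply: le_trans (ler_norm _) _; apply: le_trans (ip_le_norm ipP _ _) _.
  by rewrite (ipnormN ipP) ler_wpM2r ?ipnorm_ge0.
have h2 : ip vpsi (y *: f - x *: g) <= W * n2.
  apply: le_trans (ler_norm _) _; apply: le_trans (ip_le_norm ipP _ _) _.
  by rewrite ler_wpM2r ?ipnorm_ge0.
have := ler_wpM2l W0 n12; move: h1 h2.
move: (ip _ _) (ip _ _) => z1 z2; lra.
Qed.

(** The integral of [W * M] from 0 to [t]. In the theorem, S_t is this quantity times 2 (1 +
    tdelta). *)
Definition pair_bound t := W * gap^-1 * (c * t ^+ 2 / 2 + d * t).

Let dbound (t : R) : is_derive t 1 pair_bound (W * M t).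
Proof.
have hid : is_derive t 1 (fun x : R => x) (1 : R) by exact: is_derive_id.
have h := is_derive_funZ (W * gap^-1) (is_derive_funD
  (is_derive_funZ (c / 2) (is_derive_funM hid hid)) (is_derive_scaled d t)).
have -> : pair_bound = (fun x => W * gap^-1 * (c / 2 * (x * x) + d * x)).
  by apply/funext => x; rewrite /pair_bound expr2 [c * _ / 2]mulrAC.
by apply: is_derive_eq h _; rewrite /M; move: gap^-1 => z; field.
Qed.

Let a0 : a 0 = 1.
Proof. by rewrite /a /pair_re !U_0 phi1 psi1; field. Qed.

Let b0 : b 0 = 0.
Proof. by rewrite /b /pair_im !U_0 phipsi psiphi; field. Qed.

(* Compares [exp(- i w t) (pair_re + i pair_im) - 1] with
   [pair_bound] in an arbitrary direction [(x, y)]. *)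
Let rotated t x y : 0 <= t -> x ^+ 2 + y ^+ 2 = 1 ->
  x * (a t * cos (w * t) + b t * sin (w * t) - 1)
    + y * (b t * cos (w * t) - a t * sin (w * t)) <= pair_bound t.
Proof.
move=> t0 xy1.
pose G (s : R) := x * (a s * cos (w * s) + b s * sin (w * s))
    + y * (b s * cos (w * s) - a s * sin (w * s)) - pair_bound s.
pose dG s := ((x * cos (w * s) - y * sin (w * s)) * e1 s
    + (x * sin (w * s) + y * cos (w * s)) * e2 s) - W * M s.
have hG (s : R) : is_derive s 1 G (dG s).
  have hc := is_derive_cos_scaled w s; have hs := is_derive_sin_scaled w s.
  have h := is_derive_funB (is_derive_funD
    (is_derive_funZ x (is_derive_funD (is_derive_funM (da s) hc) (is_derive_funM (db s) hs)))
    (is_derive_funZ y (is_derive_funB (is_derive_funM (db s) hc) (is_derive_funM (da s) hs))))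
    (dbound s).
  apply: is_derive_eq h _; rewrite /dG.
  move: (a s) (b s) (cos _) (sin _) (e1 s) (e2 s) (M s) => z1 z2 z3 z4 z5 z6 z7.
  by ring.
(* In the rotating frame the main terms cancel, and the rotated direction is still a unit vector, as
   [err_le] requires. *)
have dG0 s : 0 <= s -> dG s <= 0.
  move=> s0; rewrite subr_le0; apply: err_le => //.
  rewrite -xy1 -[RHS]mulr1 -(cos2Dsin2 (w * s)).
  by move: (cos _) (sin _) => z1 z2; ring.
have : G t <= G 0.
  apply: (is_derive_increment_le t0 (fun s _ => hG s)) => s /andP[s0 _].
  exact: dG0.
have p0 : pair_bound 0 = 0 by rewrite /pair_bound; ring.
rewrite /G !mulr0 cos0 sin0 a0 b0 p0.
move: (a t * _ + _) (b t * _ - _) (pair_bound t) => z1 z2 z3; lra.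
Qed.

(** With u = z1 + i z2 of modulus 1 and alpha = z3 + i z4, this says that |alpha - u| equals
    |conj(u) alpha - 1|. *)
Let rotation_identity (z1 z2 z3 z4 : R) : z1 ^+ 2 + z2 ^+ 2 = 1 ->
  (z3 - z1) ^+ 2 + (z4 - z2) ^+ 2 =
  (z3 * z1 + z4 * z2 - 1) ^+ 2 + (z4 * z1 - z3 * z2) ^+ 2.
Proof.
move=> h.
have -> : (z3 * z1 + z4 * z2 - 1) ^+ 2 + (z4 * z1 - z3 * z2) ^+ 2 =
  (z3 ^+ 2 + z4 ^+ 2) * (z1 ^+ 2 + z2 ^+ 2) - 2 * (z3 * z1 + z4 * z2) + 1 by ring.
have -> : (z3 - z1) ^+ 2 + (z4 - z2) ^+ 2 =
  z3 ^+ 2 + z4 ^+ 2 - 2 * (z3 * z1 + z4 * z2) + (z1 ^+ 2 + z2 ^+ 2) by ring.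
by rewrite h mulr1.
Qed.

Lemma pair_phase_bound t : 0 <= t ->
  (a t - cos (w * t)) ^+ 2 + (b t - sin (w * t)) ^+ 2 <= pair_bound t ^+ 2.
Proof.
move=> t0; rewrite (rotation_identity _ _ (cos2Dsin2 (w * t))).
have h := rotated t0 (x := _) (y := _).
move: h; move: (_ - 1) (b t * _ - _) (pair_bound t) => x y p h.
set r2 := x ^+ 2 + y ^+ 2; have r20 : 0 <= r2 by rewrite addr_ge0 ?sqr_ge0.
have [->|rn] := eqVneq r2 0; first exact: sqr_ge0.
pose r := Num.sqrt r2.
have rp : 0 < r by rewrite sqrtr_gt0 lt_neqAle eq_sym rn.
have rr : r ^+ 2 = r2 by rewrite sqr_sqrtr.
(* In the direction of the vector itself, the directional bound becomes a bound on its length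
   [r]. *)
have /h {h} : (x / r) ^+ 2 + (y / r) ^+ 2 = 1.
  by rewrite !exprMn -mulrDl -/r2 -rr exprVn divff// expf_neq0// gt_eqF.
have -> : x / r * x + y / r * y = r2 / r by rewrite /r2; field; rewrite gt_eqF.
rewrite -rr expr2 mulfK ?gt_eqF// => rpb.
by rewrite -expr2 ler_pXn2r// nnegrE ?(ltW rp)// (le_trans (ltW rp)).
Qed.

(** Twice ||U z - alpha z||^2 = 1 - |alpha|^2, by parts: (a + i b)(phi + i psi) has real part a phi
    - b psi and imaginary part b phi + a psi. The 2 undoes the normalisation of [z]. *)
Lemma pair_defect t :
  ip (U t phi - (a t *: phi - b t *: psi)) (U t phi - (a t *: phi - b t *: psi)) +
  ip (U t psi - (b t *: phi + a t *: psi)) (U t psi - (b t *: phi + a t *: psi)) =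
  2 * (1 - (a t ^+ 2 + b t ^+ 2)).
Proof.
have aE : ip phi (U t phi) + ip psi (U t psi) = 2 * a t.
  by rewrite /a /pair_re; field.
have bE : ip phi (U t psi) - ip psi (U t phi) = 2 * b t.
  by rewrite /b /pair_im; field.
rewrite !ipE !U_iso !(ipC ipP (U t _) phi) !(ipC ipP (U t _) psi).
rewrite phi1 psi1 phipsi psiphi.
move: (a t) (b t) (ip phi (U t phi)) (ip psi (U t phi)) (ip phi (U t psi))
  (ip psi (U t psi)) aE bE => x y z1 z2 z3 z4 h1 h2.
have -> : z4 = 2 * x - z1 by move: h1; lra.
have -> : z3 = 2 * y + z2 by move: h2; lra.
ring.
Qed.

Lemma pair_bound_ge0 t : 0 <= t -> 0 <= pair_bound t.
Proof.
move=> t0; rewrite /pair_bound mulr_ge0 ?mulr_ge0 ?invr_ge0 ?real_gap_ge0//.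
by rewrite addr_ge0 ?mulr_ge0 ?divr_ge0 ?mulr_ge0 ?sqr_ge0.
Qed.

Lemma pair_modulus_le1 t : a t ^+ 2 + b t ^+ 2 <= 1.
Proof.
have := pair_defect t.
have := ip_ge0 ipP (U t phi - (a t *: phi - b t *: psi)).
have := ip_ge0 ipP (U t psi - (b t *: phi + a t *: psi)).
move: (ip _ _) (ip _ _) => z1 z2; lra.
Qed.

Lemma pair_modulus_bound t : 0 <= t ->
  1 - (a t ^+ 2 + b t ^+ 2) <= 2 * pair_bound t.
Proof.
move=> t0; have := pair_phase_bound t0; have := pair_bound_ge0 t0.
have := pair_modulus_le1 t; have := cos2Dsin2 (w * t).
move: (a t) (b t) (cos _) (sin _) (pair_bound t) => x y C S p CS h1 p0 h.
(* The claim is trivial for 2 p >= 1; otherwise 1 - p is positive and may be squared. *)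
have [p1|p1] := leP 1 (2 * p).
  by apply: le_trans p1; have := sqr_ge0 x; have := sqr_ge0 y; lra.
(* |alpha| >= 1 - p by Cauchy-Schwarz against the unit vector (C, S) *)
have cs : 1 - p <= x * C + y * S.
  have h2 : (1 - (x * C + y * S)) ^+ 2 <= p ^+ 2.
    apply: le_trans h; rewrite (rotation_identity x y CS) -sqrrN opprB.
    by rewrite lerDl sqr_ge0.
  have [|neg] := leP (x * C + y * S) 1; last by lra.
  move=> le1; rewrite lerBlDr -lerBlDl.
  by rewrite -(@ler_pXn2r _ 2)// nnegrE subr_ge0.
have h3 : (x * C + y * S) ^+ 2 <= x ^+ 2 + y ^+ 2.
  have -> : x ^+ 2 + y ^+ 2 = (x ^+ 2 + y ^+ 2) * (C ^+ 2 + S ^+ 2) by rewrite CS mulr1.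
  have := sqr_ge0 (x * S - y * C); lra.
have h4 : (1 - p) ^+ 2 <= (x * C + y * S) ^+ 2.
  by rewrite ler_pXn2r// nnegrE; lra.
have := sqr_ge0 p; lra.
Qed.

Lemma pair_initial_derivative :
  is_derive (0 : R) 1 a 0 /\ is_derive (0 : R) 1 b w.
Proof.
have q0 x : x = phi \/ x = psi -> ip (q x 0) (q x 0) = 0.
  by move=> [->|->]; rewrite /q U_0 !ipE ?phi1 ?psi1 ?phipsi ?psiphi; ring.
have qp y : ip y (q phi 0) = 0 by rewrite (ipC ipP); apply: ip_null => //; exact: q0 (or_introl _).
have qs y : ip y (q psi 0) = 0 by rewrite (ipC ipP); apply: ip_null => //; exact: q0 (or_intror _).
split.
  by apply: is_derive_eq (da 0) _; rewrite /e1 !qp !qs b0; ring.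
by apply: is_derive_eq (db 0) _; rewrite /e2 !qp !qs a0; ring.
Qed.

End coherent_pair.

Local Open Scope complex_scope.
Local Open Scope ring_scope.

(** * Complex square-integrable functions *)

Section complex_numbers.
Context {R : rcfType}.
Implicit Types z w : R[i].

Lemma ReM z w : complex.Re (z * w) =
  complex.Re z * complex.Re w - complex.Im z * complex.Im w.
Proof. by case: z; case: w. Qed.

Lemma ImM z w : complex.Im (z * w) =
  complex.Re z * complex.Im w + complex.Im z * complex.Re w.
Proof. by case: z => a b; case: w => c d /=; rewrite addrC. Qed.

Lemma ReD z w : complex.Re (z + w) = complex.Re z + complex.Re w.
Proof. by case: z; case: w. Qed.

Lemma ImD z w : complex.Im (z + w) = complex.Im z + complex.Im w.
Proof. by case: z; case: w. Qed.

Lemma ReN z : complex.Re (- z) = - complex.Re z.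
Proof. by case: z. Qed.

Lemma ImN z : complex.Im (- z) = - complex.Im z.
Proof. by case: z. Qed.

Definition complexE := (ReM, ImM, ReD, ImD, ReN, ImN).

Lemma complex_ext z w : complex.Re z = complex.Re w ->
  complex.Im z = complex.Im w -> z = w.
Proof. by case: z => a b; case: w => c d /= -> ->. Qed.

Lemma normcE z : normc z = Num.sqrt (complex.Re z ^+ 2 + complex.Im z ^+ 2).
Proof. by case: z. Qed.

Lemma sqrt_sum_sqr_le (x y : R) : Num.sqrt (x ^+ 2 + y ^+ 2) <= `|x| + `|y|.
Proof.
rewrite -(@ler_pXn2r _ 2)// ?nnegrE ?sqrtr_ge0 ?addr_ge0// sqr_sqrtr; last first.
  by rewrite addr_ge0 ?sqr_ge0.
rewrite sqrrD !real_normK ?num_real// addrAC lerDl.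
by rewrite mulrn_wge0// mulr_ge0.
Qed.

End complex_numbers.

Section complex_L2.
Context d (T : measurableType d) {R : realType} (mu : probability T R).
Local Notation E2 := (E2 mu).
Local Notation rip2 := (@rip2 _ _ R mu).
Local Notation ipnorm := (ipnorm (ip := rip2)).
Local Notation ipP := (rip2_semi_inner mu).
Implicit Types (a b f g : E2).

Definition cpx (f g : E2) : T -> R[i] := fun x => f x +i* g x.

Lemma L2_cpx f g : L2 mu (cpx f g).
Proof. by split; [exact: LfunP f|exact: LfunP g]. Qed.

Lemma L2P (F : T -> R[i]) : L2 mu F -> exists f g, F = cpx f g.
Proof.
move=> [hf hg]; exists (Lfun_Sub (p12 (R := R)) hf), (Lfun_Sub (p12 (R := R)) hg).
by apply/funext => x; apply: complex_ext.
Qed.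

Lemma inner_cpx a b f g : inner mu (cpx a b) (cpx f g) =
  (rip2 a f + rip2 b g) +i* (rip2 a g - rip2 b f).
Proof.
have i (u v : E2) := Lfun2_integrable_mul (LfunP u) (LfunP v).
rewrite /inner /Cintegral; congr (_ +i* _).
  rewrite -RintegralD//; apply: eq_Rintegral => x _ /=.
  by rewrite mulNr opprK.
rewrite -RintegralB//; apply: eq_Rintegral => x _ /=.
by rewrite mulNr.
Qed.

Lemma l2norm_cpx f g : l2norm mu (cpx f g) = Num.sqrt (rip2 f f + rip2 g g).
Proof.
have i (u v : E2) := Lfun2_integrable_mul (LfunP u) (LfunP v).
rewrite /l2norm -RintegralD//; congr Num.sqrt; apply: eq_Rintegral => x _.
by rewrite normcE sqr_sqrtr ?addr_ge0 ?sqr_ge0//= !expr2.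
Qed.

Lemma l2norm_cpx_le f g : l2norm mu (cpx f g) <= ipnorm f + ipnorm g.
Proof.
rewrite l2norm_cpx -!(sqr_ipnorm ipP) (le_trans (sqrt_sum_sqr_le _ _))//.
by rewrite !ger0_norm ?ipnorm_ge0.
Qed.

Lemma l2norm_cpx_ge f g :
  ipnorm f <= l2norm mu (cpx f g) /\ ipnorm g <= l2norm mu (cpx f g).
Proof.
by rewrite l2norm_cpx; split; rewrite ler_sqrt ?addr_ge0 ?(ip_ge0 ipP)//
  ?lerDl ?lerDr (ip_ge0 ipP).
Qed.

Lemma null_ae f g :
  rip2 (f - g) (f - g) = 0 <-> {ae mu, forall x, f x = g x}.
Proof.
split=> [/rip_eq0|] h; last apply/rip_eq0; apply: ae_imply h _ => x.
  by rewrite -[(f - g) x]/(f x - g x) => /eqP; rewrite subr_eq0 => /eqP.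
by rewrite -[(f - g) x]/(f x - g x) => ->; rewrite subrr.
Qed.

Lemma aeeq_cpx a b f g : aeeq mu (cpx a b) (cpx f g) <->
  rip2 (a - f) (a - f) = 0 /\ rip2 (b - g) (b - g) = 0.
Proof.
split=> [h|[/null_ae ha /null_ae hb]].
  by split; apply/null_ae; apply: ae_imply h _ => x [].
by apply: ae_imply2 ha hb _ => x; rewrite /cpx => -> ->.
Qed.

Lemma aeeq_cpx0 a b : aeeq mu (cpx a b) (cst 0) <->
  rip2 a a = 0 /\ rip2 b b = 0.
Proof.
have := aeeq_cpx a b 0 0; rewrite !subr0 => <-.
by have -> : cpx 0 0 = cst 0 by apply/funext.
Qed.

Section real_operator.
Variables (K : E2 -> E2) (KC : (T -> R[i]) -> T -> R[i]).
Hypothesis KP : positive_compact (ip := rip2) K.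
Hypothesis KCE : forall f g, KC (cpx f g) = cpx (K f) (K g).
Local Notation eigvec := (eigvec (ip := rip2)).

Let rip20 w : rip2 w 0 = 0.
Proof. by rewrite -(scale0r 0) (ipZr ipP) mul0r. Qed.

Lemma eigenfunction_cpx u a b : eigenfunction mu KC u (cpx a b) <->
  (let x := K a - (complex.Re u *: a - complex.Im u *: b) in rip2 x x = 0) /\
  (let y := K b - (complex.Re u *: b + complex.Im u *: a) in rip2 y y = 0).
Proof.
rewrite /= -aeeq_cpx /eigenfunction KCE.
have -> : (fun x => u * cpx a b x) = cpx (complex.Re u *: a - complex.Im u *: b)
    (complex.Re u *: b + complex.Im u *: a).
  by apply/funext => x; apply: complex_ext; rewrite complexE.
by split=> [[]//|h]; split=> //; exact: L2_cpx.
Qed.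

Lemma eigenfunction_real u a b : eigenfunction mu KC u%:C (cpx a b) <->
  eigvec K u a /\ eigvec K u b.
Proof.
by rewrite eigenfunction_cpx /= !scale0r subr0 addr0.
Qed.

(** Pairing the real equation with [b] and the imaginary one with [a], symmetry of [K] leaves Im u
    (||a||^2 + ||b||^2) = 0. One of the two parts is then a nonnull real eigenvector. *)
Lemma point_spectrum_real :
  point_spectrum mu KC = [set u%:C | u in real_spectrum (ip := rip2) K].
Proof.
apply/seteqP; split=> [u [f /[dup] -[/L2P[a [b ->]] _]] + fn|].
  move=> /[dup] ef /eigenfunction_cpx/=[ha hb].
  have {}fn : rip2 a a + rip2 b b != 0.
    apply/eqP => h; apply: fn; apply/aeeq_cpx0.
    have := ip_ge0 ipP a; have := ip_ge0 ipP b; move: h.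
    by move: (rip2 a a) (rip2 b b) => x y h x0 y0; split; lra.
  have u0 : complex.Im u = 0.
    have := ip_null ipP b ha; have := ip_null ipP a hb.
    rewrite !(ipE ipP) -(pc_sym KP b) (ipC ipP b (K a)) (ipC ipP b a).
    rewrite -(pc_sym KP a b).
    move: fn; move: (rip2 a a) (rip2 b b) (rip2 a b) (rip2 a (K b)).
    move=> x y q p fn h1 h2; apply/eqP; rewrite -[_ == 0]orbF -(negbTE fn).
    by rewrite -mulf_eq0; apply/eqP; lra.
  have uE : u = (complex.Re u)%:C by apply: complex_ext.
  exists (complex.Re u); last by rewrite -uE.
  rewrite uE in ef; have /eigenfunction_real[ea eb] := ef.
  have [a0|a0] := eqVneq (rip2 a a) 0; last by exists a.
  by exists b => //; move: fn; rewrite a0 add0r.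
move=> _ [u [f fn ef] <-]; exists (cpx f 0).
  by apply/eigenfunction_real; split; [exact: ef|exact: (eigvec0 ipP KP)].
by move=> /aeeq_cpx0[/eqP]; rewrite (negbTE fn).
Qed.

Lemma spectral_gap_real lam nu : spectral_gap (point_spectrum mu KC) lam nu =
  real_gap (ip := rip2) K lam nu.
Proof.
have cB (x y : R) : normc (x%:C - y%:C) = `|x - y|.
  by rewrite normcE complexE /= subr0 expr0n addr0 sqrtr_sqr.
rewrite /spectral_gap /real_gap point_spectrum_real; congr inf.
apply/seteqP; split=> [_ [_ [[u hu <-] ul] <-]|_ [u [hu ul] <-]].
  exists u; last by rewrite !cB.
  by split=> // -[h|h]; apply: ul; rewrite h; [left|right].
exists u%:C; last by rewrite !cB.
split; first by exists u.
by case=> /(congr1 (@complex.Re R))/= h; apply: ul; rewrite h; [left|right].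
Qed.

(** Pairing the combination with [a]. The multiplicity lemmas use it to read off complex
    coefficients of real orthogonal functions. *)
Lemma real_orthogonal_coef (a b f : E2) (c1 c2 c3 : R[i]) : rip2 a a != 0 ->
  rip2 a b = 0 -> rip2 a f = 0 ->
  aeeq mu (fun x => c1 * (a x)%:C + c2 * (b x)%:C + c3 * (f x)%:C) (cst 0) ->
  c1 = 0.
Proof.
move=> an ab af.
have -> : (fun x => c1 * (a x)%:C + c2 * (b x)%:C + c3 * (f x)%:C) =
    cpx (complex.Re c1 *: a + complex.Re c2 *: b + complex.Re c3 *: f)
        (complex.Im c1 *: a + complex.Im c2 *: b + complex.Im c3 *: f).
  by apply/funext => x; apply: complex_ext; rewrite !complexE/= !mulr0 ?subr0 ?add0r.
move=> /aeeq_cpx0[h1 h2].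
have := ip_null ipP a h1; have := ip_null ipP a h2.
rewrite !(ipDl ipP) !(ipZl ipP) (ipC ipP b) (ipC ipP f) ab af !mulr0 !addr0.
move=> /eqP; rewrite mulf_eq0 (negbTE an) orbF => /eqP i0.
move=> /eqP; rewrite mulf_eq0 (negbTE an) orbF => /eqP r0.
exact: complex_ext.
Qed.

Lemma multiplicity1_unique u a f : has_multiplicity mu KC u%:C 1 ->
  eigvec K u a -> eigvec K u f -> rip2 a a != 0 -> rip2 a f = 0 -> rip2 f f = 0.
Proof.
move=> [e [_ _ span]] ea ef an af; apply/eqP; apply: contraT => fn.
have e0 := eigvec0 ipP KP u.
have [c hc] := span _ ((eigenfunction_real u a 0).2 (conj ea e0)).
have [g hg] := span _ ((eigenfunction_real u f 0).2 (conj ef e0)).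
have c0 : c ord0 = 0.
  apply/eqP; rewrite -oppr_eq0; apply/eqP.
  apply: (@real_orthogonal_coef f a 0 _ (g ord0) 0 fn); first by rewrite (ipC ipP).
    exact: rip20.
  apply: ae_imply2 hc hg _ => x; rewrite !big_ord1 /= => hc hg.
  rewrite -[(a x)%:C]/(cpx a 0 x) -[(f x)%:C]/(cpx f 0 x) hc hg.
  by move: (e _ x) (c _) (g _) => p q r; ring.
have : aeeq mu (cpx a 0) (cst 0).
  by apply: ae_imply hc _ => x ->; rewrite big_ord1 c0 mul0r.
by move=> /aeeq_cpx0[/eqP]; rewrite (negbTE an).
Qed.

Lemma multiplicity2_unique u a b f : has_multiplicity mu KC u%:C 2 ->
  eigvec K u a -> eigvec K u b -> eigvec K u f ->
  rip2 a a != 0 -> rip2 b b != 0 -> rip2 a b = 0 -> rip2 a f = 0 ->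
  rip2 b f = 0 -> rip2 f f = 0.
Proof.
move=> [e [_ _ span]] ea eb ef an bn ab af bf; apply/eqP; apply: contraT => fn.
have i0 := rip20; have e0 := eigvec0 ipP KP u.
have [p hp] := span _ ((eigenfunction_real u a 0).2 (conj ea e0)).
have [q hq] := span _ ((eigenfunction_real u b 0).2 (conj eb e0)).
have [r hr] := span _ ((eigenfunction_real u f 0).2 (conj ef e0)).
have h2 : lift ord0 ord0 = 1 :> 'I_2 by exact: val_inj.
have [p0 [p1 {}hp]] : exists p0 p1, {ae mu, forall x,
    (a x)%:C = p0 * e 0 x + p1 * e 1 x}.
  exists (p 0), (p 1); apply: ae_imply hp _ => x.
  by rewrite !big_ord_recl !big_ord0 /= h2 addr0.
have [q0 [q1 {}hq]] : exists p0 p1, {ae mu, forall x,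
    (b x)%:C = p0 * e 0 x + p1 * e 1 x}.
  exists (q 0), (q 1); apply: ae_imply hq _ => x.
  by rewrite !big_ord_recl !big_ord0 /= h2 addr0.
have [r0 [r1 {}hr]] : exists p0 p1, {ae mu, forall x,
    (f x)%:C = p0 * e 0 x + p1 * e 1 x}.
  exists (r 0), (r 1); apply: ae_imply hr _ => x.
  by rewrite !big_ord_recl !big_ord0 /= h2 addr0.
(* Three vectors in the span of two satisfy the linear relation whose coefficients are the 2 x 2
   minors of their coordinates; orthogonality kills the coefficient of [f]. *)
have w0 : p0 * q1 - p1 * q0 = 0.
  apply: (@real_orthogonal_coef f a b _ (q0 * r1 - q1 * r0)
    (r0 * p1 - r1 * p0) fn); rewrite 1?(ipC ipP)//.
  apply: ae_imply2 hr (ae_imply2 hp hq (fun x => @conj _ _)) _ => x -> [-> ->] /=; ring.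
(* The combination [p0 b - q0 a] is the vanishing minor times [e 1], so its coefficient along [b] is
   0. *)
have p00 : p0 = 0.
  apply: (@real_orthogonal_coef b a 0 _ (- q0) 0 bn); [by rewrite (ipC ipP)|exact: i0|].
  apply: ae_imply2 hp hq _ => x -> -> /=.
  transitivity ((p0 * q1 - p1 * q0) * e 1 x); [ring|by rewrite w0 mul0r].
have p10 : p1 = 0.
  apply: (@real_orthogonal_coef b a 0 _ (- q1) 0 bn); [by rewrite (ipC ipP)|exact: i0|].
  apply: ae_imply2 hp hq _ => x -> -> /=.
  transitivity (- (p0 * q1 - p1 * q0) * e 0 x); [ring|].
  by rewrite w0 oppr0 mul0r.
have : aeeq mu (cpx a 0) (cst 0).
  by apply: ae_imply hp _ => x /= h; rewrite -[LHS]/(a x)%:C h p00 p10 !mul0r addr0.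
by move=> /aeeq_cpx0[/eqP]; rewrite (negbTE an).
Qed.
Lemma real_eigenbasisP lam nu (phi psi : T -> R) :
  real_eigenbasis mu KC lam nu phi psi -> exists a b : E2,
    [/\ phi = a, psi = b & [/\ rip2 a a = 1, rip2 b b = 1, rip2 a b = 0,
      eigvec K lam a & eigvec K nu b]].
Proof.
have norm1 (f : E2) : l2norm mu (cpx f 0) = 1 -> rip2 f f = 1.
  rewrite l2norm_cpx rip20 addr0 => /(congr1 (fun x => x ^+ 2)).
  by rewrite sqr_sqrtr ?(ip_ge0 ipP)// expr1n.
have lift (f : T -> R) : L2 mu (cfun f) -> exists a : E2, f = a.
  by move=> [hf _]; exists (Lfun_Sub (p12 (R := R)) hf).
move=> [ea eb]; have [a fa] := lift _ ea.1; have [b fb] := lift _ eb.1.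
subst phi psi => /norm1 a1 /norm1 b1 ab; exists a, b; split => //; split => //.
- have := congr1 (@complex.Re R) ab; rewrite -[cfun a]/(cpx a 0).
  by rewrite -[cfun b]/(cpx b 0) inner_cpx /= rip20 addr0.
- by have [] := (eigenfunction_real lam a 0).1 ea.
- by have [] := (eigenfunction_real nu b 0).1 eb.
Qed.

(** Derives the nonresonance condition of the spectral gap estimate from the multiplicity
    hypotheses. *)
Lemma eigenbasis_complete lam nu a b f :
  (lam != nu -> has_multiplicity mu KC lam%:C 1 /\
    has_multiplicity mu KC nu%:C 1) ->
  (lam = nu -> has_multiplicity mu KC lam%:C 2) ->
  rip2 a a = 1 -> rip2 b b = 1 -> rip2 a b = 0 ->
  eigvec K lam a -> eigvec K nu b ->
  orthocomplement (ip := rip2) a b f -> eigvec K lam f \/ eigvec K nu f ->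
  rip2 f f = 0.
Proof.
move=> m1 m2 a1 b1 ab ea eb [af bf].
have an : rip2 a a != 0 by rewrite a1 oner_eq0.
have bn : rip2 b b != 0 by rewrite b1 oner_eq0.
have [ln|ln] := eqVneq lam nu.
  rewrite -ln in eb *.
  by case=> ef; exact: (multiplicity2_unique (m2 ln) ea eb ef).
have [ml mn] := m1 ln; case=> ef.
  exact: (multiplicity1_unique ml ea ef).
exact: (multiplicity1_unique mn eb ef).
Qed.

End real_operator.
End complex_L2.

(** * Independence of the frequency from the eigenbasis *)

Section eigenbasis_rotation.
Context {R : realType} {E : lmodType R} {ip : E -> E -> R}.
Hypothesis ipP : semi_inner_product ip.
Local Notation ipE := (ipE ipP).
Variable K : E -> E.
Hypothesis KP : positive_compact (ip := ip) K.
Local Notation eigvec := (eigvec (ip := ip) K).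
Variables (phi psi phi' psi' : E) (lam nu : R).
Hypotheses (phi1 : ip phi phi = 1) (psi1 : ip psi psi = 1)
  (phipsi : ip phi psi = 0) (ephi : eigvec lam phi) (epsi : eigvec nu psi).
Hypotheses (phi'1 : ip phi' phi' = 1) (psi'1 : ip psi' psi' = 1)
  (phi'psi' : ip phi' psi' = 0) (ephi' : eigvec lam phi') (epsi' : eigvec nu psi').
Hypothesis nonres : forall f, orthocomplement (ip := ip) phi psi f ->
  eigvec lam f \/ eigvec nu f -> ip f f = 0.

(** Handles equal and distinct eigenvalues together: if they differ, the coefficient is 0 by
    orthogonality. *)
Let eigvec_component u w x y : eigvec u x -> eigvec w y ->
  eigvec u (- ip y x *: y).
Proof.
move=> ex ey; have [wu|wu] := eqVneq w u; first by rewrite -wu; exact: eigvecZ.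
by rewrite (eigvec_orth ipP KP ey ex wu) oppr0 scale0r; exact: eigvec0.
Qed.

Let expansion f : eigvec lam f \/ eigvec nu f ->
  let r := f - (ip phi f *: phi + ip psi f *: psi) in ip r r = 0.
Proof.
move=> ef r; have psiphi : ip psi phi = 0 by rewrite (ipC ipP).
apply: nonres.
  by split; rewrite /r !ipE ?phi1 ?psi1 ?phipsi ?psiphi; ring.
rewrite /r opprD -!scaleNr; case: ef => ef; [left|right];
  apply: (eigvecD ipP KP) => //; apply: (eigvecD ipP KP);
  by [exact: eigvec_component ef ephi|exact: eigvec_component ef epsi].
Qed.

Variable U : R -> E -> E.
Hypotheses (U_lin : forall t a x y, U t (a *: x + y) = a *: U t x + U t y)
  (U_iso : forall t x y, ip (U t x) (U t y) = ip x y)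
  (U_0 : forall x, U 0 x = x)
  (U_D : forall s t x, U (s + t) x = U s (U t x)).
Variables (vphi vpsi vpsi' : E).
Hypotheses (gphi : generator (ip := ip) U phi vphi)
  (gpsi : generator (ip := ip) U psi vpsi)
  (gpsi' : generator (ip := ip) U psi' vpsi').

(** Up to null vectors the new pair is the image of the old one under an orthogonal 2 x 2 matrix. A
    skew form in two dimensions is multiplied by the determinant, which is 1 or -1. *)
Lemma eigenbasis_frequency : `|ip phi' vpsi'| = `|ip phi vpsi|.
Proof.
have psiphi : ip psi phi = 0 by rewrite (ipC ipP).
have sk x vx y vy : generator (ip := ip) U x vx -> generator (ip := ip) U y vy ->
  ip x vy = - ip vx y by exact: generator_skew.
have := expansion (or_intror epsi'); have := expansion (or_introl ephi').
move: (ip phi phi') (ip psi phi') (ip phi psi') (ip psi psi') => a b c d /= hp hq.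
have pE y : ip phi' y = a * ip phi y + b * ip psi y.
  by have := ip_null ipP y hp; rewrite !ipE; lra.
have qE y : ip y psi' = c * ip y phi + d * ip y psi.
  by have := ip_null ipP y hq; rewrite !ipE !(ipC ipP y); lra.
have qE' y : ip psi' y = c * ip phi y + d * ip psi y.
  by rewrite (ipC ipP) qE !(ipC ipP y).
have h1 : a ^+ 2 + b ^+ 2 = 1.
  by move: phi'1; rewrite pE !(ipC ipP _ phi') !pE phi1 psi1 phipsi psiphi; lra.
have h2 : c ^+ 2 + d ^+ 2 = 1.
  by move: psi'1; rewrite qE !qE' phi1 psi1 phipsi psiphi; lra.
have h3 : a * c + b * d = 0.
  by move: phi'psi'; rewrite qE !pE phi1 psi1 phipsi psiphi; lra.
have s1 := sk _ _ _ _ gphi gphi; have s2 := sk _ _ _ _ gpsi gpsi.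
have s3 := sk _ _ _ _ gphi gpsi; have s4 := sk _ _ _ _ gpsi gphi.
have -> : ip phi' vpsi' = (a * d - b * c) * ip phi vpsi.
  rewrite pE (sk _ _ _ _ gphi gpsi') (sk _ _ _ _ gpsi gpsi') !qE.
  move: s1 s2 s3 s4; rewrite !(ipC ipP _ vphi) !(ipC ipP _ vpsi).
  move: (ip vphi _) (ip vpsi _) (ip vphi _) (ip vpsi _) => x y z t *.
  nra.
rewrite normrM (_ : `|_| = 1) ?mul1r//.
apply/eqP; rewrite -(@eqrXn2 _ 2)// expr1n real_normK ?num_real//; apply/eqP.
have -> : (a * d - b * c) ^+ 2 =
  (a ^+ 2 + b ^+ 2) * (c ^+ 2 + d ^+ 2) - (a * c + b * d) ^+ 2 by ring.
by rewrite h1 h2 h3 expr0n subr0 mulr1.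
Qed.

End eigenbasis_rotation.

(** * The Koopman group *)

Section koopman_group.
Context d (T : measurableType d) {R : realType} (mu : probability T R).
Local Notation E2 := (E2 mu).
Local Notation rip2 := (@rip2 _ _ R mu).
Local Notation ipnorm := (ipnorm (ip := rip2)).
Local Notation ipP := (rip2_semi_inner mu).
Local Notation cpx := (@cpx _ _ R mu).
Variable Phi : R -> T -> T.
Hypotheses (hPhi : forall t, measure_preserving mu (Phi t))
  (Phi0 : forall x, Phi 0 x = x)
  (PhiD : forall s t x, Phi (s + t) x = Phi s (Phi t x)).

Definition compgroup (t : R) : E2 -> E2 := compop (hPhi t).
Local Notation U := compgroup.
Local Notation generator := (generator (ip := rip2) U).

Lemma compgroup_lin t a x y : U t (a *: x + y) = a *: U t x + U t y.
Proof. exact: compop_lin. Qed.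

Lemma compgroup_iso t x y : rip2 (U t x) (U t y) = rip2 x y.
Proof. exact: compop_isometry. Qed.

Lemma compgroup_0 x : U 0 x = x.
Proof. by apply/LfuneqP => y; apply: (congr1 x). Qed.

Lemma compgroup_D s t x : U (s + t) x = U s (U t x).
Proof. by apply/LfuneqP => y; apply: (congr1 x); rewrite addrC PhiD. Qed.

Lemma koopman_cpx t a b : koopman Phi t (cpx a b) = cpx (U t a) (U t b).
Proof. by []. Qed.

Lemma l2norm_cvg0 (f g : R -> E2) (u : R -> T -> R[i]) :
  (forall t, u t = cpx (f t) (g t)) ->
  ((fun t => l2norm mu (u t)) @ (0 : R)^' --> (0 : R)) <->
  (forall e, 0 < e -> \forall t \near (0 : R)^', ipnorm (f t) <= e) /\
  (forall e, 0 < e -> \forall t \near (0 : R)^', ipnorm (g t) <= e).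
Proof.
move=> uE; split=> [h|[hf hg]].
  split=> e e0; move/cvgrPdist_le : h => /(_ e e0); apply: filterS => t.
    rewrite uE sub0r normrN; apply: le_trans.
    by rewrite (le_trans (l2norm_cpx_ge (f t) (g t)).1)// ler_norm.
  rewrite uE sub0r normrN; apply: le_trans.
  by rewrite (le_trans (l2norm_cpx_ge (f t) (g t)).2)// ler_norm.
apply/cvgrPdist_le => e e0; have e2 : 0 < e / 2 by rewrite divr_gt0.
apply: filterS2 (hf _ e2) (hg _ e2) => t ht ht'.
rewrite uE sub0r normrN ger0_norm ?sqrtr_ge0//.
rewrite (le_trans (l2norm_cpx_le _ _))//.
by rewrite (splitr e) lerD.
Qed.

Lemma koopman_deriv_cpx a b G : koopman_deriv mu Phi (cpx a b) G <->
  exists va vb, [/\ G = cpx va vb, generator a va & generator b vb].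
Proof.
have key va vb t : (fun x => (t^-1)%:C * (koopman Phi t (cpx a b) x - cpx a b x) -
    cpx va vb x) =
    cpx (t^-1 *: (U t a - a) - va) (t^-1 *: (U t b - b) - vb).
  apply/funext => x; apply: complex_ext; rewrite !complexE /= mul0r.
    by rewrite subr0.
  by rewrite addr0.
split=> [[/L2P[va [vb ->]]]|[va [vb [-> ha hb]]]].
  by move=> /(l2norm_cvg0 (key va vb))[ha hb]; exists va, vb.
by split; [exact: L2_cpx|exact/(l2norm_cvg0 (key va vb))].
Qed.

Lemma koopman_gen_dom_cpx a b va vb : generator a va -> generator b vb ->
  koopman_gen_dom mu Phi (cpx a b).
Proof.
move=> ha hb; split; first exact: L2_cpx.
by exists (cpx va vb); apply/koopman_deriv_cpx; exists va, vb.
Qed.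

(** [koopman_gen] picks some representative of the derivative, so its parts need not be [va] and
    [vb]; only the generator relation is known of them. *)
Lemma koopman_gen_cpx a b va vb : generator a va -> generator b vb ->
  exists wa wb, [/\ koopman_gen mu Phi (cpx a b) = cpx wa wb,
    generator a wa & generator b wb].
Proof.
move=> ha hb; apply/koopman_deriv_cpx.
apply: (@xgetPex _ (cst 0) [set g | koopman_deriv mu Phi (cpx a b) g]).
by exists (cpx va vb); apply/koopman_deriv_cpx; exists va, vb.
Qed.

Lemma generatorZ c a va : generator a va -> generator (c *: a) (c *: va).
Proof.
move=> ha e e0; have c1 : 0 < `|c| + 1 by rewrite ltr_wpDl.
apply: filterS (ha _ (divr_gt0 e0 c1)) => s.
have UZ : U s (c *: a) = c *: U s a.
  by apply/LfuneqP => x.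
rewrite UZ -scalerBr scalerA (mulrC s^-1) -scalerA -scalerBr (ipnormZ ipP).
rewrite ler_pdivlMr// => /(le_trans _); apply.
by rewrite mulrC ler_wpM2l ?ipnorm_ge0 ?lerDl.
Qed.

Lemma generator0 : generator 0 0.
Proof.
move=> e e0; apply: filterE => s.
have -> : U s 0 = 0 by apply/LfuneqP.
rewrite !subr0 scaler0 ipnormE.
by rewrite -(scale0r 0) (ipZl ipP) mul0r sqrtr0 ltW.
Qed.

Variables (phi psi vphi vpsi : E2).
Hypotheses (gphi : generator phi vphi) (gpsi : generator psi vpsi).

Local Notation c := ((Num.sqrt 2)^-1 : R).

Lemma sqr_invsqrt2 : c * c = 2^-1.
Proof. by rewrite -expr2 exprVn sqr_sqrtr. Qed.

Lemma zfun_cpx : zfun phi psi = cpx (c *: phi) (c *: psi).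
Proof.
by apply/funext => x; apply: complex_ext; rewrite !complexE /= mul0r ?subr0 ?addr0.
Qed.

Let sk x vx y vy : generator x vx -> generator y vy -> rip2 x vy = - rip2 vx y.
Proof. exact: (generator_skew ipP compgroup_iso compgroup_0 compgroup_D). Qed.

(** Skewness kills the real part of <z, V z>. It also removes the unknown representative
    [wa +i* wb], by moving the generator to the other argument. *)
Lemma freq_rip : freq mu Phi phi psi = (rip2 phi vpsi)%:C.
Proof.
have hP := generatorZ c gphi; have hQ := generatorZ c gpsi.
rewrite /freq zfun_cpx; have [wa [wb [-> ga gb]]] := koopman_gen_cpx hP hQ.
rewrite inner_cpx.
have e1 : rip2 (c *: phi) wa = 0.
  rewrite (sk hP ga); have := sk hP hP; rewrite (ipC ipP (_ *: phi)).
  by move: (rip2 _ _) => x; lra.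
have e2 : rip2 (c *: psi) wb = 0.
  rewrite (sk hQ gb); have := sk hQ hQ; rewrite (ipC ipP (_ *: psi)).
  by move: (rip2 _ _) => x; lra.
have e3 : rip2 (c *: phi) wb = rip2 phi vpsi / 2.
  rewrite (sk hP gb) (ipZl ipP) (ipZr ipP) mulrA sqr_invsqrt2 (sk gphi gpsi).
  by move: (rip2 _ _) => x; lra.
have e4 : rip2 (c *: psi) wa = - (rip2 phi vpsi / 2).
  rewrite (sk hQ ga) (ipZl ipP) (ipZr ipP) mulrA sqr_invsqrt2 (ipC ipP vpsi).
  by move: (rip2 _ _) => x; lra.
rewrite e1 e2 e3 e4 addr0 opprK -splitr.
have -> : 0 +i* rip2 phi vpsi = 'i%C * (rip2 phi vpsi)%:C.
  by apply: complex_ext; rewrite complexE /=; lra.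
rewrite mulrA mulVf ?mul1r//; apply/eqP => /(congr1 (@complex.Im R))/= /eqP.
by rewrite oner_eq0.
Qed.

Lemma inner_koopman_gen : inner mu (cfun psi) (koopman_gen mu Phi (cfun phi)) =
  (- rip2 phi vpsi)%:C.
Proof.
have -> : cfun psi = cpx psi 0 by [].
have -> : cfun phi = cpx phi 0 by [].
have [wa [wb [-> ga gb]]] := koopman_gen_cpx gphi generator0.
rewrite inner_cpx (sk gpsi ga) (sk gpsi gb) (sk generator0 gb) (sk generator0 ga).
have z x : rip2 0 x = 0 by rewrite -(scale0r 0) (ipZl ipP) mul0r.
rewrite (ipC ipP _ 0) !z (ipC ipP vpsi).
by apply: complex_ext; rewrite /= ?oppr0 ?addr0 ?subr0.
Qed.

Lemma autocorr_pair t : autocorr mu Phi phi psi t =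
  pair_re (ip := rip2) U phi psi t +i* pair_im (ip := rip2) U phi psi t.
Proof.
rewrite /autocorr zfun_cpx koopman_cpx inner_cpx.
have UZ a : U t (c *: a) = c *: U t a by apply/LfuneqP.
rewrite !UZ !(ipZl ipP) !(ipZr ipP) !mulrA sqr_invsqrt2 /pair_re /pair_im.
by rewrite -mulrDr -mulrBr !(mulrC 2^-1).
Qed.

Lemma l2norm_zfun : rip2 phi phi = 1 -> rip2 psi psi = 1 ->
  l2norm mu (zfun phi psi) = 1.
Proof.
move=> p1 q1; rewrite zfun_cpx l2norm_cpx !(ipZl ipP) !(ipZr ipP) p1 q1 !mulr1.
rewrite sqr_invsqrt2 (_ : _ + _ = 1) ?sqrtr1//; lra.
Qed.

End koopman_group.

Lemma Rintegral_affine (R : realType) (p q t : R) : 0 <= t ->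
  \int[lebesgue_measure]_(u in `[0, t]) (p * u + q) = p * t ^+ 2 / 2 + q * t.
Proof.
rewrite le_eqVlt => /predU1P[<-|t0].
  by rewrite set_itv1 Rintegral_set1 expr0n /=; lra.
have dF (u : R) : is_derive u 1 (fun u : R => p * u ^+ 2 / 2 + q * u : R) (p * u + q).
  have hid : is_derive u 1 (fun x : R => x) (1 : R) by exact: is_derive_id.
  have h := is_derive_funD (is_derive_funZ (p / 2) (is_derive_funM hid hid))
    (is_derive_scaled q u).
  rewrite (_ : (fun u : R => _) = (fun x => p / 2 * (x * x) + q * x)); last first.
    by apply/funext => x; ring.
  by apply: is_derive_eq h _; field.
have cF : continuous (fun u : R => p * u ^+ 2 / 2 + q * u : R).
  by move=> u; apply: differentiable_continuous; apply/derivable1_diffP; case: (dF u).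
rewrite /Rintegral (@continuous_FTC2 _ _ (fun u : R => p * u ^+ 2 / 2 + q * u))//=.
- by rewrite expr0n /= mulr0 mul0r mulr0 addr0 subr0.
- apply: continuous_subspaceT => u; apply: cvgD; last exact: cvg_cst.
  by apply: cvgM; [exact: cvg_cst|exact: cvg_id].
- split.
  + by move=> u _; case: (dF u).
  + exact/cvg_at_right_filter/cF.
  + exact/cvg_at_left_filter/cF.
- by move=> u _; rewrite derive1E; case: (dF u).
Qed.

Lemma derive_quotient_cvg (R : realType) (f : R -> R) (l : R) :
  is_derive (0 : R) 1 f l -> (fun s : R => s^-1 * (f s - f 0)) @ 0^' --> l.
Proof.
move=> [d <-]; have c : (fun s : R => s^-1 *: (f (s *: 1 + 0) - f 0)) @ 0^'
  --> 'D_1 f 0 by exact: d.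
apply: cvg_trans c; apply: near_eq_cvg; apply: filterE => s.
by rewrite addr0 -[s *: 1]/(s * 1) mulr1.
Qed.

(** * The estimates for the complex function [z] *)

Section coherent_state.
Context d (T : measurableType d) {R : realType} (mu : probability T R).
Local Notation E2 := (E2 mu).
Local Notation rip2 := (@rip2 _ _ R mu).
Local Notation ipnorm := (ipnorm (ip := rip2)).
Local Notation ipP := (rip2_semi_inner mu).
Local Notation cpx := (@cpx _ _ R mu).
Variable Phi : R -> T -> T.
Hypotheses (hPhi : forall t, measure_preserving mu (Phi t))
  (Phi0 : forall x, Phi 0 x = x)
  (PhiD : forall s t x, Phi (s + t) x = Phi s (Phi t x)).
Local Notation U := (compgroup hPhi).
Local Notation generator := (generator (ip := rip2) U).
Variable K : E2 -> E2.
Hypothesis KP : positive_compact (ip := rip2) K.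
Variables (phi psi vphi vpsi : E2) (lam nu W c del : R).
Hypotheses (phi1 : rip2 phi phi = 1) (psi1 : rip2 psi psi = 1)
  (phipsi : rip2 phi psi = 0) (ephi : eigvec (ip := rip2) K lam phi)
  (epsi : eigvec (ip := rip2) K nu psi)
  (lam0 : 0 < lam) (lamnu : lam <= nu)
  (nonres : forall f, orthocomplement (ip := rip2) phi psi f ->
    eigvec (ip := rip2) K lam f \/ eigvec (ip := rip2) K nu f -> rip2 f f = 0)
  (gphi : generator phi vphi) (gpsi : generator psi vpsi)
  (phiW : ipnorm vphi <= W) (psiW : ipnorm vpsi <= W)
  (c0 : 0 <= c) (nud : nu - lam <= del)
  (UK : forall t x, 0 <= t -> ipnorm (K (U t x) - U t (K x)) <= c * t * ipnorm x).

Local Notation a := (pair_re (ip := rip2) U phi psi).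
Local Notation b := (pair_im (ip := rip2) U phi psi).
Local Notation w := (rip2 phi vpsi).
Local Notation p := (pair_bound (ip := rip2) K lam nu W c del).
Local Notation alpha := (autocorr mu Phi phi psi).
Local Notation z := (zfun phi psi).

Let U_lin := compgroup_lin hPhi.
Let U_iso := compgroup_iso hPhi.
Let U_0 := compgroup_0 hPhi Phi0.
Let U_D := compgroup_D hPhi PhiD.

Lemma koopman_defect t : l2norm mu (fun x => koopman Phi t z x - alpha t * z x) =
  Num.sqrt (1 - (a t ^+ 2 + b t ^+ 2)).
Proof.
rewrite (autocorr_pair hPhi) zfun_cpx.
pose r := (Num.sqrt 2)^-1 : R.
have -> : (fun x => koopman Phi t (cpx (r *: phi) (r *: psi)) x -
    (a t +i* b t) * cpx (r *: phi) (r *: psi) x) =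
    cpx (r *: (U t phi - (a t *: phi - b t *: psi)))
        (r *: (U t psi - (b t *: phi + a t *: psi))).
  apply/funext => x.
  rewrite -[cpx (r *: phi) (r *: psi) x]/((r * phi x) +i* (r * psi x)).
  rewrite -[koopman _ _ _ x]/((r * phi (Phi t x)) +i* (r * psi (Phi t x))).
  rewrite -[RHS]/((r * (phi (Phi t x) - (a t * phi x - b t * psi x))) +i*
    (r * (psi (Phi t x) - (b t * phi x + a t * psi x)))).
  move: (a t) (b t) (phi x) (psi x) (phi _) (psi _) => ? ? ? ? ? ?.
  by apply: complex_ext; rewrite !complexE /=; ring.
rewrite l2norm_cpx !(ipZl ipP) !(ipZr ipP) !mulrA sqr_invsqrt2 -mulrDr.
by rewrite (pair_defect ipP U_iso phi1 psi1 phipsi) mulrA mulVf ?mul1r.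
Qed.

Lemma coherent_state_defect_le t S : 0 <= t -> 2 * p t <= S ->
  l2norm mu (fun x => koopman Phi t z x - alpha t * z x) <= Num.sqrt S.
Proof.
move=> t0 pS; rewrite koopman_defect ler_wsqrtr// (le_trans _ pS)//.
exact: (pair_modulus_bound ipP U_lin U_iso U_0 U_D KP phi1 psi1 phipsi ephi epsi
  lam0 lamnu nonres gphi gpsi phiW psiW c0 nud UK).
Qed.

Lemma phase_le t S : 0 <= t -> 2 * p t <= S ->
  normc (alpha t - cexp ('i%C * w%:C * t%:C)) <= 2 * Num.sqrt S.
Proof.
move=> t0 pS; have p0 : 0 <= p t by exact: (pair_bound_ge0 K lamnu phiW c0 nud).
have -> : cexp ('i%C * w%:C * t%:C) = cos (w * t) +i* sin (w * t).
  rewrite /cexp !complexE /=.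
  have -> : (0 * w - 1 * 0) * t - (0 * 0 + 1 * w) * 0 = 0 by move: w => x; ring.
  have -> : (0 * w - 1 * 0) * 0 + (0 * 0 + 1 * w) * t = w * t by move: w => x; ring.
  by rewrite expR0 mul1r.
rewrite (autocorr_pair hPhi) normcE !complexE /=.
have le : (a t - cos (w * t)) ^+ 2 + (b t - sin (w * t)) ^+ 2 <= p t ^+ 2.
  exact: (pair_phase_bound ipP U_lin U_iso U_0 U_D KP phi1 psi1 phipsi ephi epsi
    lam0 lamnu nonres gphi gpsi phiW psiW nud UK).
have ab : a t ^+ 2 + b t ^+ 2 <= 1 by exact: (pair_modulus_le1 ipP U_iso phi1 psi1 phipsi).
move: le ab (cos2Dsin2 (w * t)) p0 pS.
move: (a t) (b t) (cos _) (sin _) (p t) => x y k l q le ab kl q0 qS.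
rewrite -(@ler_pXn2r _ 2)// ?nnegrE ?mulr_ge0 ?sqrtr_ge0//.
rewrite exprMn !sqr_sqrtr; last 2 first.
- by lra.
- by rewrite addr_ge0 ?sqr_ge0.
(* Both points lie in the closed unit disc. *)
have X4 : (x - k) ^+ 2 + (y - l) ^+ 2 <= 4.
  by have := sqr_ge0 (x + k); have := sqr_ge0 (y + l); lra.
move: X4 le; move: (_ + _) => X X4 le.
(* For q <= 2 one has q^2 <= 2 q <= S; for larger q the trivial bound 4 is below 2 q <= S. *)
have [q2|q2] := leP q 2; nra.
Qed.

Lemma autocorr_derivative :
  (fun t : R => normc ((t^-1)%:C * (alpha t - alpha 0) - 'i%C * w%:C))
    @ 0^' --> (0 : R).
Proof.
have [/derive_quotient_cvg da /derive_quotient_cvg db] :=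
  pair_initial_derivative ipP U_iso U_0 U_D phi1 psi1 phipsi gphi gpsi.
apply/cvgrPdist_le => e e0; have e2 : 0 < e / 2 by rewrite divr_gt0.
move/cvgrPdist_le : da => /(_ _ e2) da; move/cvgrPdist_le : db => /(_ _ e2).
apply: filterS2 da => s; rewrite sub0r normrN distrC => ha hb.
rewrite sub0r normrN !(autocorr_pair hPhi) normcE ger0_norm ?sqrtr_ge0//.
rewrite (le_trans (sqrt_sum_sqr_le _ _))// (splitr e) lerD//.
  rewrite (le_trans _ ha)// !complexE /= le_eqVlt; apply/orP; left; apply/eqP.
  by congr `|_|; rewrite !mul0r mul1r !subrr !subr0.
rewrite (le_trans _ hb)// !complexE /= le_eqVlt; apply/orP; left; apply/eqP.
by congr `|_|; rewrite !mul0r mul1r !addr0 ?add0r.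
Qed.

End coherent_state.

(** * The complex integral operator and the domain of the generator *)

Section koopman_kernel.
Context {R : realType} {Omega : pmetricType R}.
Variables (mu : probability (borel Omega) R) (X : set Omega).
Hypotheses (cX : compact X) (muX : mu X = 1%E).
Variables (k : Omega -> Omega -> R) (B : R).
Hypothesis hk : uniform_kernel X k B.
Local Notation rip2 := (@rip2 _ _ R mu).
Local Notation ipnorm := (ipnorm (ip := rip2)).
Local Notation ipP := (rip2_semi_inner mu).
Local Notation cpx := (@cpx _ _ R mu).
Local Notation kop := (kop cX muX hk).
Local Notation K := (integral_operator mu k).

Lemma integral_operator_cpx f g : K (cpx f g) = cpx (kop f) (kop g).
Proof.
apply/funext => x; rewrite -[RHS]/(kint hk f x +i* kint hk g x).
rewrite /integral_operator /Cintegral; congr (_ +i* _);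
  apply: eq_Rintegral => y _; rewrite complexE /= mul0r.
  by rewrite subr0.
by rewrite addr0.
Qed.

Lemma kop_ge0 : (forall f, L2 mu f -> 0 <= inner mu f (K f)) ->
  forall f, 0 <= rip2 f (kop f).
Proof.
move=> h f; have := h _ (L2_cpx f 0).
rewrite integral_operator_cpx inner_cpx lecE /= => /andP[_].
suff -> : rip2 0 (kop 0) = 0 by rewrite addr0.
by rewrite -(scale0r 0) (ipZl ipP) mul0r.
Qed.

Variable Phi : R -> Omega -> Omega.
Hypothesis hPhi : forall t, measure_preserving mu (Phi t).
Local Notation U := (compgroup hPhi).
Local Notation generator := (generator (ip := rip2) U).

(** Needed because an eigenvector equals [u^-1 *: kop f] only up to a null vector; an isometry keeps
    null vectors null. *)
Lemma generator_null a b va : generator a va -> rip2 (b - a) (b - a) = 0 ->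
  generator b va.
Proof.
move=> ga h e e0; apply: filterS (ga e e0) => s; apply: le_trans.
have -> : s^-1 *: (U s b - b) - va =
    (s^-1 *: (U s a - a) - va) + s^-1 *: (U s (b - a) - (b - a)).
  rewrite addrAC -scalerDr; congr (_ *: _ - _).
  have -> : U s (b - a) = U s b - U s a by apply/LfuneqP.
  by rewrite opprB addrA (addrC (U s a - a)) !subrKA.
rewrite (le_trans (ipnormD ipP _ _))// (ipnormZ ipP) -{2}[ipnorm _]addr0 lerD2l.
rewrite mulr_ge0_le0//.
rewrite (le_trans (ipnormD ipP _ _))// (ipnormN ipP) !ipnormE compgroup_iso h.
by rewrite sqrtr0 addr0.
Qed.

Lemma eigvec_generator (kappa : Omega -> Omega -> R) C u f :
  (forall x y, X x -> X y -> `|kappa x y| <= C) -> 0 <= C ->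
  (forall e, 0 < e -> \forall s \near 0^', forall x y, X x -> X y ->
     `|s^-1 * (k (Phi s x) y - k x y) - kappa x y| <= e) ->
  eigvec (ip := rip2) kop u f -> 0 < u ->
  exists2 vf, generator f vf & ipnorm vf <= C / u * ipnorm f.
Proof.
move=> kC C0 kq ef u0.
have [g [gC gg]] := kop_derivative cX muX hk hPhi f kC C0 kq.
have {}gg : generator (kop f) g by exact: gg.
exists (u^-1 *: g); last first.
  rewrite (ipnormZ ipP) gtr0_norm ?invr_gt0// mulrAC -[leRHS]mulrC ler_pM2l//.
  by rewrite invr_gt0.
apply: (generator_null (generatorZ u^-1 gg)).
have -> : f - u^-1 *: kop f = - u^-1 *: (kop f - u *: f).
  by rewrite scalerBr scalerA mulNr mulVf ?gt_eqF// scaleN1r opprK addrC scaleNr.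
by rewrite (ipZl ipP) (ipZr ipP) ef !mulr0.
Qed.

End koopman_kernel.

Section invariant_support.
Context {R : realType} {Omega : pmetricType R}.
Variables (mu : probability (borel Omega) R) (Phi : R -> Omega -> Omega).
Hypotheses (flowP : is_flow Phi) (inv : invariant_measure mu Phi).

Let Phi_cont t : continuous (Phi t).
Proof.
have [c _ _] := flowP.
apply: (flow_comp_continuous c) => x; [exact: cvg_cst|exact: cvg_id].
Qed.

Lemma flow_measure_preserving t : measure_preserving mu (Phi t).
Proof.
by split; [exact: continuous_borel_map|exact: inv].
Qed.

Lemma msupport_invariant t x : msupport mu x -> msupport mu (Phi t x).
Proof.
move=> hx V oV Vx; rewrite -(inv t (open_borel oV)); apply: hx => //.
by apply: open_comp => // y _; exact: Phi_cont.
Qed.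

End invariant_support.

Theorem theorem1 (R : realType) (Omega : pmetricType R)
    (Y : completeNormedModType R)
    (mu : probability (borel Omega) R) (Phi : R -> Omega -> Omega)
    (M : set Omega) (n : nat) (A : atlas Omega 'rV[R]_n)
    (v : aidx A -> Omega -> 'rV[R]_n)
    (F : Omega -> Y) (h : R -> R) (T : R)
    (phi psi : borel Omega -> R) (lam nu : R) :
  (* the dynamical system *)
  is_flow Phi ->
  invariant_measure mu Phi ->
  ergodic_measure mu Phi ->
  compact (msupport mu) ->
  mu (msupport mu) = 1%E ->
  msupport mu `<=` M ->
  compact_C1_manifold M A ->
  (forall t x, 0 <= t -> M x -> M (Phi t x)) ->
  (forall t, 0 <= t -> C1selfmap A (Phi t)) ->
  generating_vector_field Phi v ->
  (* the observation map and the kernel *)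
  continuous F ->
  C1fun A F ->
  C1fun (prod_atlas A A) (dsq F) ->
  (forall s, 0 <= s -> 0 < h s) ->
  C1_on Rplus (h : R^o -> R^o) ->
  (exists B : R, forall s, 0 <= s ->
     h s <= B /\ opnorm (deriv_within Rplus (h : R^o -> R^o) s) <= B) ->
  0 < T ->
  let K := integral_operator mu (kT F Phi h T) in
  (forall f, L2 mu f -> 0 <= inner mu f (K f)) ->
  (* the eigenfunctions *)
  real_eigenbasis mu K lam nu phi psi ->
  lam != 0 -> nu != 0 -> lam <= nu ->
  (lam != nu -> has_multiplicity mu K lam%:C 1 /\ has_multiplicity mu K nu%:C 1) ->
  (lam = nu -> has_multiplicity mu K lam%:C 2) ->
  let V := koopman_gen mu Phi in
  let z := zfun phi psi in
  let alpha := autocorr mu Phi phi psi in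
  let omega := freq mu Phi phi psi in
  let gamma := spectral_gap (point_spectrum mu K) lam nu in
  let delta := (Num.sqrt 2)^-1 * (nu - lam) in
  let tdelta := delta / nu in
  let C1 := 2 * C1norm_Rplus h
              * supnorm (msupport mu `*` msupport mu) (dsq F) in
  let C2 := 2 * C1norm_Rplus h * C1norm (prod_atlas A A) (dsq F) in
  let s t := gamma^-1 * (C1 * t / T + 3 * delta) in
  let S t := C2 * vfield_opnorm v * (1 + tdelta) / lam
               * \int[lebesgue_measure]_(u in `[0, t]) s u in
  let eps t := s t + Num.sqrt (S t) in
  (* the frequency omega *)
  [/\ koopman_gen_dom mu Phi z,
      koopman_gen_dom mu Phi (cfun phi) & koopman_gen_dom mu Phi (cfun psi)] /\
  [/\ complex.Im omega = 0,
      omega = - inner mu (cfun psi) (V (cfun phi)) &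
      (fun t : R => normc ((t^-1)%:C * (alpha t - alpha 0) - 'i%C * omega))
        @ 0^' --> (0 : R)] /\
  (* (i) *)
  (forall t, 0 <= t ->
     approx_point_spectrum mu (koopman Phi t) (eps t) (alpha t) /\
     approx_eigenfunction mu (koopman Phi t) (eps t) (alpha t) z) /\
  (* (ii) *)
  (forall phi' psi', real_eigenbasis mu K lam nu phi' psi' ->
     normc (freq mu Phi phi' psi') = normc omega) /\
  (forall t, 0 <= t ->
     normc (alpha t - cexp ('i%C * omega * t%:C)) <= 2 * Num.sqrt (S t)).
Proof.
move=> flowP inv _ cX muX XM mM PhiM _ vP cF _ FC1 h0 hC1 [B hB] T0 K Kpos
  basis lam_neq0 nu_neq0 lamnu mult1 mult2 V z alpha omega gamma delta tdelta
  C1 C2 s S eps.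
have [Phi0 PhiD] : (forall x : borel Omega, Phi 0 x = x) /\
    (forall s t (x : borel Omega), Phi (s + t) x = Phi s (Phi t x)).
  by have [_ ? ?] := flowP.
have XPhi : forall t x, msupport mu x -> msupport mu (Phi t x).
  exact: msupport_invariant flowP inv.
pose hPhi := flow_measure_preserving flowP inv.
have hk := kernel_uniform flowP cX cF h0 hC1 hB T0.
pose Kr := kop cX muX hk.
have KE := integral_operator_cpx cX muX hk.
have KP : positive_compact (ip := @rip2 _ _ R mu) Kr.
  by apply: kop_positive_compact; exact: kop_ge0 Kpos.
have [P [Q [phiE psiE [P1 Q1 PQ eP eQ]]]] := real_eigenbasisP KE basis.
have ipP := rip2_semi_inner mu.
have lam0 : 0 < lam.
  have := pc_ge0 KP P; rewrite (eigvec_ipr ipP _ eP) P1 mulr1.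
  by rewrite le_eqVlt eq_sym (negbTE lam_neq0).
have nu0 : 0 < nu by exact: lt_le_trans lam0 lamnu.
have nonres f := eigenbasis_complete KP KE (f := f) mult1 mult2 P1 Q1 PQ eP eQ.
have [kappa [kC kq]] := kernel_derivative flowP cX XPhi XM mM PhiM vP cF FC1 hC1 hB T0.
set CK := C1norm_Rplus h * _ in kC.
(* A point of the support is needed to deduce [0 <= CK] from the bound on [kappa]. *)
have [x0 Xx0] : exists x, msupport mu x.
  apply/set0P/eqP => X0; have := muX; rewrite X0 measure0 => /eqP.
  by rewrite eq_sym onee_eq0.
have CK0 : 0 <= CK by exact: le_trans (normr_ge0 _) (kC _ _ Xx0 Xx0).
have gen u f : 0 < u -> eigvec (ip := @rip2 _ _ R mu) Kr u f ->
    exists2 vf, generator (ip := @rip2 _ _ R mu) (compgroup hPhi) f vf &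
      ipnorm (ip := @rip2 _ _ R mu) vf <= CK / u * ipnorm (ip := @rip2 _ _ R mu) f.
  move=> u0 ef; exact: (eigvec_generator hPhi kC CK0 kq ef u0).
have [vP' gP vPW] := gen _ _ lam0 eP.
have [vQ gQ vQW] := gen _ _ nu0 eQ.
have n1 f : rip2 f f = 1 -> ipnorm (ip := @rip2 _ _ R mu) f = 1.
  by move=> f1; rewrite /ipnorm f1 sqrtr1.
rewrite (n1 _ P1) mulr1 in vPW; rewrite (n1 _ Q1) mulr1 in vQW.
(* Since [lam <= nu], the bound for [phi] also covers [psi]; this is where 1 / lambda_T in S_t comes
   from. *)
have {}vQW : ipnorm (ip := @rip2 _ _ R mu) vQ <= CK / lam.
  by rewrite (le_trans vQW)// ler_wpM2l// lef_pV2.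
have C10 : 0 <= C1.
  rewrite /C1 !mulr_ge0//; first exact: shape_norm_ge0 hC1 hB.
  exact: supnorm_ge0.
(* The constant 3 in s_t absorbs the sqrt 2 relating [nu - lam] to [delta]. *)
have sqrt2_le3 : 1 <= 3 * (Num.sqrt 2)^-1 :> R.
  rewrite ler_pdivlMr ?mul1r ?sqrtr_gt0// -(@ler_pXn2r _ 2)// ?nnegrE//.
  by rewrite sqr_sqrtr//; lra.
have delta0 : 0 <= delta by rewrite mulr_ge0 ?invr_ge0// subr_ge0.
have nud : nu - lam <= 3 * delta.
  by rewrite /delta mulrA ler_peMl// subr_ge0.
have UK t x : 0 <= t -> ipnorm (ip := @rip2 _ _ R mu)
    (Kr (compgroup hPhi t x) - compgroup hPhi t (Kr x)) <=
    C1 / T * t * ipnorm (ip := @rip2 _ _ R mu) x.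
  move=> t0; rewrite (mulrAC C1).
  have K1 : 0 <= C1 * t / T by exact: divr_ge0 (mulr_ge0 C10 t0) (ltW T0).
  apply: (kop_commutator cX muX hk (hPhi t) x (XPhi t) K1).
  exact: (kernel_flow_le flowP cX XPhi cF hC1 hB T0 t0).
have c0 : 0 <= C1 / T := divr_ge0 C10 (ltW T0).
have gammaE : gamma = real_gap (ip := @rip2 _ _ R mu) Kr lam nu.
  exact: spectral_gap_real.
have gamma0 : 0 <= gamma by rewrite gammaE; exact: real_gap_ge0.
pose p := pair_bound (ip := @rip2 _ _ R mu) Kr lam nu (CK / lam) (C1 / T) (3 * delta).
have p0 t : 0 <= t -> 0 <= p t.
  by move=> t0; exact: (pair_bound_ge0 Kr lamnu vPW c0 nud).
have tdelta0 : 0 <= tdelta by rewrite divr_ge0// ltW.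
have s0 t : 0 <= t -> 0 <= s t.
  move=> t0; apply: mulr_ge0; first by rewrite invr_ge0.
  by apply: addr_ge0; [exact: divr_ge0 (mulr_ge0 C10 t0) (ltW T0)|exact: mulr_ge0].
(* The 2 is the one in [C2]; as [1 + tdelta >= 1], the bounds in terms of [2 * p t] pass to
   [S t]. *)
have SE t : 0 <= t -> S t = 2 * p t * (1 + tdelta).
  move=> t0; rewrite /S /s.
  have -> : \int[lebesgue_measure]_(u in `[0, t])
      (gamma^-1 * (C1 * u / T + 3 * delta)) =
      \int[lebesgue_measure]_(u in `[0, t])
        (gamma^-1 * C1 / T * u + gamma^-1 * (3 * delta)).
    by apply: eq_Rintegral => u _; move: gamma^-1 T^-1 => x y; ring.
  rewrite Rintegral_affine// /p /pair_bound -gammaE /CK /C2.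
  move: gamma^-1 T^-1 lam^-1 (1 + tdelta) => x y l q; by field.
have pS t : 0 <= t -> 2 * p t <= S t.
  move=> t0; rewrite SE//; apply: ler_peMr; last by rewrite lerDl.
  by apply: mulr_ge0 => //; exact: p0.
have zE : z = zfun P Q by rewrite /z phiE psiE.
have omegaE : omega = (rip2 P vQ)%:C.
  by rewrite /omega phiE psiE; exact: (freq_rip Phi0 PhiD gP gQ).
have z1 : l2norm mu z = 1 by rewrite zE; exact: l2norm_zfun.
have approx t : 0 <= t ->
    approx_eigenfunction mu (koopman Phi t) (eps t) (alpha t) z.
  move=> t0; split.
  - by rewrite zE zfun_cpx; exact: L2_cpx.
  - rewrite zE zfun_cpx => /aeeq_cpx0[h1 h2].
    move: z1; rewrite zE zfun_cpx l2norm_cpx h1 h2 addr0 sqrtr0 => /eqP.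
    by rewrite eq_sym oner_eq0.
  - rewrite z1 mulr1 zE /alpha phiE psiE.
    apply: (le_trans (coherent_state_defect_le Phi0 PhiD KP P1 Q1 PQ eP eQ
      lam0 lamnu nonres gP gQ vPW vQW c0 nud UK t0 (pS t t0))).
    by rewrite /eps lerDr s0.
split; [split|split; [split|split; [|split]]].
- rewrite zE zfun_cpx.
  exact: (koopman_gen_dom_cpx (generatorZ _ gP) (generatorZ _ gQ)).
- by rewrite phiE; exact: (koopman_gen_dom_cpx gP (generator0 hPhi)).
- by rewrite psiE; exact: (koopman_gen_dom_cpx gQ (generator0 hPhi)).
- by rewrite omegaE.
- rewrite omegaE /V phiE psiE (inner_koopman_gen Phi0 PhiD gP gQ).
  by apply: complex_ext; rewrite /= ?opprK ?oppr0.
- rewrite omegaE /alpha phiE psiE.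
  exact: (autocorr_derivative Phi0 PhiD P1 Q1 PQ gP gQ).
- by move=> t t0; split; [exists z|]; exact: approx.
- move=> phi' psi' basis'.
  have [P' [Q' [-> -> [P1' Q1' PQ' eP' eQ']]]] := real_eigenbasisP KE basis'.
  have [vP2 gP' _] := gen _ _ lam0 eP'; have [vQ' gQ' _] := gen _ _ nu0 eQ'.
  rewrite omegaE (freq_rip Phi0 PhiD gP' gQ') !normcE /= expr0n !addr0.
  rewrite !sqrtr_sqr.
  exact: (eigenbasis_frequency ipP KP P1 Q1 PQ eP eQ P1' Q1' PQ' eP' eQ' nonres
    (compgroup_iso hPhi) (compgroup_0 hPhi Phi0) (compgroup_D hPhi PhiD) gP gQ gQ').
- move=> t t0; rewrite omegaE /alpha phiE psiE.
  exact: (phase_le Phi0 PhiD KP P1 Q1 PQ eP eQ lam0 lamnu nonres gP gQ vPW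
    vQW c0 nud UK t0 (pS t t0)).
Qed.
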